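(* Let $\Gamma$ be a finitely generated torsion-free nilpotent group, let $\mathfrak{n}$ be its Malcev Lie algebra (a nilpotent Lie algebra over $\mathbb{Q}$) and set $\mathfrak{n}^{\mathbb{C}}=\mathbb{C}\otimes_{\mathbb{Q}}\mathfrak{n}$. The following assertions are equivalent: (i) $\Gamma$ is freely self-similar; (ii) $\Gamma$ is freely densely self-similar; (iii) the Lie algebra $\mathfrak{n}^{\mathbb{C}}$ admits a very special grading.
   Context: For a finite alphabet $A$, $A^\omega$ is the space of infinite words over $A$ with the profinite (product) topology. An action of a group $\Gamma$ on $A^\omega$ is self-similar if for every $\gamma\in\Gamma$ and $a\in A$ there exist $\gamma_a\in\Gamma$ and $b\in A$ with $\gamma(aw)=b\gamma_a(w)$ for all $w\in A^\omega$. $\Gamma$ is freely self-similar if it admits a free self-similar action on some $A^\omega$ with $A$ finite, and freely densely self-similar if it admits a free self-similar action with dense orbits on some $A^\omega$ with $A$ finite. The Malcev Lie algebra of $\Gamma$ is the unique finite-dimensional nilpotent Lie algebra $\mathfrak{n}$ over $\mathbb{Q}$ containing $\Gamma$ as a multiplicative lattice, i.e. as a finitely generated subgroup of $\mathfrak{n}$ for the Campbell–Hausdorff product which generates $\mathfrak{n}$ as a Lie algebra. A grading of a Lie algebra $\mathfrak{m}$ is a decomposition $\mathfrak{m}=\oplus_{k\in\mathbb{Z}}\mathfrak{m}_k$ with $[\mathfrak{m}_k,\mathfrak{m}_l]\subset\mathfrak{m}_{k+l}$; it is very special if $\mathfrak{m}_0=0$. *)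

(* Defs.v *)
From HB Require Import structures.
From mathcomp Require Import all_boot all_order all_algebra.
From mathcomp Require Import complex Rstruct.
Set Implicit Arguments. Unset Strict Implicit. Unset Printing Implicit Defensive.
Import Order.TTheory GRing.Theory Num.Theory.
Local Open Scope ring_scope.

Record Grp := {
  gcar :> Type;
  gmul : gcar -> gcar -> gcar;
  ginv : gcar -> gcar;
  gone : gcar;
  gmulA : forall x y z, gmul x (gmul y z) = gmul (gmul x y) z;
  gmul1g : forall x, gmul gone x = x;
  gmulVg : forall x, gmul (ginv x) x = gone }.

Arguments gmul {g}. Arguments ginv {g}. Arguments gone {g}.

Section GroupDefs.
Variable G : Grp.

Fixpoint gpow (x : G) (n : nat) : G :=
  if n is m.+1 then gmul x (gpow x m) else gone.

Definition gcomm (x y : G) : G := gmul (ginv x) (gmul (ginv y) (gmul x y)).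

Inductive gen (S : G -> Prop) : G -> Prop :=
  | gen_base x : S x -> gen S x
  | gen_one : gen S gone
  | gen_mul x y : gen S x -> gen S y -> gen S (gmul x y)
  | gen_inv x : gen S x -> gen S (ginv x).

Definition finitely_generated : Prop :=
  exists s : list G, forall g, gen (fun x => List.In x s) g.

Definition torsion_free : Prop :=
  forall (g : G) (n : nat), gpow g n.+1 = gone -> g = gone.

Fixpoint lcs (k : nat) : G -> Prop :=
  if k is k'.+1 then gen (fun z => exists x y, lcs k' y /\ z = gcomm x y)
  else fun _ => True.

Definition nilpotent_group : Prop := exists k, forall g, lcs k g -> g = gone.

End GroupDefs.

Definition scons (A : Type) (a : A) (w : nat -> A) : nat -> A :=
  fun n => if n is k.+1 then w k else a.

Section Actions.
Variables (G : Grp) (A : finType) (act : G -> (nat -> A) -> (nat -> A)).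

Definition is_action : Prop :=
  (forall w, act gone w = w) /\ (forall g h w, act (gmul g h) w = act g (act h w)).

Definition self_similar : Prop :=
  forall (g : G) (a : A), exists (ga : G) (b : A),
    forall w, act g (scons a w) = scons b (act ga w).

Definition free_action : Prop := forall g w, act g w = w -> g = gone.

(* every orbit is dense in the product topology: every finite word u is a
   prefix of some element of the orbit of w *)
Definition dense_orbits : Prop :=
  forall (w : nat -> A) (u : seq A), exists g : G,
    [seq act g w i | i <- iota 0 (size u)] = u.
End Actions.

Definition freely_self_similar (G : Grp) : Prop :=
  exists (A : finType), (0 < #|A|)%N /\
    exists act : G -> (nat -> A) -> (nat -> A),
      is_action act /\ self_similar act /\ free_action act.

Definition freely_densely_self_similar (G : Grp) : Prop :=
  exists (A : finType), (0 < #|A|)%N /\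
    exists act : G -> (nat -> A) -> (nat -> A),
      is_action act /\ self_similar act /\ free_action act /\ dense_orbits act.

Section Lie.
Variables (F : fieldType) (d : nat) (c : 'I_d -> 'I_d -> 'rV[F]_d).

(* [e_i, e_j] = c i j, extended bilinearly *)
Definition lie_br (x y : 'rV[F]_d) : 'rV[F]_d :=
  \sum_(i < d) \sum_(j < d) (x 0 i * y 0 j) *: c i j.

Definition is_lie_algebra : Prop :=
  (forall x, lie_br x x = 0) /\
  (forall x y z, lie_br x (lie_br y z) + lie_br y (lie_br z x)
                 + lie_br z (lie_br x y) = 0).

Fixpoint rnest (w : seq 'rV[F]_d) : 'rV[F]_d :=
  if w is a :: w' then (if w' is [::] then a else lie_br a (rnest w')) else 0.

Definition lie_nilpotent : Prop :=
  exists k, forall s : seq 'rV[F]_d, size s = k.+1 -> rnest s = 0.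

(* very special grading: F^d = (+)_{k in Z} V_k (direct sum, only finitely
   many nonzero pieces, which is automatic in finite dimension),
   [V_k, V_l] <= V_{k+l}, and V_0 = 0 *)
Definition very_special_grading : Prop :=
  exists (ks : seq int) (V : int -> 'M[F]_d),
    uniq ks /\ (forall k, k \notin ks -> V k = 0) /\
    mxdirect (\sum_(k <- ks) V k) /\
    (\sum_(k <- ks) V k :=: 1%:M)%MS /\
    (forall k l (x y : 'rV[F]_d), (x <= V k)%MS -> (y <= V l)%MS ->
        (lie_br x y <= V (k + l)%R)%MS) /\
    V 0 = 0.
End Lie.

(* Campbell-Hausdorff product on a nilpotent Lie algebra over Q        *)
(* (Dynkin's formula; on a nilpotent Lie algebra of dimension d all    *)
(*  brackets of length > d vanish, so truncating at total degree d     *)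
(*  gives the exact value)                                             *)
Definition dynkin_word (N n : nat) (r s : {ffun 'I_n -> 'I_N.+1}) : seq bool :=
  flatten [seq nseq (r i) true ++ nseq (s i) false | i <- enum 'I_n].

Definition bch (d : nat) (c : 'I_d -> 'I_d -> 'rV[rat]_d) (x y : 'rV[rat]_d)
  : 'rV[rat]_d :=
  \sum_(n < d.+1 | (0 < n)%N)
   \sum_(r : {ffun 'I_n -> 'I_d.+1})
    \sum_(s : {ffun 'I_n -> 'I_d.+1} |
            [forall i, (0 < r i + s i)%N] && (\sum_(i < n) (r i + s i) <= d)%N)
      (((-1) ^+ n.-1) /
        ((n%:R : rat) * (\sum_(i < n) (r i + s i))%N%:R
         * \prod_(i < n) (((r i)`!)%:R * ((s i)`!)%:R)))
      *: rnest c [seq if b then x else y | b <- dynkin_word r s].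

(* (Q^d, c) together with iota : G -> Q^d is the Malcev Lie algebra of G:
   a finite-dimensional nilpotent Lie algebra over Q containing G (via the
   injective map iota) as a subgroup for the Campbell-Hausdorff product, and
   generated by it as a Lie algebra. *)
Definition is_malcev_lie_algebra (G : Grp) (d : nat)
  (c : 'I_d -> 'I_d -> 'rV[rat]_d) (iota : G -> 'rV[rat]_d) : Prop :=
  is_lie_algebra c /\ lie_nilpotent c /\
  injective iota /\
  (forall g h : G, iota (gmul g h) = bch c (iota g) (iota h)) /\
  (forall P : 'rV[rat]_d -> Prop,
     P 0 -> (forall x y, P x -> P y -> P (x + y)) ->
     (forall (a : rat) x, P x -> P (a *: x)) ->
     (forall x y, P x -> P y -> P (lie_br c x y)) ->
     (forall g, P (iota g)) -> forall x, P x).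

Definition Cplx : fieldType := Rdefinitions.R[i].

Definition complexify (d : nat) (c : 'I_d -> 'I_d -> 'rV[rat]_d)
  : 'I_d -> 'I_d -> 'rV[Cplx]_d :=
  fun i j => map_mx (fun q : rat => (ratr q : Cplx)) (c i j).

(* Main.v *)
(* From (i) to (iii): fix a letter [a]. The pairs [(g, g')] such that [g] fixes [a]
   and has the state [g'] at [a] form a subgroup of [n x n]; since some positive
   power of every element fixes [a] and the action is free, the Lie algebra it
   spans is the graph of an automorphism [F] of [n]. If [F ^ k] had a nonzero
   fixed vector, some nontrivial group element would fix the word [aaa...], so no
   eigenvalue of [F] is a root of unity. The relations [lam mu = nu] among the
   eigenvalues then have an integral additive solution with nonzero weights, which
   grades the generalized eigenspaces.

   From (iii) to (ii): a very special grading is an invertible derivation over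
   [C]; derivations are the solutions of a rational linear system, so a generic
   rational one, [D], is invertible too. Choose two algebraic integers [x],
   [y] in the splitting field of [D], congruent to 1 modulo a large [N], all of
   whose conjugates are pairwise comaximal. For a linear functional [l] that is
   integral and nonzero on the spectrum, the multiplicative character
   [lam |-> prod_s s(x / y) ^ l(s^-1 lam)] is Galois equivariant, hence defines
   a rational automorphism [F = a b^-1] of [n] with commuting integral [a], [b],
   both congruent to 1, and [a A + b B = 1]. Restricted to the elements that it
   maps into the group, [F] is a virtual endomorphism of [G]. Bezout makes every
   level of the tree transitive, and freeness holds modulo each term of the lower
   central series because no eigenvalue of [b] is a unit. *)
From HB Require Import structures.
From mathcomp Require Import all_boot all_order all_algebra all_fingroup all_field.
From Stdlib Require ClassicalEpsilon.
From mathcomp Require Import complex Rstruct ring zify.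
Require Import Defs.
Set Implicit Arguments. Unset Strict Implicit. Unset Printing Implicit Defensive.
Import Order.TTheory GRing.Theory Num.Theory.
Local Open Scope ring_scope.

(** * The Campbell-Hausdorff product *)

(** The Campbell-Hausdorff product is given by Dynkin's series alone, so even its associativity has
    to be derived. The adjoint representation loses the centre and no faithful matrix representation
    of the Lie algebra is at hand; passing to dual numbers gets around this. The image of the group
    is not an additive lattice. It is caught between an additive lattice [Lam] and a multiple
    [m Lam], where [Lam] is built so that the product respects residue classes modulo its multiples.
    Congruence to 1 makes operators carry the image of the group into itself. Two integers [x] and
    [y] are needed because the functional [l] takes both signs: with the quotient [x / y] a nonunit
    enters the denominator [b] at every eigenvalue, whatever the sign. As [l] is not Galois
    invariant, different conjugates of [x] and of [y] appear on both sides of the fraction at one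
    and the same eigenvalue; hence all of them must be pairwise comaximal for [a] and [b] to be
    so. *)

Section TruncatedSeries.

Lemma dvdXnP (p : {poly rat}) n :
  reflect (forall i, (i < n)%N -> p`_i = 0) (dvdp 'X^n p).
Proof.
apply: (iffP idP) => [/dvdpP[q ->] i ltin | p0].
  by rewrite coefMXn ltin.
rewrite -[p](poly_take_drop n) dvdp_addl ?dvdp_mull //.
suff ->: take_poly n p = 0 by rewrite dvdp0.
by apply/polyP=> i; rewrite coef_take_poly coef0; case: ifP => // /p0.
Qed.

Definition expP K : {poly rat} := \poly_(i < K.+1) (i`!%:R)^-1.
Definition logP K : {poly rat} :=
  \poly_(i < K.+1) (if i == 0%N then 0 else (-1) ^+ i.-1 / i%:R).

Lemma dvdX_deriv (p : {poly rat}) n :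
  p`_0 = 0 -> ('X^n %| p^`())%R -> ('X^(n.+1) %| p)%R.
Proof.
move=> p0 /dvdXnP dp; apply/dvdXnP=> -[//|i] ltin.
have:= dp i ltin; rewrite coef_deriv => /eqP.
by rewrite mulrn_eq0 /= => /eqP.
Qed.

Lemma expP0 K : (expP K)`_0 = 1.
Proof. by rewrite coef_poly /= fact0 invr1. Qed.

Lemma logP0 K : (logP K)`_0 = 0.
Proof. by rewrite coef_poly. Qed.

Lemma deriv_expP K : (expP K)^`() = expP K - (K`!%:R)^-1 *: 'X^K.
Proof.
apply/polyP=> i; rewrite coef_deriv coefB coefZ coefXn !coef_poly ltnS.
case: (ltngtP i K) => [ltiK|ltKi|->].
- rewrite ltnS (ltnW ltiK) mulr0 subr0 factS natrM invfM.
  by rewrite -[X in X = _]mulr_natl mulrA divff ?mul1r // pnatr_eq0.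
- by rewrite ltnS leqNgt ltKi mul0rn mulr0 subr0.
by rewrite ltnS leqnn mulr1 subrr mul0rn.
Qed.

Lemma logP_deriv K : (1 + 'X) * (logP K)^`() = 1 - (- 'X) ^+ K.
Proof.
have ->: (logP K)^`() = \sum_(i < K) (- 'X) ^+ i.
  apply/polyP=> i; rewrite coef_deriv coef_poly coef_sum ltnS.
  have E (j : 'I_K) : true -> ((- 'X) ^+ j : {poly rat})`_i = (-1) ^+ i *+ (i == j).
    move=> _; rewrite (exprNn 'X) -signr_odd mulr_sign -[in RHS]signr_odd.
    case: (i =P j :> nat) => [->|/eqP/negPf nij].
      by case: (odd j); rewrite ?coefN coefXn eqxx.
    by case: (odd j); rewrite ?coefN coefXn nij ?oppr0.
  rewrite (eq_bigr _ E); case: ltnP => [ltiK|leKi].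
    rewrite (bigD1 (Ordinal ltiK)) //= eqxx big1 ?addr0 => [|j /negPf nij].
      by rewrite -[X in X = _]mulr_natr divfK // pnatr_eq0.
    by rewrite eq_sym -val_eqE /= in nij; rewrite nij.
  rewrite mul0rn big1 // => j _.
  by rewrite (gtn_eqF (leq_trans (ltn_ord j) leKi)).
by rewrite -[RHS]opprB subrX1 -mulNr opprB opprK.
Qed.

(** Both sides vanish at 0, so it is enough to compare derivatives: [expP] is its own derivative and
    [(1 + X) log' = 1], each up to a truncation error divisible by a [K]-th power. *)
Lemma logP_expP K : dvdp 'X^(K.+1) ((logP K \Po (expP K - 1)) - 'X).
Proof.
have dE : dvdp 'X (expP K - 1).
  by apply/(@dvdXnP _ 1)=> -[|//] _; rewrite coefB expP0 coefC subrr.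
have P0 : (logP K \Po (expP K - 1))`_0 = 0.
  rewrite -horner_coef0 horner_comp !hornerE.
  by rewrite horner_coef0 expP0 subrr horner_coef0 logP0.
apply: dvdX_deriv; first by rewrite coefB P0 coefX subrr.
rewrite derivB derivX deriv_comp derivB derivC subr0 deriv_expP.
set E := expP K in dE *; set L' := _ \Po _.
have EL' : E * L' = 1 - (1 - E) ^+ K.
  have:= congr1 (fun p => p \Po (E - 1)) (logP_deriv K).
  rewrite comp_polyM comp_polyD comp_polyX rmorph1 addrC subrK => ->.
  by rewrite comp_polyB rmorph1 rmorphXn /= rmorphN /= comp_polyX opprB.
rewrite mulrBr [L' * E]mulrC EL' [X in dvdp _ X](_ : _ =
   - ((1 - E) ^+ K + L' * ((K`!%:R)^-1 *: 'X^K))); last by ring.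
rewrite dvdpNr dvdp_add //;
  last by rewrite -scalerAr dvdpZr ?dvdp_mull // invr_eq0 pnatr_eq0 -lt0n fact_gt0.
by rewrite dvdp_exp2r // -dvdpNr opprB.
Qed.

(** The composite [Q] and the polynomial [1 + X] both solve [(1 + X) Q' = Q] modulo [X^K], and this
    equation determines the coefficients one after another from the constant one. *)
Lemma expP_logP K : dvdp 'X^(K.+1) ((expP K \Po logP K) - (1 + 'X)).
Proof.
set L := logP K; set Q := _ \Po _.
have dL : dvdp 'X L by apply/(@dvdXnP _ 1)=> -[|//] _; rewrite logP0.
have dQ : dvdp 'X^K ((1 + 'X) * Q^`() - Q).
  rewrite deriv_comp deriv_expP comp_polyB comp_polyZ comp_Xn_poly -/Q -/L.
  rewrite mulrCA logP_deriv.
  rewrite [X in dvdp _ X](_ : _ = - ((K`!%:R)^-1 *: L ^+ K) -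
    (Q - (K`!%:R)^-1 *: L ^+ K) * (- 'X) ^+ K); last by ring.
  rewrite dvdp_sub // ?dvdpNr; last by rewrite dvdp_mull // exprNn dvdp_mull.
  by rewrite dvdpZr ?invr_eq0 ?pnatr_eq0 -?lt0n ?fact_gt0 // dvdp_exp2r.
pose R := Q - (1 + 'X); rewrite -/R.
have R0 : R`_0 = 0.
  rewrite -horner_coef0 /R /Q !hornerE horner_comp !horner_coef0 logP0.
  by rewrite horner_coef0 expP0 subrr.
have dR : dvdp 'X^K ((1 + 'X) * R^`() - R).
  rewrite [X in dvdp _ X](_ : _ = (1 + 'X) * Q^`() - Q) //.
  by rewrite /R derivB derivD derivX derivC add0r; ring.
apply/dvdXnP; elim=> [//|i IH] ltiK.
move/dvdXnP: dR => /(_ i ltiK).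
rewrite coefB mulrDl mul1r coefD coefXM !coef_deriv.
rewrite IH ?(ltnW ltiK) // subr0.
case: i ltiK IH => [|i] ltiK IH /=.
  by rewrite addr0 => /eqP; rewrite mulrn_eq0 => /eqP.
by rewrite IH ?(ltnW ltiK) // mul0rn addr0 => /eqP; rewrite mulrn_eq0 => /eqP.
Qed.

End TruncatedSeries.

Section NilpotentExponential.
Variable A : algType rat.
Implicit Types x y : A.

Lemma horner_alg_eq (p q : {poly rat}) K x :
  x ^+ K = 0 -> 'X^K %| p - q -> horner_alg x p = horner_alg x q.
Proof.
move=> xK0 /dvdpP[r /(congr1 (horner_alg x))].
rewrite rmorphB rmorphM rmorphXn /= horner_algX xK0 mulr0 => /eqP.
by rewrite subr_eq0 => /eqP.
Qed.

Lemma horner_alg_comp (p q : {poly rat}) x :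
  horner_alg x (p \Po q) = horner_alg (horner_alg x q) p.
Proof.
elim/poly_ind: p => [|p c IH]; first by rewrite comp_poly0 !rmorph0.
by rewrite comp_polyD comp_polyM comp_polyX comp_polyC !rmorphD !rmorphM /= IH
  !horner_algX !horner_algC.
Qed.

Lemma horner_algE (p : {poly rat}) n x : (size p <= n)%N ->
  horner_alg x p = \sum_(i < n) p`_i *: x ^+ i.
Proof.
move=> sp; rewrite -{1}[p]coefK poly_def raddf_sum /=.
rewrite [RHS](bigID (fun i : 'I_n => (i < size p)%N)) /=.
rewrite [X in _ + X]big1 ?addr0 => [|i]; last first.
  by rewrite -leqNgt => lei; rewrite nth_default // scale0r.
rewrite -(big_ord_widen n (fun i => p`_i *: x ^+ i) sp).
by apply: eq_bigr => i _; rewrite linearZ /= rmorphXn /= horner_algX mulr_algl.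
Qed.

Definition expA K x := horner_alg x (expP K).
Definition logA K x := horner_alg x (logP K).

Lemma expAE K x : expA K x = \sum_(i < K.+1) (i`!%:R)^-1 *: x ^+ i.
Proof.
rewrite /expA (horner_algE _ (size_poly _ _)).
by apply: eq_bigr => i _; rewrite coef_poly ltn_ord.
Qed.

Lemma logAE K x :
  logA K x = \sum_(1 <= i < K.+1) ((-1) ^+ i.-1 / i%:R) *: x ^+ i.
Proof.
rewrite /logA (horner_algE _ (size_poly _ _)).
rewrite -(big_mkord xpredT (fun i => (logP K)`_i *: x ^+ i)) big_ltn //.
rewrite coef_poly scale0r add0r; apply: eq_big_nat => -[//|i] /andP[_ ltiK].
by rewrite coef_poly ltiK.
Qed.

Lemma expA0 K : expA K 0 = 1.
Proof.
rewrite expAE (bigD1 ord0) //= fact0 invr1 scale1r expr0 big1 ?addr0 // => i.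
by rewrite -val_eqE /= expr0n => /negPf ->; rewrite scaler0.
Qed.

Lemma horner_alg_nilp (p : {poly rat}) K x :
  x ^+ K = 0 -> p`_0 = 0 -> horner_alg x p ^+ K = 0.
Proof.
move=> xK0 p0; have /dvdpP[q ->] : 'X %| p.
  by apply/(@dvdXnP _ 1)=> -[|//].
rewrite -rmorphXn exprMn rmorphM /= [X in _ * X]rmorphXn /= horner_algX.
by rewrite xK0 mulr0.
Qed.

Lemma logA_expA K x : x ^+ K.+1 = 0 -> logA K (expA K x - 1) = x.
Proof.
move=> xK; rewrite -(rmorph1 (horner_alg x)) -rmorphB /logA -horner_alg_comp.
by rewrite (horner_alg_eq xK (logP_expP K)) horner_algX.
Qed.

Lemma expA_logA K x : x ^+ K.+1 = 0 -> expA K (logA K x) = 1 + x.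
Proof.
move=> xK; rewrite /expA /logA -horner_alg_comp.
by rewrite (horner_alg_eq xK (expP_logP K)) rmorphD rmorph1 /= horner_algX.
Qed.

Lemma expA_inj K x y : x ^+ K.+1 = 0 -> y ^+ K.+1 = 0 ->
  expA K x = expA K y -> x = y.
Proof. by move=> x0 y0 e; rewrite -(logA_expA x0) e logA_expA. Qed.

Lemma big_triangle (V : nmodType) N (F : nat -> nat -> V) :
  \sum_(0 <= n < N) \sum_(0 <= i < n.+1) F (n - i)%N i
    = \sum_(0 <= i < N) \sum_(0 <= j < N - i) F i j.
Proof.
transitivity (\sum_(0 <= n < N) \sum_(0 <= i < N | (i <= n)%N) F i (n - i)%N).
  apply: eq_big_nat => n /andP[_ ltnN]; rewrite big_nat_rev /= add0n.
  rewrite (big_nat_widen _ _ N) //; apply: congr_big_nat => // i /andP[] //.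
  rewrite ltnS => lein _; rewrite subSS; congr (F _ _); lia.
rewrite (exchange_big_dep_nat xpredT) //=; apply: eq_big_nat => i /andP[_ ltiN].
transitivity (\sum_(0 + i <= j < N) F i (j - i)%N).
  by rewrite [RHS](big_nat_widenl _ 0).
rewrite big_addn; apply: eq_bigr => j _.
by rewrite addnK.
Qed.

(** The product of two truncated series differs from the truncated series of the sum only above
    total degree [K], which is the part killed by the second hypothesis. *)
Lemma expA_add K x y : GRing.comm x y ->
  (forall i j, (K < i + j)%N -> x ^+ i * y ^+ j = 0) ->
  expA K (x + y) = expA K x * expA K y.
Proof.
move=> cxy nil; pose F i j := (i`!%:R)^-1 *: x ^+ i * ((j`!%:R)^-1 *: y ^+ j).
have F0 i j : (K < i + j)%N -> F i j = 0.
  by move=> /nil xy0; rewrite /F -scalerAr -scalerAl xy0 !scaler0.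
transitivity (\sum_(0 <= n < K.+1) \sum_(0 <= i < n.+1) F (n - i)%N i).
  rewrite expAE -(big_mkord xpredT (fun n => (n`!%:R)^-1 *: (x + y) ^+ n)).
  apply: eq_bigr => n _; rewrite exprDn_comm // scaler_sumr big_mkord.
  apply: eq_bigr => -[i /= lein] _; rewrite ltnS in lein.
  rewrite /F -scalerAr -scalerAl scalerA -scaler_nat scalerA; congr (_ *: _).
  have f0 k : k`!%:R != 0 :> rat by rewrite pnatr_eq0 -lt0n fact_gt0.
  rewrite -(bin_fact lein) !natrM; field.
  by rewrite !f0 pnatr_eq0 -lt0n bin_gt0 lein.
rewrite big_triangle !expAE mulr_suml big_mkord; apply: eq_bigr => i _.
rewrite mulr_sumr -(big_mkord xpredT (fun j => F i j)).
rewrite [RHS](@big_cat_nat _ _ _ (K.+1 - i)) ?leq_subr //= [X in _ = _ + X]big1_seq ?addr0 //.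
move=> j /andP[_]; rewrite mem_index_iota => /andP[lej _]; apply: F0.
by rewrite -leq_subLR.
Qed.

End NilpotentExponential.

(** * Sums over words in two letters *)

Section DynkinSum.
Variables (V : lmodType rat) (K : nat).
Implicit Types (g : seq bool -> V) (w : seq bool).

(* [Tsum n g] is the sum of [g (X^r1 Y^s1 ... X^rn Y^sn) / (r1! s1! ... rn! sn!)]
   over exponents at most [K] with all [r_i + s_i > 0]. *)
Fixpoint Tsum n g : V :=
  if n is n'.+1 then
    \sum_(r < K.+1) \sum_(s < K.+1 | (0 < r + s)%N)
      ((r`!)%:R * (s`!)%:R)^-1 *:
        Tsum n' (fun w => g (nseq r true ++ nseq s false ++ w))
  else g [::].

(** When [g] evaluates words in an associative algebra, this is the truncation of
    [log (exp x * exp y)]. Leaving [g] arbitrary lets one sum serve associative words, nested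
    commutators and Lie brackets. *)
Definition BCHsum g : V :=
  \sum_(1 <= n < K.+1) ((-1) ^+ n.-1 / n%:R) *: Tsum n g.

Lemma Tsum_eq n g g' : (forall w, (n <= size w)%N -> g w = g' w) ->
  Tsum n g = Tsum n g'.
Proof.
elim: n g g' => [|n IH] g g' e /=; first exact: e.
apply: eq_bigr => r _; apply: eq_bigr => s rs; congr (_ *: _).
apply: IH => w nw; apply: e; rewrite !size_cat !size_nseq; lia.
Qed.

Lemma BCHsum_eq g g' : (forall w, (0 < size w)%N -> g w = g' w) ->
  BCHsum g = BCHsum g'.
Proof.
move=> e; apply: eq_big_nat => n /andP[n0 _]; congr (_ *: _).
by apply: Tsum_eq => w nw; apply: e; apply: leq_trans nw.
Qed.

Lemma Tsum0 n : Tsum n (fun=> 0) = 0.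
Proof.
elim: n => //= n IH; rewrite big1 // => r _; rewrite big1 // => s _.
by rewrite IH scaler0.
Qed.

Lemma TsumD n g g' : Tsum n (fun w => g w + g' w) = Tsum n g + Tsum n g'.
Proof.
elim: n g g' => //= n IH g g'; rewrite -big_split; apply: eq_bigr => r _.
by rewrite -big_split; apply: eq_bigr => s _; rewrite IH scalerDr.
Qed.

Lemma BCHsum0 : BCHsum (fun=> 0) = 0.
Proof. by rewrite /BCHsum big1 // => n _; rewrite Tsum0 scaler0. Qed.

Lemma BCHsumD g g' : BCHsum (fun w => g w + g' w) = BCHsum g + BCHsum g'.
Proof.
by rewrite -big_split; apply: eq_bigr => n _; rewrite TsumD scalerDr.
Qed.

Lemma BCHsum_sum (I : Type) (r : seq I) (P : pred I) (h : I -> seq bool -> V) :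
  BCHsum (fun w => \sum_(i <- r | P i) h i w) = \sum_(i <- r | P i) BCHsum (h i).
Proof.
elim: r => [|i r IH].
  by rewrite big_nil -[RHS]BCHsum0; apply: BCHsum_eq => w _; rewrite big_nil.
rewrite big_cons -IH; case: ifP => Pi; last first.
  by apply: BCHsum_eq => w _; rewrite big_cons Pi.
by rewrite -BCHsumD; apply: BCHsum_eq => w _; rewrite big_cons Pi.
Qed.

(** The parameter [T] lets properties of whole maps, such as polynomial dependence on a parameter,
    pass through the sum; a property of single values is the case of a one-point [T]. *)
Lemma BCHsum_curve (T : Type) (P : (T -> V) -> Prop) (g : T -> seq bool -> V) :
  (forall f f', f =1 f' -> P f -> P f') ->
  P (fun=> 0) -> (forall f f', P f -> P f' -> P (fun t => f t + f' t)) ->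
  (forall (a : rat) f, P f -> P (fun t => a *: f t)) ->
  (forall w, (0 < size w)%N -> P (fun t => g t w)) -> P (fun t => BCHsum (g t)).
Proof.
move=> ext P0 PD PZ Pg.
have Psum (I : eqType) (r : seq I) (Q : pred I) (F : I -> T -> V) :
    (forall i, i \in r -> Q i -> P (F i)) -> P (fun t => \sum_(i <- r | Q i) F i t).
  elim: r => [|i r IH] PF.
    by apply: (ext (fun=> 0)) => // t; rewrite big_nil.
  case Qi : (Q i).
    apply: (ext (fun t => F i t + \sum_(j <- r | Q j) F j t)).
      by move=> t; rewrite big_cons Qi.
    apply: (PD _ _); first by apply: PF; rewrite ?mem_head.
    by apply: IH => j jr Qj; apply: PF; rewrite // inE jr orbT.
  apply: (ext (fun t => \sum_(j <- r | Q j) F j t)).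
    by move=> t; rewrite big_cons Qi.
  by apply: IH => j jr Qj; apply: PF; rewrite // inE jr orbT.
apply: (Psum _ _ _ _) => n; rewrite mem_index_iota => /andP[n0 _] _; apply: (PZ _ _).
have {n0 Pg} : forall w, (n <= size w)%N -> P (fun t => g t w).
  by move=> w nw; apply: Pg; apply: leq_trans nw.
elim: n g => [|n IH] g Pg /=; first exact: Pg.
apply: (Psum _ _ _ _) => r _ _; apply: (Psum _ _ _ _) => s _ rs; apply: (PZ _ _).
apply: IH => w nw; apply: Pg; rewrite !size_cat !size_nseq; lia.
Qed.

Lemma BCHsum_ind (P : V -> Prop) g :
  P 0 -> (forall x y, P x -> P y -> P (x + y)) ->
  (forall (a : rat) x, P x -> P (a *: x)) ->
  (forall w, (0 < size w)%N -> P (g w)) -> P (BCHsum g).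
Proof.
move=> P0 PD PZ Pg; apply: (@BCHsum_curve unit (fun f => P (f tt)) (fun=> g)) => //.
  by move=> f f' <-.
- by move=> f f'; apply: PD.
by move=> a f; apply: PZ.
Qed.

End DynkinSum.

Section DynkinSumMorphism.
Variables (V W : lmodType rat) (phi : V -> W).
Hypothesis lin_phi : linear phi.

Let phi0 : phi 0 = 0.
Proof. by have := lin_phi (-1) 0 0; rewrite scaler0 addr0 scaleN1r addNr. Qed.

Let phiD : {morph phi : x y / x + y}.
Proof. by move=> x y; have := lin_phi 1 x y; rewrite !scale1r. Qed.

Let phiZ a x : phi (a *: x) = a *: phi x.
Proof. by have := lin_phi a x 0; rewrite phi0 !addr0. Qed.

Lemma Tsum_linear K n (g : seq bool -> V) :
  phi (Tsum K n g) = Tsum K n (phi \o g).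
Proof.
elim: n g => //= n IH g; rewrite (big_morph phi phiD phi0); apply: eq_bigr => r _.
by rewrite (big_morph phi phiD phi0); apply: eq_bigr => s _; rewrite phiZ IH.
Qed.

Lemma BCHsum_linear K (g : seq bool -> V) :
  phi (BCHsum K g) = BCHsum K (phi \o g).
Proof.
rewrite /BCHsum (big_morph phi phiD phi0); apply: eq_bigr => n _.
by rewrite phiZ Tsum_linear.
Qed.

End DynkinSumMorphism.

Section DynkinSumTruncation.
Variables (V : lmodType rat).

Lemma Tsum_trunc K K' n (g : seq bool -> V) : (K <= K')%N ->
  (forall w, (K < size w)%N -> g w = 0) -> Tsum K' n g = Tsum K n g.
Proof.
move=> leK; elim: n g => //= n IH g g0.
have c0 r s w : (K < r + s)%N -> g (nseq r true ++ nseq s false ++ w) = 0.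
  by move=> h; apply: g0; rewrite !size_cat !size_nseq; lia.
have z r s : (K < r + s)%N ->
    Tsum K' n (fun w => g (nseq r true ++ nseq s false ++ w)) = 0.
  move=> h; rewrite -[RHS](Tsum0 V K' n); apply: Tsum_eq => w _; exact: c0.
pose F r s := ((r`!)%:R * (s`!)%:R)^-1 *:
  Tsum K' n (fun w => g (nseq r true ++ nseq s false ++ w)).
rewrite [LHS](bigID (fun r : 'I_K'.+1 => (r < K.+1)%N)) /= [X in _ + X]big1 ?addr0; last first.
  by move=> r; rewrite -leqNgt => Kr; rewrite big1 // => s _; rewrite z ?scaler0; last lia.
have leK1 : (K.+1 <= K'.+1)%N by [].
rewrite -(big_ord_widen _ (fun r => \sum_(s < K'.+1 | (0 < r + s)%N) F r s) leK1).
apply: eq_bigr => r _.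
rewrite [LHS](bigID (fun s : 'I_K'.+1 => (s < K.+1)%N)) /= [X in _ + X]big1 ?addr0; last first.
  by move=> s /andP[_]; rewrite -leqNgt => Ks; rewrite /F z ?scaler0; last lia.
rewrite -(big_ord_widen_cond _ (fun s => (0 < r + s)%N) (fun s => F r s) leK1).
apply: eq_bigr => s _; congr (_ *: _); apply: IH => w Kw; apply: g0.
by rewrite !size_cat !size_nseq; lia.
Qed.

Lemma BCHsum_trunc K K' (g : seq bool -> V) : (K <= K')%N ->
  (forall w, (K < size w)%N -> g w = 0) -> BCHsum K' g = BCHsum K g.
Proof.
move=> leK g0; rewrite /BCHsum (@big_cat_nat _ _ _ K.+1) //=.
rewrite [X in _ + X]big1_seq ?addr0 => [|n /andP[_]].
  by apply: eq_bigr => n _; rewrite (Tsum_trunc _ leK).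
rewrite mem_index_iota => /andP[Kn _]; rewrite (Tsum_trunc _ leK) //.
have -> : Tsum K n g = Tsum K n (fun=> 0).
  by apply: Tsum_eq => w nw; apply: g0; apply: leq_trans nw.
by rewrite Tsum0 scaler0.
Qed.

End DynkinSumTruncation.

Lemma BCHsumZ (V : lmodType rat) K (a : rat) (g : seq bool -> V) :
  a *: BCHsum K g = BCHsum K (fun w => a *: g w).
Proof.
by apply: (BCHsum_linear (phi := *:%R a)) => b x y; rewrite scalerDr !scalerA mulrC.
Qed.

Lemma BCHsumN (V : lmodType rat) K (g : seq bool -> V) :
  - BCHsum K g = BCHsum K (fun w => - g w).
Proof.
by apply: (BCHsum_linear (phi := -%R)) => b x y; rewrite opprD scalerN.
Qed.

(** * Words as operators and Dynkin's formula for matrices *)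

Fixpoint wact (V : Type) (X Y : V -> V) (v : V) (w : seq bool) : V :=
  if w is b :: w' then (if b then X else Y) (wact X Y v w') else v.

Lemma wact_cat (V : Type) (X Y : V -> V) v w1 w2 :
  wact X Y v (w1 ++ w2) = wact X Y (wact X Y v w2) w1.
Proof. by elim: w1 => //= b w1 ->. Qed.

Lemma wact_nseq (V : Type) (X Y : V -> V) v b n :
  wact X Y v (nseq n b) = iter n (if b then X else Y) v.
Proof. by elim: n => //= n ->. Qed.

Section DynkinOperators.
Import FalgLfun.
Variable A : falgType rat.
Implicit Types X Y : 'End(A).

Lemma lfun_exprE X n v : (X ^+ n) v = iter n X v.
Proof. by elim: n v => [|n IH] v; rewrite ?lfunE // exprSr lfun_mulE IH. Qed.

(** The product [f * g] of ['End(A)] applies [f] first, whereas the head of a word acts last; this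
    reverses the order of the two exponentials. *)
Lemma Tsum_wact K X Y n v :
  Tsum K n (wact X Y v) = ((expA K Y * expA K X - 1) ^+ n) v.
Proof.
elim: n => [|n IH] /=; first by rewrite expr0 lfunE.
rewrite exprSr lfun_mulE -IH; set u := Tsum K n _.
transitivity (\sum_(r < K.+1) \sum_(s < K.+1 | (0 < r + s)%N)
   ((r`!)%:R * (s`!)%:R)^-1 *: (Y ^+ s * X ^+ r) u).
  apply: eq_bigr => r _; apply: eq_bigr => s _; congr (_ *: _).
  rewrite (Tsum_linear (linearP _)); apply: Tsum_eq => w _ /=.
  by rewrite !wact_cat !wact_nseq lfun_mulE !lfun_exprE.
rewrite !expAE mulr_suml add_lfunE sum_lfunE opp_lfunE lfunE /=.
rewrite [in RHS](eq_bigr (fun s : 'I_K.+1 => \sum_(r < K.+1)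
   ((r`!)%:R * (s`!)%:R)^-1 *: (Y ^+ s * X ^+ r) u)); last first.
  move=> s _; rewrite mulr_sumr sum_lfunE; apply: eq_bigr => r _.
  by rewrite -scalerAr -scalerAl !scale_lfunE scalerA invfM.
rewrite [in RHS]exchange_big /= [in RHS]big_ord_recl [in LHS]big_ord_recl /=.
rewrite addrAC; congr (_ + _).
rewrite big_mkcond /= !big_ord_recl /= add0r fact0 !expr0 !mulr1.
by rewrite invr1 scale1r lfunE /= addrAC subrr add0r.
Qed.

Lemma BCHsum_wact K X Y v :
  BCHsum K (wact X Y v) = logA K (expA K Y * expA K X - 1) v.
Proof.
rewrite logAE sum_lfunE; apply: eq_bigr => n _.
by rewrite scale_lfunE Tsum_wact.
Qed.

Lemma iter_amull (x : A) n v : iter n (amull x) v = x ^+ n * v.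
Proof. by elim: n => [|n /= ->]; rewrite ?expr0 ?mul1r // lfunE /= mulrA exprS. Qed.

Lemma amull_exp K (x : A) : expA K (amull x) = amull (expA K x).
Proof.
apply/lfunP=> v; rewrite lfunE /= !expAE sum_lfunE mulr_suml.
by apply: eq_bigr => i _; rewrite scale_lfunE lfun_exprE iter_amull scalerAl.
Qed.

Lemma amulr_exp K (x : A) : expA K (amulr x) = amulr (expA K x).
Proof.
rewrite !expAE linear_sum; apply: eq_bigr => i _; rewrite linearZ; congr (_ *: _).
by rewrite rmorphXn.
Qed.

Definition wprod (x y : A) : seq bool -> A := wact (fun u => x * u) (fun u => y * u) 1.

Lemma wprodE x y w : wprod x y w = wact (amull x) (amull y) 1 w.
Proof. by rewrite /wprod; elim: w => //= b w ->; case: b; rewrite lfunE. Qed.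

Lemma Tsum_wprod K x y n :
  Tsum K n (wprod x y) = (expA K x * expA K y - 1) ^+ n.
Proof.
rewrite (@Tsum_eq _ _ _ _ (wact (amull x) (amull y) 1)); last first.
  by move=> w _; rewrite wprodE.
have E : amull (expA K y) * amull (expA K x) - 1 = amull (expA K x * expA K y - 1).
  by apply/lfunP=> v; rewrite add_lfunE opp_lfunE lfun_mulE !lfunE /= mulrBl mul1r mulrA.
rewrite Tsum_wact !amull_exp E.
by rewrite lfun_exprE iter_amull mulr1.
Qed.

Lemma BCHsum_wprod K x y :
  BCHsum K (wprod x y) = logA K (expA K x * expA K y - 1).
Proof. by rewrite logAE; apply: eq_bigr => n _; rewrite Tsum_wprod. Qed.

End DynkinOperators.

Fixpoint nest (V : nmodType) (br : V -> V -> V) (s : seq V) : V :=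
  if s is a :: s' then (if s' is [::] then a else br a (nest br s')) else 0.

Definition lett (V : Type) (x y : V) (w : seq bool) : seq V :=
  [seq if b then x else y | b <- w].

Definition commr (A : pzRingType) (x y : A) := x * y - y * x.

Section Dynkin.
Import FalgLfun.
Variables (A : falgType rat) (K0 K : nat).
Hypothesis leK : (2 * K0 <= K)%N.

Lemma nil2 (B : pzRingType) (u v : B) i j :
  u ^+ K0.+1 = 0 -> v ^+ K0.+1 = 0 -> (K < i + j)%N -> u ^+ i * v ^+ j = 0.
Proof.
move=> u0 v0 lt; case: (leqP K0.+1 i) => [le|lt'].
  by rewrite -(subnK le) exprD u0 mulr0 mul0r.
have le : (K0.+1 <= j)%N by lia.
by rewrite -(subnK le) exprD v0 !mulr0.
Qed.

Lemma exprN0 (B : pzRingType) (z : B) n : z ^+ n = 0 -> (- z) ^+ n = 0.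
Proof. by rewrite exprNn => ->; rewrite mulr0. Qed.

Lemma expA_opp (B : algType rat) (z : B) : z ^+ K0.+1 = 0 ->
  expA K z * expA K (- z) = 1.
Proof.
move=> z0; rewrite -expA_add ?subrr ?expA0 //; first exact: commrN.
by move=> i j; apply: nil2 => //; apply: exprN0.
Qed.

Definition adl (x : A) : 'End(A) := amull x - amulr x.

Lemma amullr_comm (x y : A) : GRing.comm (amull x) (amulr y).
Proof. by apply/lfunP=> v; rewrite !lfun_mulE !lfunE /= mulrA. Qed.

Lemma amull_nil (z : A) n : z ^+ n = 0 -> amull z ^+ n = 0.
Proof.
move=> z0; apply/lfunP=> v.
by rewrite lfun_exprE iter_amull z0 mul0r lfunE.
Qed.

Lemma amulr_nil (z : A) n : z ^+ n = 0 -> amulr z ^+ n = 0.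
Proof. by rewrite -rmorphXn => ->; rewrite raddf0. Qed.

(** Left and right multiplication commute, so the exponential of their difference splits:
    [exp (ad z)] is conjugation by [exp z]. *)
Lemma expA_adl (z : A) : z ^+ K0.+1 = 0 ->
  expA K (adl z) = amull (expA K z) * amulr (expA K (- z)).
Proof.
move=> z0; rewrite /adl -linearN expA_add ?amull_exp ?amulr_exp //.
  exact: amullr_comm.
move=> i j; apply: nil2; first exact: amull_nil.
by apply: amulr_nil; apply: exprN0.
Qed.

Lemma adl_nil (z : A) : z ^+ K0.+1 = 0 -> adl z ^+ K.+1 = 0.
Proof.
move=> z0; rewrite /adl -linearN exprDn_comm; last exact: amullr_comm.
rewrite big1 // => i _; rewrite nil2 ?mul0rn //; first exact: amull_nil.
  by apply: amulr_nil; apply: exprN0.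
by rewrite subnK // -ltnS.
Qed.

Section Graded.
Variables x y h : A.
Hypotheses (hx : commr h x = x) (hy : commr h y = y).
Hypothesis words0 : forall w, (K0 < size w)%N -> wprod x y w = 0.

(** The innermost bracket of a letter with [h] is minus that letter, so applying a word of adjoint
    operators to [h] rebuilds the nested commutator of the word. *)
Lemma wact_adl w : w != [::] -> wact (adl x) (adl y) h w = - nest (@commr A) (lett x y w).
Proof.
elim: w => [//|b w IH] _ /=; set z := lett x y w in IH *.
have cN u v : commr u v = - commr v u :> A by rewrite /commr opprB.
have E u : (if b then adl x : A -> A else adl y) u = commr (if b then x else y) u.
  by case: b; rewrite add_lfunE opp_lfunE !lfunE.
rewrite E; case: w @z IH => [|b' w] z IH /=.
  by rewrite cN; case: (b); rewrite ?hx ?hy.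
move: IH; rewrite /z /= => -> //.
by rewrite /commr mulrN mulNr opprK opprB addrC.
Qed.

Let Z := BCHsum K (wprod x y).

(** The logarithm of [exp (ad x) exp (ad y)] is evaluated at [h] in two ways. Word by word it gives
    nested commutators; on the other hand, conjugation by [exp x * exp y = exp Z] is [exp (ad Z)],
    with logarithm [ad Z]. The bound [2 * K0] is there because [ad z] is nilpotent of about twice
    the order of [z]. *)
Lemma dynkin_graded :
  BCHsum K (fun w => nest (@commr A) (lett x y w)) = commr h Z.
Proof.
have x0 : x ^+ K0.+1 = 0.
  have := words0 (w := nseq K0.+1 true); rewrite size_nseq ltnSn => /(_ isT).
  by rewrite wprodE wact_nseq iter_amull mulr1.
have y0 : y ^+ K0.+1 = 0.
  have := words0 (w := nseq K0.+1 false); rewrite size_nseq ltnSn => /(_ isT).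
  by rewrite wprodE wact_nseq iter_amull mulr1.
pose U := expA K x * expA K y - 1.
have U0 : U ^+ K0.+1 = 0.
  by rewrite -Tsum_wprod (@Tsum_eq _ _ _ (wprod x y) (fun=> 0)) ?Tsum0.
have leK' : (K0.+1 <= K.+1)%N by lia.
have ext (B : pzRingType) (u : B) : u ^+ K0.+1 = 0 -> u ^+ K.+1 = 0.
  by move=> u0; rewrite -(subnK leK') exprD u0 mulr0.
have ZE : Z = logA K U by rewrite /Z BCHsum_wprod.
have Z0 : Z ^+ K0.+1 = 0 by rewrite ZE; apply: horner_alg_nilp => //; apply: logP0.
have expZ : expA K Z = expA K x * expA K y.
  by rewrite ZE expA_logA ?ext // addrC subrK.
have expNZ : expA K (- y) * expA K (- x) = expA K (- Z).
  have e : expA K Z * (expA K (- y) * expA K (- x)) = 1.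
    by rewrite expZ mulrA -(mulrA (expA K x)) !expA_opp ?mulr1 // expA_opp.
  have e' : expA K (- Z) * expA K Z = 1.
    by have := expA_opp (exprN0 Z0); rewrite opprK.
  by rewrite -[LHS]mul1r -e' -mulrA e mulr1.
have : BCHsum K (wact (adl x) (adl y) h) = adl Z h.
  rewrite BCHsum_wact !expA_adl //.
  have -> : amull (expA K y) * amulr (expA K (- y)) *
        (amull (expA K x) * amulr (expA K (- x))) = expA K (adl Z).
    rewrite expA_adl // -expNZ expZ; apply/lfunP=> v.
    by rewrite !lfun_mulE !lfunE /= !mulrA.
  by rewrite logA_expA // adl_nil.
rewrite (@BCHsum_eq _ _ _ (fun w => - nest (@commr A) (lett x y w))); last first.
  by move=> [//|b w] _; rewrite wact_adl.
rewrite -BCHsumN => /(congr1 -%R).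
by rewrite opprK => ->; rewrite add_lfunE opp_lfunE !lfunE /= opprB.
Qed.

End Graded.
End Dynkin.

Section DynkinMatrix.
Import FalgLfun.
Variable m : nat.
Let M := 'M[rat]_m.+1.

(* The shift [J] and the grading [H] turn left-right multiplication into a
   representation where words of length [q] acquire the weight [q]. *)
Let J : M := \matrix_(i, j) ((j == i.+1 :> nat)%:R).
Let H : M := \matrix_(i, j) ((i : nat)%:R *+ (i == j)).

Let JHJ : J * H - H * J = J.
Proof.
apply/matrixP=> i j; rewrite !mxE (bigD1 j) //= big1 ?addr0 => [|k kj]; last first.
  by rewrite !mxE (negPf kj) mulr0n mulr0.
rewrite (bigD1 i) //= big1 ?addr0 => [|k ki]; last first.
  by rewrite !mxE eq_sym (negPf ki) mulr0n mul0r.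
rewrite !mxE !eqxx !mulr1n.
case: eqP => [->|_]; last by rewrite mul0r mulr0 subr0.
by rewrite mul1r mulr1 -natrB // subSnn.
Qed.

Let JXE q i j : (J ^+ q) i j = ((j == i + q :> nat)%N)%:R.
Proof.
elim: q i j => [|q IH] i j; first by rewrite expr0 mxE addn0 eq_sym.
rewrite exprS mxE; case: (ltnP i.+1 m.+1) => ltim.
  rewrite (bigD1 (Ordinal ltim)) //= IH big1 ?addr0 => [|k kj].
    by rewrite mxE /= eqxx mul1r addnS.
  by rewrite mxE; case: eqP => [e|_]; rewrite ?mul0r //; case/eqP: kj; apply: val_inj.
rewrite big1 => [|k _].
  rewrite (_ : (_ == _) = false) //; apply/negbTE; rewrite neq_ltn; apply/orP; left.
  by have := ltn_ord j; lia.
by rewrite mxE (_ : (_ == _) = false) ?mul0r //; have := ltn_ord k; lia.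
Qed.

Section Words.
Variables X Y : M.
Let x' : 'End(M) := amulr X * amull J.
Let y' : 'End(M) := amulr Y * amull J.
Let h : 'End(M) := amull H.

Let lr (N : M) q : 'End(M) := amulr N * amull (J ^+ q).

Let lrM N N' q q' : lr N q * lr N' q' = lr (N * N') (q + q').
Proof.
apply/lfunP=> v; rewrite !lfun_mulE !lfunE /= !mulrA -exprD addnC.
by rewrite -!mulrA.
Qed.

Let lrB N N' q : lr (N - N') q = lr N q - lr N' q.
Proof. by rewrite /lr linearB /= mulrBl. Qed.

Let x'E : x' = lr X 1. Proof. by rewrite /lr expr1. Qed.
Let y'E : y' = lr Y 1. Proof. by rewrite /lr expr1. Qed.

Let hlr N : commr h (lr N 1) = lr N 1.
Proof.
apply/lfunP=> v; rewrite /commr add_lfunE opp_lfunE !lfun_mulE !lfunE /= expr1.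
by rewrite -{3}JHJ !mulrBl !mulrA.
Qed.

Let wprod' w : wprod x' y' w = lr (wprod X Y w) (size w).
Proof.
elim: w => [|b w IH] /=.
  by apply/lfunP=> v; rewrite /lr lfun_mulE !lfunE /= expr0 mulr1 mul1r.
by rewrite /wprod /= -!/(wprod _ _ _) x'E y'E; case: b; rewrite IH lrM.
Qed.

Let nest' w : nest (@commr _) (lett x' y' w) = lr (nest (@commr _) (lett X Y w)) (size w).
Proof.
elim: w => [|b [|b' w] IH] /=.
- by apply/lfunP=> v; rewrite /lr lfun_mulE !lfunE /= mulr0 mulr0.
- by rewrite x'E y'E; case: b.
move: IH => /= ->; rewrite /commr x'E y'E.
by case: b; rewrite !lrM addn1 add1n -lrB.
Qed.

Let hwprod' w : commr h (wprod x' y' w) = (size w)%:R *: wprod x' y' w.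
Proof.
elim: w => [|b w IH] /=; first by rewrite /commr mulr1 mul1r subrr scale0r.
rewrite /wprod /= -!/(wprod _ _ _).
have D u v : commr h (u * v) = commr h u * v + u * commr h v :> 'End(M).
  by rewrite /commr mulrBl mulrBr !mulrA addrA subrK.
have hx : commr h x' = x' by rewrite x'E hlr.
have hy : commr h y' = y' by rewrite y'E hlr.
rewrite -[(size w).+1]add1n natrD scalerDl scale1r.
by case: b; rewrite D IH ?hx ?hy scalerAr.
Qed.

Let K := (2 * m)%N.

Let graded v : BCHsum K (fun w => J ^+ size w * (v * (nest (@commr _) (lett X Y w)
                      - (size w)%:R *: wprod X Y w))) = 0.
Proof.
have J0 q : (m < q)%N -> J ^+ q = 0.
  move=> ltq; apply/matrixP=> i j; rewrite JXE mxE (_ : (_ == _) = false) //.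
  by have := ltn_ord j; lia.
have w0 w : (m < size w)%N -> wprod x' y' w = 0.
  move=> ltw; rewrite wprod' /lr J0 // (raddf0 (@amull _ M)) mulr0 //.
have hx : commr h x' = x' by rewrite x'E hlr.
have hy : commr h y' = y' by rewrite y'E hlr.
have := dynkin_graded (leqnn K) hx hy w0.
have linh : linear (commr h).
  move=> a u v'; rewrite /commr mulrDr mulrDl opprD addrACA.
  by rewrite -scalerAr -scalerAl scalerBr.
rewrite (BCHsum_linear linh) => e.
have linv : linear (fun f : 'End(M) => f v).
  by move=> a f f'; rewrite add_lfunE scale_lfunE.
have := congr1 (fun f : 'End(M) => f v) e; rewrite /= !(BCHsum_linear linv) => {}e.
rewrite (@BCHsum_eq _ _ _ (fun w => nest (@commr _) (lett x' y' w) v +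
   (-1) *: commr h (wprod x' y' w) v)); last first.
  move=> w _; rewrite nest' hwprod' wprod' scale_lfunE /lr !lfun_mulE !lfunE /=.
  by rewrite !mulrBr scaleN1r -!scalerAr.
rewrite BCHsumD e -[X in X + _]scale1r.
by rewrite -BCHsumZ scale1r scaleN1r subrr.
Qed.

(** The entry of [J ^+ n] in row 0 and column [q] is 1 for [n = q] and 0 otherwise, so evaluating
    [graded] at a matrix unit isolates the words of length [q]. *)
Let gradedq q : (q <= m)%N ->
  BCHsum K (fun w => if size w == q then nest (@commr _) (lett X Y w)
                      - (size w)%:R *: wprod X Y w else 0) = 0.
Proof.
move=> leq; rewrite -ltnS in leq; apply/matrixP=> i j.
have := graded (delta_mx (Ordinal leq) i).
move=> /(congr1 (fun N : M => N 0 j)).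
have lin0 i0 : linear (fun N : M => N i0 j : rat^o).
  by move=> a u u'; rewrite !mxE.
rewrite !(BCHsum_linear (lin0 _)) => e; transitivity ((0 : M) 0 j); last by rewrite !mxE.
rewrite -e; apply: (@BCHsum_eq rat^o) => w _ /=.
set N := nest _ _ - _; rewrite mxE (bigD1 (Ordinal leq)) //= big1 ?addr0; last first.
  move=> k kq; rewrite [X in _ * X]mxE big1 ?mulr0 // => k' _.
  by rewrite mxE (negPf kq) mul0r.
rewrite JXE add0n [X in _ * X]mxE (bigD1 i) //= big1 ?addr0; last first.
  by move=> k ki; rewrite mxE (negPf ki) andbF mul0r.
rewrite mxE !eqxx mul1r eq_sym; case: eqP => _; rewrite ?mul1r //.
by rewrite mul0r mxE.
Qed.

Hypothesis words0 : forall w, (m < size w)%N -> wprod X Y w = 0.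

(** The induction removes the first letter by passing to the predicate [P (commr letter u)]; the two
    halves of that commutator are words with the letter put in front or at the end. *)
Lemma nest_words (P : M -> Prop) w :
  (forall u v, P u -> P v -> P (u + v)) -> (forall (a : rat) u, P u -> P (a *: u)) ->
  (forall w', size w' = size w -> P (wprod X Y w')) -> w != [::] ->
  P (nest (@commr _) (lett X Y w)).
Proof.
elim: w P => [//|b w IH] P PD PZ Pw _ /=.
case: w IH Pw => [|b' w] IH Pw.
  by have := Pw [:: b] erefl; rewrite /wprod /=; case: (b); rewrite mulr1.
apply: (IH (fun u => P (commr (if b then X else Y) u))) => //.
- move=> u v Pu Pv; have := PD _ _ Pu Pv; congr P.
  by rewrite /commr mulrDr mulrDl opprD addrACA.
- by move=> a u /(PZ a); congr P; rewrite /commr -scalerAl -scalerAr scalerBr.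
move=> w' sw'; have P1 := Pw (b :: w') (congr1 S sw').
have P2 : P (wprod X Y (rcons w' b)) by apply: Pw; rewrite size_rcons sw'.
have := PD _ _ P1 (PZ (-1) _ P2); congr P; rewrite scaleN1r /commr; congr (_ - _).
  by rewrite /wprod /=; case: (b).
elim: (w') => [|b1 w1 IHw]; first by case: (b); rewrite /wprod /= mulr1 mul1r.
rewrite rcons_cons /wprod /=; by rewrite -!/(wprod _ _ _) IHw; case: (b1); rewrite mulrA.
Qed.

Let nest0 w : (m < size w)%N -> nest (@commr _) (lett X Y w) = 0.
Proof.
move=> ltw; apply: (nest_words (P := fun u => u = 0)).
- by move=> u v -> ->; rewrite addr0.
- by move=> a u ->; rewrite scaler0.
- by move=> w' sw'; apply: words0; rewrite sw'.
by case: w ltw.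
Qed.

(** In each length [q] the nested commutators sum to [q] times the words, by [gradedq]; weighting by
    [1 / q] and adding over [q <= m] turns one series into the other. *)
Lemma dynkin_matrix :
  BCHsum m (fun w => (size w)%:R^-1 *: nest (@commr _) (lett X Y w))
    = BCHsum m (wprod X Y).
Proof.
have leK : (m <= K)%N by rewrite /K; lia.
rewrite -!(BCHsum_trunc leK) //; last by move=> w ltw; rewrite nest0 ?scaler0.
pose D w := nest (@commr _) (lett X Y w) - (size w)%:R *: wprod X Y w.
have E : BCHsum K (fun w => \sum_(q < m.+1) (q%:R^-1 : rat) *: (if size w == q then D w else 0))
  = 0.
  rewrite BCHsum_sum big1 // => q _.
  rewrite -BCHsumZ gradedq ?scaler0 //; first by rewrite -ltnS.
apply/eqP; rewrite -subr_eq0 -E.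
rewrite BCHsumN -BCHsumD; apply/eqP; apply: BCHsum_eq => w sw /=.
case: (ltnP m (size w)) => [ltw|lew].
  rewrite nest0 // words0 // scaler0 subrr big1 // => q _; case: eqP => [e|_]; rewrite ?scaler0 //.
  by have := ltn_ord q; rewrite -e; lia.
rewrite -ltnS in lew; rewrite (bigD1 (Ordinal lew)) //= eqxx big1 ?addr0.
  by rewrite /D scalerBr scalerA mulVf ?scale1r // pnatr_eq0 -lt0n.
move=> q; rewrite -val_eqE /= eq_sym => /negPf ->; exact: scaler0.
Qed.

Lemma exp_dynkin_matrix :
  expA m (BCHsum m (fun w => (size w)%:R^-1 *: nest (@commr _) (lett X Y w)))
    = expA m X * expA m Y.
Proof.
rewrite dynkin_matrix BCHsum_wprod; set U := _ - 1.
have U0 : U ^+ m.+1 = 0.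
  by rewrite -Tsum_wprod (@Tsum_eq _ _ _ (wprod X Y) (fun=> 0)) ?Tsum0.
by rewrite (expA_logA U0) /U addrC subrK.
Qed.

End Words.
End DynkinMatrix.

Section LowOrderTerms.
Variables (V : lmodType rat) (k : nat).
Let K := k.+2.
Implicit Type g : seq bool -> V.

Let ord_sum2 (F : nat -> nat -> V) :
  (forall r s, (2 < r + s)%N -> F r s = 0) ->
  \sum_(r < K.+1) \sum_(s < K.+1 | (0 < r + s)%N) F r s
   = F 1%N 0%N + F 0%N 1%N + F 2%N 0%N + F 1%N 1%N + F 0%N 2%N.
Proof.
move=> F0; rewrite !big_ord_recl /= [X in _ + (_ + (_ + X))]big1 ?addr0; last first.
  by move=> r _; rewrite big1 // => s _; apply: F0; rewrite /bump /=; lia.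
rewrite !(big_mkcond (fun s : 'I_K.+1 => _)) /= !big_ord_recl /=.
rewrite -[bump 0 0]/1%N -[bump 0 1]/2%N add0r.
rewrite ![\sum_(i < k) _]big1 ?addr0; first last.
- by move=> s _; apply: F0; rewrite /bump /=; lia.
- by move=> s _; apply: F0; rewrite /bump /=; lia.
- by move=> s _; apply: F0; rewrite /bump /=; lia.
rewrite (F0 1%N 2%N) // (F0 2%N 1%N) // (F0 2%N 2%N) // !addr0.
by rewrite (AC (2*(2*1)) (3*1*5*4*2)).
Qed.

Lemma Tsum1_low g : (forall w, (2 < size w)%N -> g w = 0) ->
  Tsum K 1 g = g [:: true] + g [:: false] + 2^-1 *: g [:: true; true]
     + g [:: true; false] + 2^-1 *: g [:: false; false].
Proof.
move=> g0 /=.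
rewrite (ord_sum2 (F := fun r s => ((r`!)%:R * (s`!)%:R)^-1 *:
   g (nseq r true ++ nseq s false ++ [::]))).
  by rewrite /= !fact0 !(mulr1, mul1r) invr1 !scale1r.
by move=> r s lt; rewrite g0 ?scaler0 // !size_cat !size_nseq addn0.
Qed.

Lemma Tsum2_low g : (forall w, (2 < size w)%N -> g w = 0) ->
  Tsum K 2 g = g [:: true; true] + g [:: true; false]
    + g [:: false; true] + g [:: false; false].
Proof.
move=> g0; rewrite -[LHS]/(\sum_(r < K.+1) \sum_(s < K.+1 | (0 < r + s)%N)
   ((r`!)%:R * (s`!)%:R)^-1 *: Tsum K 1 (fun w => g (nseq r true ++ nseq s false ++ w))).
have z r s : (2 <= r + s)%N ->
    Tsum K 1 (fun w => g (nseq r true ++ nseq s false ++ w)) = 0.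
  move=> lt; rewrite (@Tsum_eq _ _ _ _ (fun=> 0)) ?Tsum0 // => w sw.
  by apply: g0; rewrite !size_cat !size_nseq; lia.
rewrite (ord_sum2 (F := fun r s => ((r`!)%:R * (s`!)%:R)^-1 *:
   Tsum K 1 (fun w => g (nseq r true ++ nseq s false ++ w)))); last first.
  by move=> r s lt; rewrite z ?scaler0 //; lia.
rewrite (z 2%N 0%N) // (z 1%N 1%N) // (z 0%N 2%N) // !scaler0 !addr0.
rewrite !Tsum1_low /=; first last.
- by move=> w sw; apply: g0 => /=; lia.
- by move=> w sw; apply: g0 => /=; lia.
rewrite ![g [:: _, _, _ & _]]g0 // !scaler0 !addr0.
by rewrite !fact0 !mulr1 invr1 !scale1r !addrA.
Qed.

(** Only one and two blocks contribute. The squares of a letter get [1/2 - 1/2 = 0], the word [xy]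
    gets [1 - 1/2] and the word [yx] gets [- 1/2]. *)
Lemma BCHsum_low g : (forall w, (2 < size w)%N -> g w = 0) ->
  BCHsum K g = g [:: true] + g [:: false]
    + 2^-1 *: (g [:: true; false] - g [:: false; true]).
Proof.
move=> g0; rewrite /BCHsum big_ltn // big_ltn // big1_seq ?addr0; last first.
  move=> n /andP[_]; rewrite mem_index_iota => /andP[n2 _].
  rewrite (@Tsum_eq _ _ _ g (fun=> 0)) ?Tsum0 ?scaler0 // => w nw.
  by apply: g0; apply: leq_trans nw.
rewrite Tsum1_low // Tsum2_low //= expr0 expr1 divr1 scale1r mulN1r scaleNr.
set a := g [:: true]; set b := g [:: false]; set tt := g [:: true; true].
set tf := g [:: true; false]; set ft := g [:: false; true]; set ff := g [:: false; false].
have {1}-> : tf = 2^-1 *: tf + 2^-1 *: tf.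
  by rewrite -scalerDl (_ : _ + _ = 1) ?scale1r.
rewrite !scalerDr !scalerN !opprD.
move: (2^-1 *: tt) (2^-1 *: tf) (2^-1 *: ft) (2^-1 *: ff) => {}tt {}tf {}ft {}ff.
by rewrite (AC ((3*2*1)*4) (1*2*(5*9)*(4*8)*(3*7)*(6*10)))/= !subrr !addr0.
Qed.

End LowOrderTerms.

(** * Lie brackets and the product they define *)

Record lie_bracket (L : lmodType rat) (br : L -> L -> L) : Prop := LieBracket {
  br_linl : forall y, linear (br^~ y);
  br_linr : forall x, linear (br x);
  br_xx : forall x, br x x = 0;
  br_jacobi : forall x y z, br x (br y z) + br y (br z x) + br z (br x y) = 0 }.

Definition nil_bracket (L : lmodType rat) (br : L -> L -> L) K :=
  forall s, (K < size s)%N -> nest br s = 0.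

Definition bchg (L : lmodType rat) (br : L -> L -> L) K (x y : L) : L :=
  BCHsum K (fun w => (size w)%:R^-1 *: nest br (lett x y w)).

Lemma nest_morph (U W : nmodType) (br : U -> U -> U) (br' : W -> W -> W) (phi : U -> W) s :
  phi 0 = 0 -> (forall x y, phi (br x y) = br' (phi x) (phi y)) ->
  phi (nest br s) = nest br' (map phi s).
Proof.
move=> phi0 phibr; elim: s => [|a [|b s] IH] //.
by rewrite [LHS]/= phibr IH.
Qed.

Lemma map_lett (U W : Type) (phi : U -> W) x y w :
  map phi (lett x y w) = lett (phi x) (phi y) w.
Proof. by rewrite /lett -map_comp; apply: eq_map => -[]. Qed.

Lemma linear0' (U W : lmodType rat) (phi : U -> W) : linear phi -> phi 0 = 0.
Proof. by move=> lin; have := lin (-1) 0 0; rewrite scaler0 addr0 scaleN1r addNr. Qed.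

Lemma bchg_morph (U W : lmodType rat) (br : U -> U -> U) (br' : W -> W -> W) (phi : U -> W) K :
  linear phi -> (forall x y, phi (br x y) = br' (phi x) (phi y)) ->
  forall x y, phi (bchg br K x y) = bchg br' K (phi x) (phi y).
Proof.
move=> lin phibr x y; have phi0 := linear0' lin.
rewrite /bchg (BCHsum_linear lin); apply: BCHsum_eq => w _ /=.
rewrite -[_ *: _]addr0 lin phi0 addr0 (nest_morph (br' := br')) //.
by rewrite map_lett.
Qed.

Section LieTheory.
Variables (L : lmodType rat) (br : L -> L -> L) (K : nat).
Hypotheses (lieL : lie_bracket br) (nilL : nil_bracket br K).

Local Notation "x ** y" := (bchg br K x y) (at level 40, left associativity).

Lemma br0l x : br 0 x = 0. Proof. exact: (linear0' (br_linl lieL x)). Qed.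
Lemma br0r x : br x 0 = 0. Proof. exact: (linear0' (br_linr lieL x)). Qed.

Lemma brDl x y z : br (x + y) z = br x z + br y z.
Proof. by have := br_linl lieL z 1 x y; rewrite !scale1r. Qed.
Lemma brDr x y z : br x (y + z) = br x y + br x z.
Proof. by have := br_linr lieL x 1 y z; rewrite !scale1r. Qed.
Lemma brZl a x y : br (a *: x) y = a *: br x y.
Proof. by have := br_linl lieL y a x 0; rewrite br0l !addr0. Qed.
Lemma brZr a x y : br x (a *: y) = a *: br x y.
Proof. by have := br_linr lieL x a y 0; rewrite br0r !addr0. Qed.
Lemma brNl x y : br (- x) y = - br x y.
Proof. by rewrite -scaleN1r brZl scaleN1r. Qed.
Lemma brNr x y : br x (- y) = - br x y.
Proof. by rewrite -scaleN1r brZr scaleN1r. Qed.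
Lemma brC x y : br x y = - br y x.
Proof.
have := br_xx lieL (x + y); rewrite brDl !brDr !(br_xx lieL) add0r addr0.
by move/eqP; rewrite addr_eq0 => /eqP.
Qed.
Lemma br_leibniz x y z : br x (br y z) = br (br x y) z + br y (br x z).
Proof.
have := br_jacobi lieL x y z; rewrite (brC z x) brNr (brC z (br x y)).
by move/eqP; rewrite -addrA addr_eq0 => /eqP ->; rewrite opprD !opprK addrC.
Qed.

(** The cutoff [K.+2] is at least 2, as [BCHsum_low] demands, for every [K]; words longer than [K]
    contribute nothing once the bracket is nilpotent. *)
Definition bch_tail x y : L :=
  BCHsum K.+2 (fun w => if (2 < size w)%N then (size w)%:R^-1 *: nest br (lett x y w) else 0).

Lemma size_lett (x y : L) w : size (lett x y w) = size w.
Proof. by rewrite size_map. Qed.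

Lemma bchg_expand x y : x ** y = x + y + 2^-1 *: br x y + bch_tail x y.
Proof.
rewrite /bchg -(@BCHsum_trunc _ K K.+2) ?(leqW (leqnSn _)) //; last first.
  by move=> w lt; rewrite nilL ?scaler0 // size_lett.
pose g w := if (2 < size w)%N then 0 else (size w)%:R^-1 *: nest br (lett x y w).
have -> : x + y + 2^-1 *: br x y = BCHsum K.+2 g.
  rewrite BCHsum_low /g => [|w ->] //=; rewrite !invr1 !scale1r; congr (_ + _).
  rewrite [br y x]brC scalerN opprK -scalerDl scalerA; congr (_ *: _).
rewrite /bch_tail -BCHsumD; apply: BCHsum_eq => w _; rewrite /g.
by case: ifP; rewrite ?add0r ?addr0.
Qed.

Lemma nest_lett_same x w : (1 < size w)%N -> forall a b : rat,
  nest br (lett (a *: x) (b *: x) w) = 0.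
Proof.
elim: w => [//|c [//|c' [|c'' w]] IH] _ a b.
  by case: c; case: (c') => /=; rewrite brZl brZr (br_xx lieL) !scaler0.
by rewrite -[LHS]/(br _ (nest br (lett _ _ (c' :: c'' :: w)))) IH // br0r.
Qed.

Lemma bchg_mul a b x : (a *: x) ** (b *: x) = (a + b) *: x.
Proof.
rewrite bchg_expand brZl brZr (br_xx lieL) !scaler0 addr0 -scalerDl.
rewrite [bch_tail _ _](_ : _ = 0) ?addr0 // -[RHS](BCHsum0 L K.+2).
apply: BCHsum_eq => w _; case: ifP => // lt.
by rewrite nest_lett_same ?scaler0 //; apply: ltn_trans lt.
Qed.

Lemma bchg0 x : x ** 0 = x.
Proof. by have := bchg_mul 1 0 x; rewrite addr0 !scale1r scale0r. Qed.
Lemma bch0g x : 0 ** x = x.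
Proof. by have := bchg_mul 0 1 x; rewrite add0r !scale1r scale0r. Qed.
Lemma bchgN x : x ** (- x) = 0.
Proof. by have := bchg_mul 1 (-1) x; rewrite scaleN1r scale1r subrr scale0r. Qed.
Lemma bchNg x : (- x) ** x = 0.
Proof. by have := bchg_mul (-1) 1 x; rewrite scaleN1r scale1r addNr scale0r. Qed.

End LieTheory.

Lemma poly_nonroot (F : fieldType) (p : {poly F}) :
  injective (fun n : nat => n%:R : F) -> p != 0 -> exists n : nat, p.[n%:R] != 0.
Proof.
move=> inj nz; pose rs : seq F := [seq i%:R | i <- iota 0 (size p)].
have : ~~ all (root p) rs.
  apply/negP => /(max_poly_roots nz); rewrite map_inj_uniq // iota_uniq => /(_ isT).
  by rewrite size_map size_iota ltnn.
by move=> /allPn[x /mapP[n _ ->]]; exists n.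
Qed.

Lemma natr_inj (F : numDomainType) : injective (fun n : nat => n%:R : F).
Proof. by move=> i j /eqP; rewrite eqr_nat => /eqP. Qed.

(** * Brackets in coordinates and associativity of the product *)

Section CoordinateBracket.
Variables (K : fieldType) (d : nat) (c : 'I_d -> 'I_d -> 'rV[K]_d).
Local Notation br := (lie_br c).

Lemma lie_brE x y k :
  (br x y) 0 k = \sum_i \sum_j x 0 i * y 0 j * c i j 0 k.
Proof.
rewrite summxE; apply: eq_bigr => i _; rewrite summxE; apply: eq_bigr => j _.
by rewrite mxE.
Qed.

Lemma lie_br_linl y : linear (br^~ y).
Proof.
move=> a x x'; apply/rowP=> k.
rewrite !mxE !lie_brE mulr_sumr -big_split; apply: eq_bigr => i _ /=.
rewrite mulr_sumr -big_split; apply: eq_bigr => j _ /=.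
by rewrite !mxE !mulrDl !mulrA.
Qed.

Lemma lie_br_linr x : linear (br x).
Proof.
move=> a y y'; apply/rowP=> k.
rewrite !mxE !lie_brE mulr_sumr -big_split; apply: eq_bigr => i _ /=.
rewrite mulr_sumr -big_split; apply: eq_bigr => j _ /=.
by rewrite !mxE mulrDr !mulrDl !mulrA; congr (_ * _ * _ + _); rewrite mulrC.
Qed.

End CoordinateBracket.

Section CoordinateLie.
Variables (d : nat) (c : 'I_d -> 'I_d -> 'rV[rat]_d).
Let n := 'rV[rat]_d.
Let br : n -> n -> n := lie_br c.

Lemma lie_alg_bracket : is_lie_algebra c -> lie_bracket br.
Proof.
by case=> brxx jac; split => // [y|x]; [apply: lie_br_linl|apply: lie_br_linr].
Qed.

Hypotheses (lieL : lie_bracket br) (nilL : nil_bracket br d).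
Let L2 := (n * n)%type.

(* The bracket of the dual numbers [n + eps n]. *)
Definition br_eps (U V : L2) : L2 := (br U.1 V.1, br U.1 V.2 + br U.2 V.1).

Definition admx (u : n) : 'M[rat]_d := \matrix_(i, j) (br u (delta_mx 0 j)) 0 i.

Lemma admxE u x : admx u *m x^T = (br u x)^T.
Proof.
apply/colP=> i; rewrite !mxE.
have -> : br u x = \sum_j x 0 j *: br u (delta_mx 0 j).
  rewrite {1}[x]row_sum_delta; elim/big_rec2: _ => [|j y1 y2 _ IH]; first exact: br0r.
  by rewrite (br_linr lieL) IH.
by rewrite summxE; apply: eq_bigr => j _; rewrite !mxE mulrC.
Qed.

Lemma admx_lin : linear admx.
Proof. by move=> a x y; apply/matrixP=> i j; rewrite !mxE (br_linl lieL) !mxE. Qed.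

Definition lowmx (C : 'cV[rat]_d) (A : 'M[rat]_d) : 'M[rat]_d.+1 :=
  block_mx (0 : 'M_1) 0 C A : 'M_(1 + d).

Lemma lowmx_mul C A C' A' : lowmx C A * lowmx C' A' = lowmx (A *m C') (A *m A').
Proof.
rewrite -[LHS]/((block_mx (0 : 'M_1) 0 C A : 'M_(1 + d)) *m block_mx (0 : 'M_1) 0 C' A').
by rewrite mulmx_block !(mulmx0, mul0mx, addr0, add0r).
Qed.

Lemma lowmx_lin a C A C' A' :
  a *: lowmx C A + lowmx C' A' = lowmx (a *: C + C') (a *: A + A').
Proof.
rewrite -[LHS]/(a *: (block_mx (0 : 'M_1) 0 C A : 'M_(1 + d))
  + (block_mx (0 : 'M_1) 0 C' A' : 'M_(1 + d))).
by rewrite scale_block_mx add_block_mx !scaler0 !addr0.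
Qed.

Lemma lowmx0 : lowmx 0 0 = 0.
Proof. by rewrite -[LHS]/(block_mx (0 : 'M_1) 0 0 0 : 'M_(1 + d)) block_mx0. Qed.

Lemma lowmx_inj C A C' A' : lowmx C A = lowmx C' A' -> C = C'.
Proof.
by move=> /(congr1 (fun M : 'M_(1 + d) => dlsubmx M)); rewrite !block_mxKdl.
Qed.

(* The representation of [n + eps n] on [Q + n] that detects the second
   component. *)
Definition rho (U : L2) : 'M[rat]_d.+1 := lowmx (- U.2^T) (admx U.1).

Lemma rho_lin : linear rho.
Proof.
move=> a U V; rewrite /rho lowmx_lin /= admx_lin; congr lowmx.
by rewrite linearP opprD scalerN.
Qed.

Lemma rho_br U V : rho (br_eps U V) = commr (rho U) (rho V).
Proof.
have cl C A C' A' : lowmx C A - lowmx C' A' = lowmx (C - C') (A - A').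
  by rewrite addrC -scaleN1r lowmx_lin !scaleN1r ![- _ + _]addrC.
rewrite /commr /rho !lowmx_mul cl !mulmxN !admxE; congr lowmx.
  by rewrite /= opprK linearD /= opprD (brC lieL U.2) linearN /= opprK.
apply/matrixP=> i j.
have E w x : (admx w *m x^T) i 0 = br w x 0 i by rewrite admxE mxE.
rewrite !mxE.
have F a b : \sum_k admx a i k * admx b k j = (br a (br b (delta_mx 0 j))) 0 i.
  rewrite -E mxE; apply: eq_bigr => k _; by rewrite !mxE.
by rewrite !F (br_leibniz lieL U.1) mxE addrK.
Qed.

(** The block [A] of a word is a composite of adjoint maps, hence a nested bracket once applied to a
    vector; the column [C] is minus a nested bracket as long as the word, whose last entry is a
    second component. *)
Lemma words_rho U V w : (d < size w)%N -> wprod (rho U) (rho V) w = 0.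
Proof.
have H : forall w, w != [::] -> exists C A, wprod (rho U) (rho V) w = lowmx C A /\
    (forall x, exists s, size s = (size w).+1 /\ A *m x^T = (nest br s)^T) /\
    (exists s, size s = size w /\ C = - (nest br s)^T).
  elim=> [//|b w' IH] _; rewrite /wprod /= -/(wprod _ _ _).
  pose Z := if b then U else V.
  have EZ u : (if b then fun u => rho U * u else fun u => rho V * u) u = rho Z * u.
    by rewrite /Z; case: (b).
  rewrite EZ; case: w' IH => [|b' w'] IH.
    rewrite /wprod /= mulr1; exists (- Z.2^T), (admx Z.1); split=> //; split.
      by move=> x; exists [:: Z.1; x]; rewrite admxE.
    by exists [:: Z.2].
  have [//|C [A [-> [HA [s [ss ->]]]]]] := IH.
  exists (- (br Z.1 (nest br s))^T), (admx Z.1 *m A); split; last split.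
  - by rewrite lowmx_mul mulmxN admxE.
  - move=> x; have [s' [ss' e]] := HA x; exists (Z.1 :: s'); split=> /=; first by rewrite ss'.
    by rewrite -mulmxA e admxE; case: s' ss' {e}.
  by exists (Z.1 :: s); split=> /=; rewrite ?ss //; case: s ss.
move=> lt; have [|C [A [-> [HA [s [ss ->]]]]]] := H w; first by case: w lt.
rewrite nilL ?ss // trmx0 oppr0 (_ : A = 0); first exact: lowmx0.
apply/matrixP=> i j; have [s' [ss' e]] := HA (delta_mx 0 j).
move: e; rewrite nilL ?ss' ?(ltn_trans lt) // trmx0 => /colP/(_ i).
rewrite !mxE (bigD1 j) //= big1 => [|k kj]; first by rewrite !mxE !eqxx mulr1 addr0.
by rewrite !mxE (negPf kj) mulr0.
Qed.

Local Notation "x ** y" := (bchg br d x y) (at level 40, left associativity).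
Fact bche_key : unit. Proof. exact: tt. Qed.
Definition bche : L2 -> L2 -> L2 := locked_with bche_key (bchg br_eps d).
Lemma bcheE : bche = bchg br_eps d. Proof. by rewrite /bche unlock. Qed.
Local Notation "x *e y" := (bche x y) (at level 40, left associativity).

Lemma exp_rho U V : expA d (rho (U *e V)) = expA d (rho U) * expA d (rho V).
Proof.
rewrite bcheE -exp_dynkin_matrix; last by move=> w; apply: words_rho.
congr expA; exact: (bchg_morph _ rho_lin rho_br).
Qed.

Lemma fst_bch_eps U V : (U *e V).1 = U.1 ** V.1.
Proof. by rewrite bcheE; apply: bchg_morph. Qed.

(** Matrix multiplication is associative and [expA] is injective on nilpotents, so the two products
    have the same image under [rho]; that image determines the second component, while of the first
    it retains only the adjoint action. *)
Lemma bch_eps_assoc2 U V W : (U *e V *e W).2 = (U *e (V *e W)).2.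
Proof.
have : expA d (rho (U *e V *e W)) = expA d (rho (U *e (V *e W))).
  apply: etrans (exp_rho (U *e V) W) _; apply/esym/(etrans (exp_rho U (V *e W))).
  by rewrite (exp_rho U V) (exp_rho V W) mulrA.
have nil Z : rho Z ^+ d.+1 = 0.
  have := @words_rho Z Z (nseq d.+1 true); rewrite size_nseq => /(_ (leqnn _)).
  by rewrite wprodE wact_nseq iter_amull mulr1.
by move=> /(expA_inj (nil _) (nil _)) /lowmx_inj/oppr_inj/trmx_inj.
Qed.

(* [F] is a polynomial curve together with its derivative. *)
Definition dpair (F : rat -> L2) := forall i, exists p : {poly rat},
  forall s, (F s).1 0 i = p.[s] /\ (F s).2 0 i = p^`().[s].

Lemma dpair_ext F F' : F =1 F' -> dpair F -> dpair F'.
Proof. by move=> e H i; have [p Hp] := H i; exists p => s; rewrite -e. Qed.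

Lemma dpairD F F' : dpair F -> dpair F' -> dpair (fun s => F s + F' s).
Proof.
move=> H H' i; have [p Hp] := H i; have [q Hq] := H' i; exists (p + q) => s.
rewrite !mxE derivD !hornerE.
by have [-> ->] := Hp s; have [-> ->] := Hq s.
Qed.

Lemma dpairZ a F : dpair F -> dpair (fun s => a *: F s).
Proof.
move=> H i; have [p Hp] := H i; exists (a *: p) => s.
by rewrite !mxE derivZ !hornerE; have [-> ->] := Hp s.
Qed.

Lemma dpair0 : dpair (fun=> 0).
Proof. by move=> i; exists 0 => s; rewrite !mxE derivC !hornerE. Qed.

Lemma dpair_br F F' : dpair F -> dpair F' -> dpair (fun s => br_eps (F s) (F' s)).
Proof.
move=> H H' k; have /fin_all_exists[p Hp] := H; have /fin_all_exists[q Hq] := H'.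
exists (\sum_i \sum_j (c i j 0 k) *: (p i * q j)) => s; split.
  rewrite lie_brE horner_sum; apply: eq_bigr => i _; rewrite horner_sum.
  apply: eq_bigr => j _; by rewrite hornerZ hornerM (Hp i s).1 (Hq j s).1 mulrC.
rewrite mxE !lie_brE -big_split /= raddf_sum horner_sum; apply: eq_bigr => i _.
rewrite -big_split /= raddf_sum horner_sum; apply: eq_bigr => j _ /=.
rewrite derivZ derivM hornerZ hornerD !hornerM (Hp i s).1 (Hp i s).2 (Hq j s).1 (Hq j s).2.
by rewrite addrC mulrDr !(mulrC (c i j 0 k)).
Qed.

Lemma dpair_bch F F' : dpair F -> dpair F' -> dpair (fun s => F s *e F' s).
Proof.
move=> H H'; rewrite bcheE /bchg.
apply: (@BCHsum_curve (n * n)%type d rat dpair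
  (fun s w => (size w)%:R^-1 *: nest br_eps (lett (F s) (F' s) w))).
- exact: dpair_ext.
- exact: dpair0.
- exact: dpairD.
- exact: dpairZ.
move=> w _; apply: dpairZ.
elim: w => [|b [|b' w] IH]; first exact: dpair0.
  by case: b.
by case: b; apply: dpair_br IH.
Qed.

(* The associativity defect along [s |-> (s x, s y, s z)] vanishes at [s = 0], and
   its derivative is the dual part of the defect over the dual numbers, which
   vanishes because a matrix representation detects it. *)
Lemma bchg_assoc x y z : x ** y ** z = x ** (y ** z).
Proof.
pose X (v : n) (s : rat) : L2 := (s *: v, v).
have dX v : dpair (X v).
  move=> i; exists (v 0 i *: 'X) => s; rewrite derivZ derivX !hornerE !mxE.
  by rewrite mulrC.
have D1 := dpair_bch (dpair_bch (dX x) (dX y)) (dX z).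
have D2 := dpair_bch (dX x) (dpair_bch (dX y) (dX z)).
have D := dpairD (dpairZ (-1) D2) D1.
apply/eqP; rewrite -subr_eq0; apply/eqP/rowP=> i.
have [p Hp] := D i.
have p'0 : p^`() = 0.
  case: (eqVneq (p^`()) 0) => // /(poly_nonroot (@natr_inj rat))[m /negP[]].
  apply/eqP; have [_ <-] := Hp m%:R.
  by rewrite /= bch_eps_assoc2 scaleN1r addNr mxE.
have E s : (s *: x) ** (s *: y) ** (s *: z) - (s *: x) ** ((s *: y) ** (s *: z)) =
  (-1) *: ((X x s) *e ((X y s) *e (X z s))).1 + ((X x s) *e (X y s) *e (X z s)).1.
  by rewrite !fst_bch_eps scaleN1r addrC.
have p1 : p.[1] = p.[0].
  have szp : (size p <= 1)%N.
    rewrite leqNgt; apply/negP => lt.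
    move: p'0 => /(congr1 (fun q : {poly rat} => q`_(size p).-2)).
    rewrite coef_deriv coef0 -subn2 (_ : (size p - 2).+1 = (size p).-1); last lia.
    move/eqP; rewrite mulrn_eq0 /= -/(lead_coef p) lead_coef_eq0 => /orP[|/eqP p0].
      by move: lt; case: (size p) => [|[]].
    by move: lt; rewrite p0 size_poly0.
  by rewrite [p]size1_polyC // !hornerC.
have := (Hp 1).1; rewrite p1 -(Hp 0).1 /=.
rewrite -!E !scale1r !scale0r => ->.
by rewrite !(bchg0 lieL nilL) subrr.
Qed.

End CoordinateLie.

(** * Subgroups of a nilpotent Lie algebra *)

Section LieHull.
Variables (L : lmodType rat) (br : L -> L -> L) (K : nat).
Hypotheses (lieL : lie_bracket br) (nilL : nil_bracket br K).
Local Notation "x ** y" := (bchg br K x y) (at level 40, left associativity).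
Hypothesis bchA : forall x y z, x ** y ** z = x ** (y ** z).
Variable S : L -> Prop.
Hypotheses (S0 : S 0) (SM : forall x y, S x -> S y -> S (x ** y))
  (SN : forall x, S x -> S (- x)).

Lemma SmulZ (z : int) x : S x -> S (z%:~R *: x).
Proof.
move=> Sx; have Sn (n : nat) : S (n%:R *: x).
  elim: n => [|n IH]; first by rewrite scale0r.
  rewrite -addn1 natrD -(bchg_mul lieL nilL); apply: SM => //.
  by rewrite scale1r.
case: z => n; first by rewrite -pmulrn; apply: Sn.
by rewrite NegzE mulrNz scaleNr -pmulrn; apply/SN/Sn.
Qed.

(* The lower central filtration of the Lie subalgebra generated by [S]. *)
Inductive Fil (i : nat) : L -> Prop :=
| Fil_zero : Fil i 0
| Fil_add x y : Fil i x -> Fil i y -> Fil i (x + y)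
| Fil_scale (a : rat) x : Fil i x -> Fil i (a *: x)
| Fil_base s : (i <= size s)%N -> (forall x, x \in s -> S x) -> Fil i (nest br s).

Lemma Fil_le i j x : (i <= j)%N -> Fil j x -> Fil i x.
Proof.
move=> leij; elim=> [|y z _ Hy _ Hz|a y _ Hy|s js Ss].
- exact: Fil_zero.
- exact: Fil_add.
- exact: Fil_scale.
by apply: Fil_base => //; apply: leq_trans js.
Qed.

Lemma Fil_opp i x : Fil i x -> Fil i (- x).
Proof. by rewrite -scaleN1r; apply: Fil_scale. Qed.

Lemma Fil_sub i x y : Fil i x -> Fil i y -> Fil i (x - y).
Proof. by move=> Hx Hy; apply: Fil_add => //; apply: Fil_opp. Qed.

Lemma Fil_nil i x : (K < i)%N -> Fil i x -> x = 0.
Proof.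
move=> lt; elim=> [//|y z _ -> _ ->|a y _ ->|s les Ss]; rewrite ?addr0 ?scaler0 //.
by apply: nilL; apply: leq_trans les.
Qed.

Lemma Fil_S x : S x -> Fil 1 x.
Proof.
move=> Sx; have := @Fil_base 1 [:: x] isT; apply.
by move=> y; rewrite inE => /eqP ->.
Qed.

Lemma Fil_brS a j y : S a -> (0 < j)%N -> Fil j y -> Fil j.+1 (br a y).
Proof.
move=> Sa j0; elim=> [|y1 y2 _ H1 _ H2|q y1 _ H1|s js Ss].
- by rewrite (br0r lieL); apply: Fil_zero.
- by rewrite (brDr lieL); apply: Fil_add.
- by rewrite (brZr lieL); apply: Fil_scale.
have -> : br a (nest br s) = nest br (a :: s) by case: s js Ss j0 => //; case: j.
by apply: Fil_base => // x; rewrite inE => /orP[/eqP ->|/Ss].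
Qed.

Lemma Fil_br i j x y : (0 < i)%N -> (0 < j)%N -> Fil i x -> Fil j y ->
  Fil (i + j) (br x y).
Proof.
move=> i0 j0; elim=> [|x1 x2 _ H1 _ H2|q x1 _ H1|s les Ss] Hy.
- by rewrite (br0l lieL); apply: Fil_zero.
- by rewrite (brDl lieL); apply: Fil_add; [apply: H1|apply: H2].
- by rewrite (brZl lieL); apply: Fil_scale; apply: H1.
apply: (@Fil_le _ (size s + j)); first by rewrite leq_add2r.
have {les i0} : s != [::] by case: s les {Ss} => //; case: (i) i0.
elim: s Ss j j0 y Hy => [//|a [|b s] IH] Ss j j0 y Hy _.
  by apply: Fil_brS => //; apply: Ss; rewrite mem_head.
have Sa : S a by apply: Ss; rewrite mem_head.
have {}IH := IH (fun x xs => Ss x (@mem_behead _ [:: a, b & s] x xs)).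
set X := nest br (b :: s) in IH *.
have -> : br (nest br [:: a, b & s]) y = br a (br X y) - br X (br a y).
  by rewrite (br_leibniz lieL a X y) addrK.
have -> : (size [:: a, b & s] + j = (size (b :: s) + j).+1)%N by [].
apply: Fil_sub; first by apply: Fil_brS => //; apply: IH.
by rewrite -addnS; apply: IH => //; apply: Fil_brS.
Qed.

(** The innermost bracket is [br a b] up to sign, or zero, and starts at level [m]; each of the
    other [size w - 2] letters raises the level by one. *)
Lemma Fil_words a b m w : Fil 1 a -> Fil 1 b -> (0 < m)%N -> Fil m (br a b) ->
  (1 < size w)%N -> Fil (m + size w - 2) (nest br (lett a b w)).
Proof.
move=> Ha Hb m0 Hab; elim: w => [//|e [//|e' [|e'' w]] IH] _.
  rewrite addnK; case: e; case: (e') => //=; rewrite ?(br_xx lieL); try exact: Fil_zero.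
  by rewrite (brC lieL); apply: Fil_opp.
have -> : (m + size [:: e, e', e'' & w] - 2 = 1 + (m + size [:: e', e'' & w] - 2))%N.
  by rewrite /=; lia.
have -> : nest br (lett a b [:: e, e', e'' & w]) =
  br (if e then a else b) (nest br (lett a b [:: e', e'' & w])) by [].
by apply: Fil_br => //; [rewrite /=; lia|case: (e)|apply: IH].
Qed.

Lemma Fil_tail a b m : Fil 1 a -> Fil 1 b -> (0 < m)%N -> Fil m (br a b) ->
  Fil m.+1 (bch_tail br K a b).
Proof.
move=> Ha Hb m0 Hab; apply: BCHsum_ind.
- exact: Fil_zero.
- exact: Fil_add.
- exact: Fil_scale.
move=> w _; case: ifP => lt; last exact: Fil_zero.
apply: Fil_scale; apply: Fil_le (Fil_words Ha Hb m0 Hab _); last exact: ltnW.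
lia.
Qed.

Lemma halfD (v : L) : 2^-1 *: v + 2^-1 *: v = v.
Proof. by rewrite -scalerDl (_ : _ + _ = 1) ?scale1r. Qed.

(** With [a = u ** v] and [b = (- u) ** (- v)] the linear parts cancel, so [a + b] is [br u v]
    modulo [Fil i.+2]. Since [br a b = br a (a + b)], one more bracket pushes all remaining terms of
    [a ** b] into [Fil i.+2] as well. *)
Lemma group_commutator u v i : (0 < i)%N -> S u -> S v -> Fil i v ->
  let delta := (u ** v) ** ((- u) ** (- v)) in
  S delta /\ Fil i.+2 (delta - br u v).
Proof.
move=> i0 Su Sv Hv delta; split.
  by apply: SM; apply: SM => //; apply: SN.
have Hu := Fil_S Su; have Hv1 := Fil_S Sv.
have Huv : Fil i.+1 (br u v) by rewrite -add1n; apply: Fil_br.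
have Ht1 : Fil i.+2 (bch_tail br K u v) by apply: Fil_tail.
have Ht2 : Fil i.+2 (bch_tail br K (- u) (- v)).
  apply: Fil_tail => //; try exact: Fil_opp.
  by rewrite (brNl lieL) (brNr lieL) opprK.
move: Ht1 Ht2; set t1 := bch_tail _ _ _ _; set t2 := bch_tail _ _ _ _ => Ht1 Ht2.
have Ea : u ** v = u + v + 2^-1 *: br u v + t1 by apply: bchg_expand.
have Eb : (- u) ** (- v) = - u - v + 2^-1 *: br u v + t2.
  by rewrite (bchg_expand lieL nilL) (brNl lieL) (brNr lieL) opprK.
set a := u ** v in Ea; set b := (- u) ** (- v) in Eb.
pose e := br u v + t1 + t2.
have Eab : a + b = e.
  rewrite [a]Ea [b]Eb /e -{3}(halfD (br u v)); move: (2^-1 *: br u v) => h.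
  by rewrite (AC (4*4) ((1*5)*(2*6)*((3*7)*4*8)))/= !subrr !add0r.
have He : Fil i.+1 e.
  by apply: Fil_add; [apply: Fil_add|]; rewrite ?Huv //; apply: Fil_le (leqnSn _) _.
have Ha : Fil 1 a by apply: Fil_S; apply: SM.
have Hb : Fil 1 b by apply: Fil_S; apply: SM; apply: SN.
have Hab : Fil i.+2 (br a b).
  have -> : b = e - a by rewrite -Eab addrC addKr.
  rewrite (brDr lieL) (brNr lieL) (br_xx lieL) subr0 -[i.+2]add1n.
  exact: Fil_br.
rewrite /delta (bchg_expand lieL nilL) Eab /e.
have HT : Fil i.+2 (2^-1 *: br a b) by apply: Fil_scale.
have HT' : Fil i.+2 (bch_tail br K a b) by apply: Fil_le (leqnSn _) _; apply: Fil_tail.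
move: (2^-1 *: br a b) (bch_tail br K a b) HT HT' => T T' HT HT'.
rewrite (AC (5*1) ((1*6)*(2*(3*(4*5)))))/= subrr add0r.
by apply: Fil_add => //; apply: Fil_add => //; apply: Fil_add.
Qed.

(** Iterated group commutators stand in for nested brackets; by [group_commutator] every replacement
    costs only an error one level further down. *)
Lemma nest_representative s : s != [::] -> (forall x, x \in s -> S x) ->
  exists delta, [/\ S delta, Fil (size s) delta & Fil (size s).+1 (delta - nest br s)].
Proof.
elim: s => [//|a [|b s] IH] _ Ss.
  have Sa : S a by apply: Ss; rewrite mem_head.
  by exists a; split=> //; [apply: Fil_S|rewrite /= subrr; apply: Fil_zero].
have Sa : S a by apply: Ss; rewrite mem_head.
have [//|x xs|del [Sd Hd Hd']] := IH _; first by apply: Ss; rewrite inE xs orbT.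
move: Hd Hd'; set X := nest br (b :: s); set k := size (b :: s) => Hd Hd'.
have [Sdel Hdel] := group_commutator (isT : (0 < k)%N) Sa Sd Hd.
set delta := _ ** _ in Sdel Hdel; exists delta.
have H : Fil k.+2 (delta - br a X).
  have -> : delta - br a X = (delta - br a del) + br a (del - X).
    by rewrite (brDr lieL) (brNr lieL) addrA subrK.
  by apply: Fil_add => //; apply: Fil_brS.
split=> //; have -> : delta = (delta - br a X) + br a X by rewrite subrK.
apply: Fil_add; first exact: Fil_le (leqnSn _) _.
by have := @Fil_base k.+1 [:: a, b & s] (leqnn _) Ss.
Qed.

(** Nested brackets are replaced by group elements modulo the next level, after which only rational
    coefficients remain; [N] is a common denominator. *)
Lemma Fil_decompose i x : (0 < i)%N -> Fil i x ->
  exists N (l : seq (int * L)), [/\ (0 < N)%N,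
    (forall p, p \in l -> S p.2 /\ Fil i p.2) &
    Fil i.+1 (N%:R *: x - \sum_(p <- l) p.1%:~R *: p.2)].
Proof.
move=> i0; elim=> [|y z _ [N [l [N0 Hl Hy]]] _ [N' [l' [N0' Hl' Hz]]]|q y _ [N [l [N0 Hl Hy]]]|s].
- by exists 1%N, [::]; split=> //; rewrite big_nil scaler0 subr0; apply: Fil_zero.
- exists (N * N')%N, ([seq (p.1 * N'%:Z, p.2) | p <- l] ++ [seq (p.1 * N%:Z, p.2) | p <- l']).
  split; first by rewrite muln_gt0 N0.
    by move=> p; rewrite mem_cat => /orP[] /mapP[p' p'l ->] /=; [apply: Hl|apply: Hl'].
  rewrite big_cat !big_map /= opprD scalerDr addrACA; apply: Fil_add.
    have := Fil_scale N'%:R Hy; congr (Fil _ _); rewrite scalerBr scalerA natrM mulrC.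
    congr (_ - _); rewrite scaler_sumr; apply: eq_bigr => p _.
    by rewrite scalerA rmorphM /= mulrC.
  have := Fil_scale N%:R Hz; congr (Fil _ _); rewrite scalerBr scalerA natrM.
  congr (_ - _); rewrite scaler_sumr; apply: eq_bigr => p _.
  by rewrite scalerA rmorphM /= mulrC.
- have d0 := denq_gt0 q.
  exists (N * `|denq q|)%N, [seq (p.1 * numq q, p.2) | p <- l]; split.
  + by rewrite muln_gt0 N0 absz_gt0 denq_neq0.
  + by move=> p /mapP[p' p'l ->] /=; apply: Hl.
  have := Fil_scale (numq q)%:~R Hy; congr (Fil _ _); rewrite scalerBr !scalerA big_map.
  congr (_ - _).
    have E : (denq q)%:~R * q = (numq q)%:~R.
      by rewrite -{2}[q]divq_num_den mulrC divfK // intr_eq0 denq_neq0.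
    by rewrite natrM natr_absz gtr0_norm // -mulrA E mulrC.
  rewrite scaler_sumr; apply: eq_bigr => p _ /=.
  by rewrite scalerA rmorphM /= mulrC.
move=> les Ss; case: (ltngtP i (size s)) les => // [lt _|e _].
  by exists 1%N, [::]; split=> //; rewrite big_nil subr0 scale1r; apply: Fil_base.
have [|delta [Sd Hd Hd']] := nest_representative _ Ss.
  by move: i0; rewrite e; case: s {Ss e}.
exists 1%N, [:: (1, delta)]; split=> //.
  by move=> p; rewrite inE => /eqP ->; rewrite e.
by rewrite big_seq1 /= !scale1r -opprB e; apply: Fil_opp.
Qed.

Section PolynomialMaps.
Variable T : eqType.
Implicit Types (f g q : (T -> int) -> L) (l : T -> int).

Definition mon (s : seq T) l : int := \prod_(t <- s) l t.

(** Monomials are nonempty, so the substitution [l |-> N l] multiplies each coefficient by a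
    positive power of [N]. This is what clears denominators, and constant terms would escape it. *)
Inductive Pol (i : nat) : ((T -> int) -> L) -> Prop :=
| Pol_mon s v : s != [::] -> Fil i v -> Pol i (fun l => (mon s l)%:~R *: v)
| Pol_zero : Pol i (fun=> 0)
| Pol_add f g : Pol i f -> Pol i g -> Pol i (fun l => f l + g l)
| Pol_ext f g : f =1 g -> Pol i f -> Pol i g.

Lemma Pol_le i j f : (i <= j)%N -> Pol j f -> Pol i f.
Proof.
move=> leij; elim=> [s v s0 Hv||g h _ Hg _ Hh|g h e _ Hg].
- by apply: Pol_mon => //; apply: Fil_le Hv.
- exact: Pol_zero.
- exact: Pol_add.
exact: Pol_ext Hg.
Qed.

Lemma Pol_scale i (a : rat) f : Pol i f -> Pol i (fun l => a *: f l).
Proof.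
elim=> [s v s0 Hv||g h _ Hg _ Hh|g h e _ Hg].
- apply: (@Pol_ext _ (fun l => (mon s l)%:~R *: (a *: v))).
    by move=> l; rewrite !scalerA mulrC.
  by apply: Pol_mon => //; apply: Fil_scale.
- by apply: (@Pol_ext _ (fun=> 0)); [move=> l; rewrite scaler0|apply: Pol_zero].
- apply: (@Pol_ext _ (fun l => a *: g l + a *: h l)); last exact: Pol_add.
  by move=> l; rewrite scalerDr.
by apply: Pol_ext Hg => l; rewrite e.
Qed.

Lemma Pol_br i j f g : (0 < i)%N -> (0 < j)%N -> Pol i f -> Pol j g ->
  Pol (i + j) (fun l => br (f l) (g l)).
Proof.
move=> i0 j0 Hf Hg; elim: Hf => {f} [s v s0 Hv||f f' _ Hf _ Hf'|f f' e _ Hf].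
- elim: Hg => {g} [s' v' s0' Hv'||g g' _ Hg _ Hg'|g g' e _ Hg].
  + apply: (@Pol_ext _ (fun l => (mon (s ++ s') l)%:~R *: br v v')).
      by move=> l; rewrite (brZl lieL) (brZr lieL) scalerA /mon big_cat rmorphM.
    by apply: Pol_mon; [case: s s0|apply: Fil_br].
  + by apply: (@Pol_ext _ (fun=> 0)); [move=> l; rewrite (br0r lieL)|apply: Pol_zero].
  + by apply: Pol_ext (Pol_add Hg Hg') => l; rewrite (brDr lieL).
  by apply: Pol_ext Hg => l; rewrite e.
- by apply: (@Pol_ext _ (fun=> 0)); [move=> l; rewrite (br0l lieL)|apply: Pol_zero].
- by apply: Pol_ext (Pol_add Hf Hf') => l; rewrite (brDl lieL).
by apply: Pol_ext Hf => l; rewrite e.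
Qed.

Lemma Pol_words i f g w : (0 < i)%N -> Pol i f -> Pol i g ->
  Pol i (fun l => nest br (lett (f l) (g l) w)) /\
  ((1 < size w)%N -> Pol (i + i) (fun l => nest br (lett (f l) (g l) w))).
Proof.
move=> i0 Hf Hg; elim: w => [|b [|b' w] [IH _]].
- by split=> //; apply: Pol_zero.
- by split=> //=; case: b.
have H : Pol (i + i) (fun l => nest br (lett (f l) (g l) [:: b, b' & w])).
  by case: b; apply: Pol_br IH.
by split=> // ; apply: Pol_le H; apply: leq_addr.
Qed.

Lemma Pol_bch i f g : (0 < i)%N -> Pol i f -> Pol i g ->
  Pol (i + i) (fun l => f l ** g l - (f l + g l)).
Proof.
move=> i0 Hf Hg.
apply: (@Pol_ext _ (fun l => 2^-1 *: br (f l) (g l) + bch_tail br K (f l) (g l))).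
  move=> l /=; rewrite (bchg_expand lieL nilL); move: (f l + g l) => z.
  by rewrite [RHS]addrC !addrA addNr add0r.
apply: Pol_add; first by apply: Pol_scale; apply: Pol_br.
apply: (@BCHsum_curve L K.+2 (T -> int) (Pol (i + i)) (fun l w => if (2 < size w)%N then
   (size w)%:R^-1 *: nest br (lett (f l) (g l) w) else 0)).
- exact: Pol_ext.
- exact: Pol_zero.
- exact: Pol_add.
- exact: Pol_scale.
move=> w _; case lt: (2 < size w)%N; last exact: Pol_zero.
by apply: Pol_scale; apply: (Pol_words w i0 Hf Hg).2; apply: ltnW.
Qed.

Lemma Pol_bch_le i f g : (0 < i)%N -> Pol i f -> Pol i g -> Pol i (fun l => f l ** g l).
Proof.
move=> i0 Hf Hg.
apply: (@Pol_ext _ (fun l => (f l ** g l - (f l + g l)) + (f l + g l))).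
  by move=> l; rewrite subrK.
apply: Pol_add; last exact: Pol_add.
by apply: Pol_le (Pol_bch i0 Hf Hg); apply: leq_addr.
Qed.

Lemma mon_scale (N : int) s l : mon s (fun t => N * l t) = N ^+ size s * mon s l.
Proof.
rewrite /mon big_split /=; congr (_ * _).
by elim: s => [|t s IH]; rewrite ?big_nil ?expr0 // big_cons IH exprS.
Qed.

Lemma Pol_subst i (N : int) f : Pol i f -> Pol i (fun l => f (fun t => N * l t)).
Proof.
elim=> [s v s0 Hv||g h _ Hg _ Hh|g h e _ Hg].
- apply: (@Pol_ext _ (fun l => (mon s l)%:~R *: ((N ^+ size s)%:~R *: v))).
    by move=> l; rewrite mon_scale scalerA -rmorphM mulrC.
  by apply: Pol_mon => //; apply: Fil_scale.
- exact: Pol_zero.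
- exact: Pol_add Hg Hh.
by apply: Pol_ext Hg => l; rewrite e.
Qed.

Lemma Pol_congr i f l l' : Pol i f -> l =1 l' -> f l = f l'.
Proof.
move=> Hf e; elim: Hf => [s v _ _||g h _ -> _ ->|g h eg _ Hg] //.
  by congr (_%:~R *: _); apply: eq_bigr.
by rewrite -!eg.
Qed.

Lemma Pol_approx i f : (0 < i)%N -> Pol i f ->
  exists (N : nat) q, [/\ (0 < N)%N, forall l, S (q l), Pol i q &
    Pol i.+1 (fun l => f (fun t => N%:Z * l t) - q l)].
Proof.
move=> i0.
have leS : (i.+1 <= i + i)%N by rewrite -addn1 leq_add2l.
elim=> [s v s0 Hv||f1 f2 F1 [N1 [q1 [N10 S1 P1 R1]]] F2 [N2 [q2 [N20 S2 P2 R2]]]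
  |f1 f2 e _ [N1 [q1 [N10 S1 P1 R1]]]].
- have [N [l [N0 Hl HN]]] := Fil_decompose i0 Hv.
  (* After the substitution the monomial carries [N ^ size s]. One factor [N] turns [v] into an
     integral combination of elements of [S]; the other [(size s).-1] factors remain as an integer
     multiplier. *)
  have [q [Sq Pq Rq]] : exists q, [/\ forall l, S (q l), Pol i q & Pol i.+1
      (fun l' => (mon s l')%:~R *: ((N ^ (size s).-1)%N%:R *: (\sum_(p <- l) p.1%:~R *: p.2)) - q
        l')].
    elim: l {HN} Hl => [|p l IH] Hl.
      exists (fun=> 0); split=> //; first exact: Pol_zero.
      by apply: (Pol_ext _ (Pol_zero _)) => l'; rewrite big_nil !scaler0 subrr.
    have [|q [Sq Pq Rq]] := IH; first by move=> p' p'l; apply: Hl; rewrite inE p'l orbT.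
    have [Sp Hp] := Hl p (mem_head _ _).
    pose r l' := ((mon s l' * ((N ^ (size s).-1)%N%:Z * p.1))%:~R : rat) *: p.2.
    have Pr : Pol i r.
      apply: (@Pol_ext _ (fun l' => (mon s l')%:~R *: (((N ^ (size s).-1)%N%:Z * p.1)%:~R *: p.2))).
        by move=> l'; rewrite scalerA -rmorphM.
      by apply: Pol_mon => //; apply: Fil_scale.
    exists (fun l' => r l' ** q l'); split.
    + by move=> l'; apply: SM => //; apply: SmulZ.
    + exact: Pol_bch_le.
    have H := Pol_add Rq (Pol_scale (-1) (Pol_le leS (Pol_bch i0 Pr Pq))).
    apply: Pol_ext H => l'; rewrite big_cons scaleN1r !scalerDr opprB.
    rewrite /r !rmorphM /= -!scalerA.
    set A := _ *: (_ *: (_ *: p.2)); set B := _ *: (_ *: \sum_(_ <- _) _).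
    by rewrite (AC (2*(2*1)) ((3*1)*5*(4*2)))/= subrr addr0.
  exists N, q; split=> //.
  have H1 : Pol i.+1 (fun l' => (mon s l')%:~R *: ((N ^ (size s).-1)%N%:R *:
       (N%:R *: v - \sum_(p <- l) p.1%:~R *: p.2))).
    by apply: Pol_mon => //; apply: Fil_scale.
  apply: Pol_ext (Pol_add H1 Rq) => l'.
  rewrite !scalerBr addrA subrK; congr (_ - _); rewrite mon_scale !scalerA rmorphM /=.
  congr (_ *: _); rewrite -mulrA -natrM mulrC; congr (_ * _).
  by case: (s) s0 => // t s' _ /=; rewrite -expnSr natrX rmorphXn.
- exists 1%N, (fun=> 0); split=> //; first exact: Pol_zero.
  by apply: (Pol_ext _ (Pol_zero _)) => l'; rewrite subrr.
- exists (N1 * N2)%N, (fun l => q1 (fun t => N2%:Z * l t) ** q2 (fun t => N1%:Z * l t)).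
  have Q1 := Pol_subst N2%:Z P1; have Q2 := Pol_subst N1%:Z P2.
  split; first by rewrite muln_gt0 N10.
  + by move=> l; apply: SM.
  + exact: Pol_bch_le.
  apply: Pol_ext (Pol_add (Pol_add (Pol_subst N2%:Z R1) (Pol_subst N1%:Z R2))
    (Pol_scale (-1) (Pol_le leS (Pol_bch i0 Q1 Q2)))) => l.
  have E1 : f1 (fun t => N1%:Z * (N2%:Z * l t)) = f1 (fun t => (N1 * N2)%N%:Z * l t).
    by apply: (Pol_congr F1) => t; rewrite mulrA.
  have E2 : f2 (fun t => N2%:Z * (N1%:Z * l t)) = f2 (fun t => (N1 * N2)%N%:Z * l t).
    by apply: (Pol_congr F2) => t; rewrite mulrA mulnC.
  rewrite E1 E2 scaleN1r opprB.
  by rewrite (AC ((2*2)*(2*1)) ((1*3*7)*(2*5)*(4*6)))/= !addNr !addr0.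
exists N1, q1; split=> //; apply: Pol_ext R1 => l; by rewrite e.
Qed.

(* Downward induction on the filtration: up to a substitution [l |-> N l], a
   polynomial map agrees with a product of elements of [S] modulo the next term,
   and the quotient is again polynomial. *)
Lemma Pol_in_subgroup i f : (0 < i)%N -> Pol i f ->
  exists M : nat, (0 < M)%N /\ forall l, S (f (fun t => M%:Z * l t)).
Proof.
have [k] := ubnP (K.+1 - i); elim: k i f => // k IH i f lek i0 Hf.
case: (ltnP K i) => [lt|le].
  have f0 : forall l, f l = 0.
    move: lt; elim: Hf {lek i0} => {f} [s v _ Hv||f g _ Hf _ Hg|f g e _ Hf] lt l.
    - by rewrite (Fil_nil lt Hv) scaler0.
    - by [].
    - by rewrite Hf // Hg // addr0.
    by rewrite -e Hf.
  by exists 1%N; split=> // l; rewrite f0.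
have [N [q [N0 Sq Pq Rq]]] := Pol_approx i0 Hf.
have leS : (i.+1 <= i + i)%N by rewrite -addn1 leq_add2l.
have Pf := Pol_subst N%:Z Hf; have PNq := Pol_scale (-1) Pq.
have Ph : Pol i.+1 (fun l => f (fun t => N%:Z * l t) ** (- q l)).
  apply: Pol_ext (Pol_add (Pol_le leS (Pol_bch i0 Pf PNq)) Rq) => l.
  by rewrite scaleN1r subrK.
have [||M [M0 SM']] := IH _ _ _ _ Ph => //; first lia.
exists (N * M)%N; split=> [|l]; first by rewrite muln_gt0 N0.
have := SM (SM' l) (Sq (fun t => M%:Z * l t)).
rewrite bchA (bchNg lieL nilL) (bchg0 lieL nilL).
congr S; apply: (Pol_congr Hf) => t; by rewrite mulrA.
Qed.

End PolynomialMaps.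

Lemma Fil_multiple_in x : Fil 1 x -> exists M : nat, (0 < M)%N /\ S (M%:R *: x).
Proof.
move=> Hx; have := @Pol_mon unit 1 [:: tt] x isT Hx.
move=> /(Pol_in_subgroup (ltnSn 0)) [M [M0 SM']]; exists M; split=> //.
have := SM' (fun=> 1); rewrite /mon big_seq1 mulr1; by congr S.
Qed.

(** A single [M] has to work for all integer vectors at once; this uniformity is why polynomial maps
    were treated instead of single elements. *)
Lemma Fil_lattice_in (r : nat) (v : 'I_r -> L) : (forall j, Fil 1 (v j)) ->
  exists M : nat, (0 < M)%N /\
    forall z : 'I_r -> int, S (\sum_j (M%:Z * z j)%:~R *: v j).
Proof.
move=> Hv; have P : Pol 1 (fun l : 'I_r -> int => \sum_j (l j)%:~R *: v j).
  elim: (index_enum _) => [|j s IH].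
    by apply: (@Pol_ext _ _ (fun=> 0)) (Pol_zero _ _) => l; rewrite big_nil.
  apply: (@Pol_ext _ _ (fun l => (mon [:: j] l)%:~R *: v j + \sum_(j <- s) (l j)%:~R *: v j)).
    by move=> l; rewrite big_cons /mon big_seq1.
  by apply: Pol_add IH; apply: Pol_mon.
by have [M [M0 HM]] := Pol_in_subgroup (ltnSn 0) P; exists M.
Qed.

End LieHull.

(** * Dynkin's formula with explicit exponents, and the nilpotency class *)

Section DynkinFormula.

Definition fcons (T : finType) n (a : T) (r : {ffun 'I_n -> T}) : {ffun 'I_n.+1 -> T} :=
  [ffun i => if unlift ord0 i is Some j then r j else a].

Lemma fcons0 (T : finType) n (a : T) (r : {ffun 'I_n -> T}) : fcons a r ord0 = a.
Proof. by rewrite ffunE unlift_none. Qed.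

Lemma fconsS (T : finType) n (a : T) (r : {ffun 'I_n -> T}) j : fcons a r (lift ord0 j) = r j.
Proof. by rewrite ffunE liftK. Qed.

Lemma big_ffun_recl (T : finType) (V : nmodType) n (F : {ffun 'I_n.+1 -> T} -> V) :
  \sum_r F r = \sum_a \sum_(r : {ffun 'I_n -> T}) F (fcons a r).
Proof.
rewrite pair_big /= (reindex (fun p : T * {ffun 'I_n -> T} => fcons p.1 p.2)) //=.
exists (fun r => (r ord0, [ffun j => r (lift ord0 j)])) => [[a r]|r] _ /=.
  by rewrite fcons0; congr (_, _); apply/ffunP=> j; rewrite ffunE fconsS.
apply/ffunP=> i; rewrite ffunE; case: unliftP => [j ->|->] //.
by rewrite ffunE.
Qed.

Lemma dynkin_word_cons N n a b (r s : {ffun 'I_n -> 'I_N.+1}) :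
  dynkin_word (fcons a r) (fcons b s) = nseq a true ++ nseq b false ++ dynkin_word r s.
Proof.
rewrite /dynkin_word enum_ordSl /= !fcons0 -catA; congr (_ ++ (_ ++ _)).
by rewrite -map_comp; congr flatten; apply: eq_map => j /=; rewrite !fconsS.
Qed.

Lemma size_dynkin_word N n (r s : {ffun 'I_n -> 'I_N.+1}) :
  size (dynkin_word r s) = (\sum_(i < n) (r i + s i))%N.
Proof.
rewrite /dynkin_word size_flatten /shape -map_comp sumnE big_map -big_enum /=.
by apply: eq_bigr => i _; rewrite size_cat !size_nseq.
Qed.

Lemma Tsum_ffun (V : lmodType rat) K n (g : seq bool -> V) :
  Tsum K n g = \sum_(r : {ffun 'I_n -> 'I_K.+1})
    \sum_(s : {ffun 'I_n -> 'I_K.+1} | [forall i, (0 < r i + s i)%N])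
      (\prod_(i < n) (((r i)`!)%:R * ((s i)`!)%:R))^-1 *: g (dynkin_word r s).
Proof.
elim: n g => [|n IH] g /=.
  have f0 (r : {ffun 'I_0 -> 'I_K.+1}) : r = [ffun i => ord0].
    by apply/ffunP=> -[].
  rewrite (bigD1 [ffun i => ord0]) //= [X in _ + X]big1 ?addr0; last first.
    by move=> r; rewrite [r]f0 eqxx.
  rewrite (bigD1 [ffun i => ord0]) /=; last by apply/forallP=> -[].
  rewrite [X in _ + X]big1 ?addr0; last by move=> r; rewrite [r]f0 eqxx andbF.
  by rewrite big_ord0 invr1 scale1r /dynkin_word enum_ord0.
rewrite big_ffun_recl; apply: eq_bigr => a _.
transitivity (\sum_(b < K.+1 | (0 < a + b)%N) \sum_(r : {ffun 'I_n -> 'I_K.+1})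
  \sum_(s : {ffun 'I_n -> 'I_K.+1} | [forall i, (0 < r i + s i)%N])
    ((a`!)%:R * (b`!)%:R)^-1 *: ((\prod_(i < n) (((r i)`!)%:R * ((s i)`!)%:R))^-1 *:
     g (dynkin_word (fcons a r) (fcons b s)))).
  apply: eq_bigr => b _; rewrite IH scaler_sumr; apply: eq_bigr => r _.
  by rewrite scaler_sumr; apply: eq_bigr => s _; rewrite dynkin_word_cons.
rewrite exchange_big /=; apply: eq_bigr => r _.
rewrite [RHS]big_mkcond big_ffun_recl big_mkcond; apply: eq_bigr => b _.
have F s : [forall i, (0 < fcons a r i + fcons b s i)%N]
    = (0 < a + b)%N && [forall i, (0 < r i + s i)%N].
  apply/forallP/andP=> [H|[H0 /forallP H] i].
    split; first by have := H ord0; rewrite !fcons0.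
    by apply/forallP=> j; have := H (lift ord0 j); rewrite !fconsS.
  case: (unliftP ord0 i) => [j ->|->]; first by rewrite !fconsS.
  by rewrite !fcons0.
case: ifP => ab; last by rewrite big1 // => s _; rewrite F ab.
rewrite big_mkcond; apply: eq_bigr => s _; rewrite F ab /=; case: ifP => // _.
rewrite scalerA -invfM big_ord_recl !fcons0; congr (_^-1 *: _).
by congr (_ * _); apply: eq_bigr => i _; rewrite !fconsS.
Qed.

Lemma rnestE (d : nat) (c : 'I_d -> 'I_d -> 'rV[rat]_d) s : rnest c s = nest (lie_br c) s.
Proof. by elim: s => [|a [|b s] IH] //; rewrite -[LHS]/(lie_br c a (rnest c (b :: s))) IH. Qed.

Lemma bch_bchg (d : nat) (c : 'I_d -> 'I_d -> 'rV[rat]_d) x y :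
  nil_bracket (lie_br c) d -> bch c x y = bchg (lie_br c) d x y.
Proof.
move=> nil; rewrite /bchg /BCHsum big_geq_mkord /bch; apply: eq_bigr => n _.
rewrite Tsum_ffun scaler_sumr; apply: eq_bigr => r _.
rewrite scaler_sumr big_mkcondr; apply: eq_bigr => s _.
rewrite -size_dynkin_word -/(lett x y _) rnestE; case: ifP => lt.
  rewrite !scalerA !invfM !mulrA; congr (_ *: _).
  by rewrite -!mulrA; congr (_ * (_ * _)); rewrite mulrC.
by rewrite nil ?scaler0 // size_map ltnNge lt.
Qed.

End DynkinFormula.

Section NilpotencyClass.
Variables (d : nat) (c : 'I_d -> 'I_d -> 'rV[rat]_d).
Local Notation br := (lie_br c).

(** [V i] contains the nested brackets of length [i + 1]. If two consecutive ranks agree, the series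
    is stationary from there on and therefore zero by nilpotency; so the rank drops at every step
    until it is zero, within [d] steps. *)
Lemma nilpotent_bracket : lie_bracket br -> lie_nilpotent c -> nil_bracket br d.
Proof.
move=> lieL [k nilk].
pose M j := (admx c (delta_mx 0 j))^T.
have ME v j : v *m M j = br (delta_mx 0 j) v.
  by rewrite -[v]trmxK -trmx_mul admxE // !trmxK.
pose V := fix V i := if i is i'.+1 then (\sum_j V i' *m M j)%MS else 1%:M : 'M[rat]_d.
have Vnest i (P : 'rV[rat]_d -> Prop) : P 0 -> (forall x y, P x -> P y -> P (x + y)) ->
    (forall s, size s = i.+1 -> P (nest br s)) -> forall v, (v <= V i)%MS -> P v.
  elim: i P => [|i IH] P P0 PD Ps v; first by move=> _; apply: (Ps [:: v]).
  move=> /= /sub_sumsmxP[u ->]; apply: (big_ind P) => // j _.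
  rewrite mulmxA ME; apply: (IH (fun x => P (br (delta_mx 0 j) x))).
  - by rewrite (br0r lieL).
  - by move=> x y Px Py; rewrite (brDr lieL); apply: PD.
  - by move=> s ss; have := Ps (delta_mx 0 j :: s); case: s ss => //= a s [->] /(_ erefl).
  exact: submxMl.
have nestV s : (nest br s <= V (size s).-1)%MS.
  elim: s => [|a [|b s] IH]; rewrite ?submx1 //.
  rewrite -[nest br _]/(br a (nest br (b :: s))).
  have -> : br a (nest br (b :: s)) = \sum_j a 0 j *: (nest br (b :: s) *m M j).
    rewrite {1}[a]row_sum_delta; elim/big_rec2: _ => [|j y1 y2 _ <-]; first exact: br0l.
    by rewrite (brDl lieL) (brZl lieL) ME.
  apply: summx_sub => j _; apply: scalemx_sub; apply: (sumsmx_sup j) => //.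
  exact: submxMr.
have VS i : (V i.+1 <= V i)%MS.
  elim: i => [|i IH]; first by rewrite submx1.
  apply/sumsmx_subP => j _; apply: (sumsmx_sup j) => //; exact: submxMr.
have Vk : V k = 0.
  apply/eqP/rowV0P => v /(Vnest k (fun v => v = 0)); apply => //.
    by move=> x y -> ->; rewrite addr0.
  by move=> s ss; rewrite -rnestE nilk.
have Vrank i : V i = 0 \/ (\rank (V i.+1) < \rank (V i))%N.
  case: (ltnP (\rank (V i.+1)) (\rank (V i))) => [|le]; [by right|left].
  have eqV : (V i == V i.+1)%MS by rewrite VS andbT -(geq_leqif (mxrank_leqif_sup (VS i))).
  have stable j : (V (i + j)%N == V i)%MS.
    elim: j => [|j IHj]; first by rewrite addn0 submx_refl.
    rewrite addnS; apply/eqmxP; apply: eqmx_trans (eqmx_sym (eqmxP eqV)) => /=.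
    apply: eqmx_sums => l _; exact: eqmxMr (eqmxP IHj).
  have le0 j : (k <= j)%N -> V j = 0.
    move=> /subnKC <-; elim: (j - k)%N => [|m IHm]; first by rewrite addn0.
    by rewrite addnS /= big1 // => l _; rewrite IHm mul0mx.
  by have := stable k; rewrite le0 ?leq_addl // => /andP[_]; rewrite submx0 => /eqP.
have Vd i : (\rank (V i) <= d - i)%N.
  elim: i => [|i IH]; first by rewrite subn0 rank_leq_row.
  case: (Vrank i) => [V0|lt]; last by have := leq_trans lt IH; lia.
  by rewrite /= big1 ?mxrank0 // => j _; rewrite V0 mul0mx.
move=> s lt; have := nestV s; have := Vd (size s).-1.
rewrite (_ : d - _ = 0)%N; last by lia.
by rewrite leqn0 mxrank_eq0 => /eqP ->; rewrite submx0 => /eqP.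
Qed.

End NilpotencyClass.

(** * Groups inside their Malcev Lie algebra *)

Section GroupFacts.
Variable G : Grp.
Implicit Types g h : G.

Lemma gmulgV g : gmul g (ginv g) = gone.
Proof.
have e : gmul (gmul (ginv (ginv g)) (ginv g)) (gmul g (ginv g)) = gmul g (ginv g).
  by rewrite gmulVg gmul1g.
by rewrite -e -!gmulA [gmul (ginv g) (gmul _ _)]gmulA gmulVg gmul1g gmulVg.
Qed.

Lemma gmulg1 g : gmul g gone = g.
Proof. by rewrite -(gmulVg g) gmulA gmulgV gmul1g. Qed.

Lemma gmulKg g h : gmul (ginv g) (gmul g h) = h.
Proof. by rewrite gmulA gmulVg gmul1g. Qed.

Lemma ginv_unique g h : gmul g h = gone -> h = ginv g.
Proof. by move=> e; rewrite -[LHS](gmulKg g) e gmulg1. Qed.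

Lemma ginvK g : ginv (ginv g) = g.
Proof. by symmetry; apply: ginv_unique; apply: gmulVg. Qed.

Lemma gpowD g m n : gpow g (m + n) = gmul (gpow g m) (gpow g n).
Proof. by elim: m => [|m IH] /=; rewrite ?gmul1g // IH gmulA. Qed.

End GroupFacts.

Section PairAlgebra.
Variables (d : nat) (c : 'I_d -> 'I_d -> 'rV[rat]_d).
Local Notation n := 'rV[rat]_d.
Local Notation br := (lie_br c).
Hypotheses (lieL : lie_bracket br) (nilL : nil_bracket br d).

Definition br_pair (U V : (n * n)%type) : (n * n)%type := (br U.1 V.1, br U.2 V.2).

Lemma br_pair_lie : lie_bracket br_pair.
Proof.
split.
- by move=> y a x x'; congr (_, _); apply: br_linl.
- by move=> x a y y'; congr (_, _); apply: br_linr.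
- by move=> x; congr (_, _); apply: br_xx.
by move=> x y z; congr (_, _); apply: br_jacobi.
Qed.

Lemma br_pair_nil : nil_bracket br_pair d.
Proof.
move=> s lt; rewrite [LHS]surjective_pairing.
rewrite (nest_morph (br' := br) (phi := fst)) // (nest_morph (br' := br) (phi := snd)) //.
by rewrite !nilL ?size_map.
Qed.

Lemma bch_pair U V : bchg br_pair d U V = (bchg br d U.1 V.1, bchg br d U.2 V.2).
Proof.
by rewrite [LHS]surjective_pairing; congr (_, _); apply: bchg_morph.
Qed.

Lemma bch_pair_assoc U V W : bchg br_pair d (bchg br_pair d U V) W =
  bchg br_pair d U (bchg br_pair d V W).
Proof. by rewrite !bch_pair /= !(bchg_assoc lieL nilL). Qed.

End PairAlgebra.

Section MalcevFacts.
Variables (G : Grp) (d : nat) (c : 'I_d -> 'I_d -> 'rV[rat]_d) (iota : G -> 'rV[rat]_d).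
Hypothesis malcev : is_malcev_lie_algebra c iota.
Local Notation n := 'rV[rat]_d.
Local Notation br := (lie_br c).
Local Notation "x ** y" := (bchg br d x y) (at level 40, left associativity).

Lemma malcev_lie : lie_bracket br.
Proof. by apply: lie_alg_bracket; case: malcev. Qed.

Lemma malcev_nil : nil_bracket br d.
Proof. by case: malcev => _ [nil _]; apply: (nilpotent_bracket malcev_lie nil). Qed.

Let lieL := malcev_lie.
Let nilL := malcev_nil.

Lemma iotaM g h : iota (gmul g h) = iota g ** iota h.
Proof. by case: malcev => _ [_ [_ [-> _]]]; rewrite bch_bchg. Qed.

Lemma iota_inj : injective iota.
Proof. by case: malcev => _ [_ [H _]]. Qed.

Lemma bchKg x y : (- x) ** (x ** y) = y.
Proof. by rewrite -(bchg_assoc lieL nilL) (bchNg lieL nilL) (bch0g lieL nilL). Qed.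

Lemma iota1 : iota gone = 0.
Proof.
by have := bchKg (iota gone) (iota gone); rewrite -iotaM gmul1g (bchNg lieL nilL) => <-.
Qed.

Lemma iotaV g : iota (ginv g) = - iota g.
Proof.
have := bchKg (iota g) (iota (ginv g)); rewrite -iotaM gmulgV iota1.
by rewrite (bchg0 lieL nilL) => <-.
Qed.

Lemma iotaX g m : iota (gpow g m) = m%:R *: iota g.
Proof.
elim: m => [|m IH] /=; first by rewrite iota1 scale0r.
rewrite iotaM IH -{1}[iota g]scale1r (bchg_mul lieL nilL).
by congr (_ *: _); rewrite -add1n natrD.
Qed.

Lemma malcev_ind (P : n -> Prop) : P 0 -> (forall x y, P x -> P y -> P (x + y)) ->
  (forall (a : rat) x, P x -> P (a *: x)) -> (forall x y, P x -> P y -> P (br x y)) ->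
  (forall g, P (iota g)) -> forall x, P x.
Proof. by case: malcev => _ [_ [_ [_ H]]]; apply: H. Qed.

End MalcevFacts.

(** * The automorphism attached to a self-similar action *)

Section SelfSimilarAutomorphism.
Variables (G : Grp) (d : nat) (c : 'I_d -> 'I_d -> 'rV[rat]_d) (iota : G -> 'rV[rat]_d).
Hypothesis malcev : is_malcev_lie_algebra c iota.
Local Notation n := 'rV[rat]_d.
Local Notation br := (lie_br c).
Let lieL := malcev_lie malcev.
Let nilL := malcev_nil malcev.

Variables (A : finType) (act : G -> (nat -> A) -> (nat -> A)) (a : A).
Hypotheses (actP : is_action act) (selfsim : self_similar act) (free : free_action act).

Let funext (T U : Type) (f f' : T -> U) : f =1 f' -> f = f'.
Proof. exact: FunctionalExtensionality.functional_extensionality. Qed.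

Lemma scons_inj (b b' : A) w w' : scons b w = scons b' w' -> b = b' /\ w = w'.
Proof.
move=> e; split; first by have := congr1 (fun f => f 0%N) e.
by apply: funext => k; have := congr1 (fun f => f k.+1) e.
Qed.

Let w0 : nat -> A := fun=> a.

Let w0E : w0 = scons a w0.
Proof. by apply: funext => -[]. Qed.

Definition vend (g g' : G) := forall w, act g (scons a w) = scons a (act g' w).

Lemma vend1 : vend gone gone.
Proof. by move=> w; rewrite !actP.1. Qed.

Lemma vendM g g' h h' : vend g g' -> vend h h' -> vend (gmul g h) (gmul g' h').
Proof. by move=> Hg Hh w; rewrite !actP.2 Hh Hg. Qed.

Lemma vendV g g' : vend g g' -> vend (ginv g) (ginv g').
Proof.
move=> Hg w; rewrite -{1}[w]actP.1 -(gmulgV g') actP.2 -Hg -actP.2 gmulVg.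
by rewrite actP.1.
Qed.

Lemma vend1l g' : vend gone g' -> g' = gone.
Proof.
move=> /(_ w0); rewrite actP.1 => /scons_inj[_ e].
by apply: (free (w := w0)).
Qed.

Lemma vend1r g : vend g gone -> g = gone.
Proof. by move=> /(_ w0); rewrite actP.1; apply: free. Qed.

Let letter g b := act g (scons b w0) 0%N.

Let letterE g b w : act g (scons b w) 0%N = letter g b.
Proof. by have [ga [b' H]] := selfsim g b; rewrite /letter !H. Qed.

Let letterM g h b : letter (gmul g h) b = letter g (letter h b).
Proof.
by have [ga [b' H]] := selfsim h b; rewrite /letter actP.2 H /= letterE.
Qed.

(** By the pigeonhole principle two among the first [#|A| + 1] powers of [g] send [a] to the same
    letter, and their quotient fixes [a]. *)
Lemma vend_power g : exists m g', (0 < m)%N /\ vend (gpow g m) g'.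
Proof.
pose f (i : 'I_#|A|.+1) := letter (gpow g i) a.
have /injectivePn[i [j ij e]] : ~~ injectiveb f.
  apply/negP => /injectiveP/leq_card; by rewrite card_ord ltnn.
wlog lt : i j ij e / (i < j)%N.
  by move=> H; case: (ltngtP i j) => [|/(H j i)|/val_inj/eqP]; rewrite ?(negPf ij);
    [apply: H|apply; rewrite 1?eq_sym|].
exists (j - i)%N; have [g' [b H]] := selfsim (gpow g (j - i)) a.
exists g'; rewrite subn_gt0; split=> // w; rewrite H; congr scons.
have: letter (ginv (gpow g i)) (f i) = letter (ginv (gpow g i)) (f j) by rewrite e.
rewrite /f -!letterM gmulVg -(subnKC (ltnW lt)) gpowD gmulKg {1 2}/letter actP.1 H.
by [].
Qed.

Let S (U : (n * n)%type) := exists g g', vend g g' /\ U = (iota g, iota g').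

Let S0 : S 0.
Proof. by exists gone, gone; split; [apply: vend1|rewrite (iota1 malcev)]. Qed.

Let SM U V : S U -> S V -> S (bchg (br_pair c) d U V).
Proof.
move=> [g [g' [Hg ->]]] [h [h' [Hh ->]]]; exists (gmul g h), (gmul g' h').
by split; [apply: vendM|rewrite bch_pair !(iotaM malcev)].
Qed.

Let SN U : S U -> S (- U).
Proof.
move=> [g [g' [Hg ->]]]; exists (ginv g), (ginv g').
by split; [apply: vendV|rewrite !(iotaV malcev)].
Qed.

Let lie2 := br_pair_lie lieL.
Let nil2 := br_pair_nil nilL.
Let H := Fil (br_pair c) S 1.

Let Hmul U : H U -> exists M : nat, (0 < M)%N /\ S (M%:R *: U).
Proof.
apply: (Fil_multiple_in lie2 nil2 _ S0 (fun U V => @SM U V) (fun U => @SN U)).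
by move=> *; apply: bch_pair_assoc.
Qed.

Let Hbr U V : H U -> H V -> H (br_pair c U V).
Proof. by move=> HU HV; apply: Fil_le (Fil_br lie2 _ _ HU HV). Qed.

(** By [Hmul] a positive multiple of any pair in the hull comes from actual group elements, to which
    freeness applies. *)
Let H0l y : H (0, y) -> y = 0.
Proof.
move=> /Hmul[M [M0 [g [g' [Hg e]]]]].
have /(iota_inj malcev) eg : iota g = iota gone.
  by rewrite (iota1 malcev) -[LHS](congr1 fst e) /= scaler0.
have := congr1 snd e; rewrite /= (vend1l (g' := g')); last by rewrite -eg.
rewrite (iota1 malcev) => /eqP; rewrite scaler_eq0 pnatr_eq0 => /orP[/eqP M0'|/eqP //].
by move: M0; rewrite M0'.
Qed.

Let H0r x : H (x, 0) -> x = 0.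
Proof.
move=> /Hmul[M [M0 [g [g' [Hg e]]]]].
have /(iota_inj malcev) eg : iota g' = iota gone.
  by rewrite (iota1 malcev) -[LHS](congr1 snd e) /= scaler0.
have := congr1 fst e; rewrite /= (vend1r (g := g)); last by rewrite -eg.
rewrite (iota1 malcev) => /eqP; rewrite scaler_eq0 pnatr_eq0 => /orP[/eqP M0'|/eqP //].
by move: M0; rewrite M0'.
Qed.

Let Honto x : exists y, H (x, y).
Proof.
apply: (malcev_ind malcev (P := fun x => exists y, H (x, y))).
- by exists 0; apply: Fil_zero.
- by move=> x1 x2 [y1 H1] [y2 H2]; exists (y1 + y2); apply: (Fil_add H1 H2).
- by move=> q x1 [y1 H1]; exists (q *: y1); apply: (Fil_scale q H1).
- by move=> x1 x2 [y1 H1] [y2 H2]; exists (br y1 y2); apply: (Hbr H1 H2).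
move=> g; have [m [g' [m0 Hg]]] := vend_power g.
exists (m%:R^-1 *: iota g').
have HS : H (iota (gpow g m), iota g').
  by apply: Fil_S; exists (gpow g m), g'.
have := Fil_scale (m%:R^-1) HS; congr H; congr (_, _).
by rewrite /= (iotaX malcev) scalerA mulVf ?scale1r // pnatr_eq0 -lt0n.
Qed.

Lemma selfsimilar_automorphism : exists F : 'M[rat]_d,
  [/\ F \in unitmx, (forall x y, br x y *m F = br (x *m F) (y *m F))
   & forall k, \det (F ^+ k.+1 - 1) != 0].
Proof.
have /fin_all_exists[y Hy] := fun j : 'I_d => Honto (delta_mx 0 j).
pose F : 'M[rat]_d := \matrix_j y j.
have HF x : H (x, x *m F).
  rewrite {2}[x]row_sum_delta {1}[x]row_sum_delta mulmx_suml.
  elim: (index_enum _) => [|j s IH]; first by rewrite !big_nil; apply: Fil_zero.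
  rewrite !big_cons; have Hj : H (x 0 j *: delta_mx 0 j, x 0 j *: delta_mx 0 j *m F).
    by rewrite -scalemxAl -rowE rowK; apply: (Fil_scale (x 0 j) (Hy j)).
  exact: (Fil_add Hj IH).
have Finj (v : n) : v *m F = 0 -> v = 0 by move=> e; have := HF v; rewrite e => /H0r.
exists F; split.
- rewrite -row_free_unit -kermx_eq0; apply/rowV0P => v /sub_kermxP; exact: Finj.
- move=> x1 x2; apply/eqP; rewrite -subr_eq0; apply/eqP/H0l.
  have := Fil_sub (HF (br x1 x2)) (Hbr (HF x1) (HF x2)); congr H.
  by congr (_, _); rewrite /= subrr.
move=> k; apply/negP => /det0P[v v0]; rewrite mulmxBr mulmx1 => /eqP.
rewrite subr_eq0 => /eqP vF.
pose u i := v *m F ^+ i.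
have uS i : u i.+1 = u i *m F by rewrite /u exprSr mulmxA.
have uper i : u i = u (i %% k.+1)%N.
  rewrite {1}(divn_eq i k.+1) /u; elim: (i %/ k.+1)%N => [|q IH]; first by rewrite mul0n.
  by rewrite mulSn -addnA exprD mulmxA vF.
(* The orbit of [v] under [F] is finite, so one multiple [N] puts all pairs [N (u i, u i.+1)] into
   the group graph at once. The element over [N u i] then fixes [a] with the element over [N u i.+1]
   as its state, and by induction it fixes every letter of the constant word. *)
have /fin_all_exists[M HM] := fun i : 'I_k.+1 => Hmul (HF (u i)).
pose N := (\prod_(i < k.+1) M i)%N.
have N0 : (0 < N)%N by apply: prodn_gt0 => i; case: (HM i).
have SU i : S (N%:R *: (u i, u i.+1)).
  have -> : (u i, u i.+1) = (u (i %% k.+1)%N, u (i %% k.+1)%N.+1).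
    by rewrite !uS -!uper.
  have lt : (i %% k.+1 < k.+1)%N by rewrite ltn_pmod.
  have [_ HS] := HM (Ordinal lt); rewrite -uS in HS.
  have := SmulZ lie2 nil2 S0 (fun U V => @SM U V) (fun U => @SN U)
     (Posz (\prod_(j < k.+1 | j != Ordinal lt) M j)) HS.
  rewrite scalerA -pmulrn -natrM; congr (S (_%:R *: _)).
  by rewrite /N [RHS](bigD1 (Ordinal lt)) //= mulnC.
have Hfix m : forall i g, iota g = N%:R *: u i -> act g w0 m = a.
  elim: m => [|m IH] i g eg; have [g1 [g1' [Hg /esym e]]] := SU i;
    have eg1 : g1 = g by apply: (iota_inj malcev); rewrite eg; exact: (congr1 fst e).
    by rewrite w0E -eg1 Hg.
  rewrite w0E -eg1 Hg /=; apply: (IH i.+1).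
  exact: (congr1 snd e).
have [g [g' [Hg e]]] := SU 0%N.
have eg : iota g = N%:R *: u 0%N := esym (congr1 fst e).
have g1 : g = gone.
  by apply: (free (w := w0)); apply: funext => m; apply: Hfix eg.
move/eqP: eg; rewrite g1 (iota1 malcev) eq_sym scaler_eq0 pnatr_eq0 -leqn0 leqNgt N0.
by rewrite /u expr0 mulmx1 (negPf v0).
Qed.

End SelfSimilarAutomorphism.

Lemma seq_choice (T : eqType) (U : Type) (u0 : U) (P : T -> U -> Prop) (s : seq T) :
  (forall x, x \in s -> exists y, P x y) ->
  exists f : T -> U, forall x, x \in s -> P x (f x).
Proof.
elim: s => [|a s IH] H; first by exists (fun=> u0).
have [|f Hf] := IH; first by move=> x xs; apply: H; rewrite inE xs orbT.
have [y Py] := H a (mem_head _ _).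
exists (fun x => if x == a then y else f x) => x; rewrite inE.
by case: eqP => [-> _|_ /= /Hf].
Qed.

(** * Spectral decomposition and gradings *)

Section SpectralProjections.
Variables (K : fieldType) (d' : nat).
Local Notation d := d'.+1.
Variables (M : 'M[K]_d) (s : seq K) (N : nat).
Let p (lam : K) : {poly K} := ('X - lam%:P) ^+ N.
Hypotheses (uniq_s : uniq s) (ann : horner_mx M (\prod_(lam <- s) p lam) = 0).

Lemma coprime_Xsub_pow (lam mu : K) i j : lam != mu ->
  coprimep (('X - lam%:P) ^+ i) (('X - mu%:P) ^+ j).
Proof.
move=> ne; apply: coprimep_expl; apply: coprimep_expr.
by rewrite coprimep_XsubC root_XsubC eq_sym.
Qed.

Lemma coprime_Xsub_prod lam (r : seq K) : lam \notin r ->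
  coprimep (p lam) (\prod_(mu <- r) p mu).
Proof.
elim: r => [|mu r IH]; first by rewrite big_nil coprimep1.
rewrite inE negb_or big_cons => /andP[ne nr].
by rewrite coprimepMr coprime_Xsub_pow ?IH.
Qed.

Lemma horner_all_dvd f : (forall lam, lam \in s -> p lam %| f) -> horner_mx M f = 0.
Proof.
move=> H; have : \prod_(lam <- s) p lam %| f.
  elim: s uniq_s H => [|mu r IH]; first by rewrite big_nil dvd1p.
  rewrite cons_uniq => /andP[nr ur] H.
  rewrite big_cons Gauss_dvdp ?coprime_Xsub_prod //.
  by rewrite H ?mem_head // IH // => lam lr; apply: H; rewrite inE lr orbT.
by move=> /dvdpP[g ->]; rewrite rmorphM /= ann mulr0.
Qed.

Lemma spectral_projections : exists pi : K -> 'M[K]_d,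
  [/\ \sum_(lam <- s) pi lam = 1,
      forall lam mu, lam \in s -> mu \in s -> lam != mu -> pi lam * pi mu = 0,
      forall lam, lam \in s -> pi lam * (M - lam%:M) ^+ N = 0
    & forall lam, lam \in s -> exists e, pi lam = horner_mx M e].
Proof.
have [e He] : exists e : K -> {poly K}, forall lam, lam \in s ->
    (forall mu, mu \in s -> mu != lam -> p mu %| e lam) /\ p lam %| e lam - 1.
  apply: (@seq_choice K {poly K} 0 (fun lam f =>
    (forall mu, mu \in s -> mu != lam -> p mu %| f) /\ p lam %| f - 1)) => lam ls.
  have /Bezout_eq1_coprimepP[[u v] /= uv] : coprimep (p lam) (\prod_(mu <- rem lam s) p mu).
    by apply: coprime_Xsub_prod; rewrite mem_rem_uniqF.
  exists (v * \prod_(mu <- rem lam s) p mu); split.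
    move=> mu ms ne; apply: dvdp_mull; rewrite (big_rem mu) /=; first exact: dvdp_mulr.
    by rewrite mem_rem_uniq // !inE ne.
  have -> : v * \prod_(mu <- rem lam s) p mu = 1 - u * p lam.
    by apply/eqP; rewrite eq_sym subr_eq [X in _ == X]addrC uv.
  by rewrite addrAC subrr add0r dvdpNr dvdp_mull.
have pE lam : horner_mx M (p lam) = (M - lam%:M) ^+ N.
  by rewrite rmorphXn rmorphB /= horner_mx_X horner_mx_C.
exists (fun lam => horner_mx M (e lam)); split.
- apply/eqP; rewrite -subr_eq0 -(rmorph1 (horner_mx M)) -raddf_sum -raddfB; apply/eqP.
  apply: horner_all_dvd => mu ms; rewrite (big_rem mu) //= addrAC.
  rewrite dvdp_addr ?(He mu ms).2 // big_seq.
  apply: (big_ind (fun f => p mu %| f)); [exact: dvdp0|exact: dvdp_add|].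
  move=> lam; rewrite mem_rem_uniq // !inE => /andP[ne ls].
  by apply: (He lam ls).1 => //; rewrite eq_sym.
- move=> lam mu ls ms ne; rewrite -rmorphM; apply: horner_all_dvd => nu ns.
  case: (eqVneq nu lam) => [->|ne'].
    by apply: dvdp_mull; apply: (He mu ms).1.
  by apply: dvdp_mulr; apply: (He lam ls).1.
- move=> lam ls; rewrite -pE -rmorphM; apply: horner_all_dvd => nu ns.
  case: (eqVneq nu lam) => [->|ne']; first exact: dvdp_mull.
  by apply: dvdp_mulr; apply: (He lam ls).1.
by move=> lam _; exists (e lam).
Qed.

End SpectralProjections.

Section SpectralTheory.
Variables (K : fieldType) (d' : nat).
Local Notation d := d'.+1.
Variables (M : 'M[K]_d) (s : seq K) (N : nat) (pi : K -> 'M[K]_d).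
Hypotheses (uniq_s : uniq s)
  (pi1 : \sum_(lam <- s) pi lam = 1)
  (pi0 : forall lam mu, lam \in s -> mu \in s -> lam != mu -> pi lam * pi mu = 0)
  (piM : forall lam, lam \in s -> pi lam * (M - lam%:M) ^+ N = 0)
  (piP : forall lam, lam \in s -> exists e, pi lam = horner_mx M e).

Lemma pi_idem lam : lam \in s -> pi lam * pi lam = pi lam.
Proof.
move=> ls; rewrite -[RHS]mulr1 -pi1 (big_rem lam) //= mulrDr mulr_sumr big_seq big1 ?addr0 //.
by move=> mu; rewrite mem_rem_uniq // !inE eq_sym => /andP[ne ms]; apply: pi0.
Qed.

Lemma pi_comm lam : lam \in s -> GRing.comm (pi lam) M.
Proof.
move=> /piP[e ->].
have : horner_mx M (e * 'X) = horner_mx M ('X * e) by rewrite mulrC.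
by rewrite !rmorphM /= horner_mx_X.
Qed.

Lemma pi_comm_sub lam mu k : lam \in s -> GRing.comm (pi lam) ((M - mu%:M) ^+ k).
Proof.
move=> ls; apply: commrX; apply: commrB; first exact: pi_comm.
exact: scalar_mxC.
Qed.

Lemma nilp_two (lam mu : K) i j m (A : 'M[K]_(m, d)) : lam != mu ->
  A *m (M - lam%:M) ^+ i = 0 -> A *m (M - mu%:M) ^+ j = 0 -> A = 0.
Proof.
move=> ne Ai Aj.
have /Bezout_eq1_coprimepP[[u v] /= uv] := coprime_Xsub_pow i j ne.
have pE nu k : horner_mx M (('X - nu%:P) ^+ k) = (M - nu%:M) ^+ k.
  by rewrite rmorphXn rmorphB /= horner_mx_X horner_mx_C.
have := congr1 (fun f => A *m horner_mx M f) uv.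
rewrite /= rmorph1 mulmx1 => <-; rewrite rmorphD mulmxDr /=.
by rewrite ![_ * ('X - _) ^+ _]mulrC !rmorphM /= !mulmxA !pE Ai Aj !mul0mx addr0.
Qed.

Lemma pi_fix lam k m (A : 'M[K]_(m, d)) : lam \in s ->
  A *m (M - lam%:M) ^+ k = 0 -> A *m pi lam = A.
Proof.
move=> ls Ak; rewrite -[RHS]mulmx1 -[1%:M]pi1 (big_rem lam) //= mulmxDr mulmx_sumr.
rewrite big_seq big1 ?addr0 // => mu; rewrite mem_rem_uniq // !inE => /andP[ne ms].
apply: (@nilp_two lam mu k N); rewrite 1?eq_sym //.
  by rewrite -mulmxA [X in _ *m X](pi_comm_sub lam k ms) mulmxA Ak mul0mx.
by rewrite -mulmxA [X in _ *m X](piM ms) mulmx0.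
Qed.

Lemma pi_notin nu k m (A : 'M[K]_(m, d)) : nu \notin s ->
  A *m (M - nu%:M) ^+ k = 0 -> A = 0.
Proof.
move=> ns Ak; rewrite -[A]mulmx1 -[1%:M]pi1 mulmx_sumr big_seq big1 // => mu ms.
apply: (@nilp_two nu mu k N); first by apply: contraNneq ns => ->.
  by rewrite -mulmxA [X in _ *m X](pi_comm_sub nu k ms) mulmxA Ak mul0mx.
by rewrite -mulmxA [X in _ *m X](piM ms) mulmx0.
Qed.

End SpectralTheory.

Section BracketEigenspaces.
Variables (K : fieldType) (d' : nat).
Local Notation d := d'.+1.
Variables (c : 'I_d -> 'I_d -> 'rV[K]_d) (M : 'M[K]_d).
Local Notation br := (lie_br c).

Lemma nilp_suffix m (A : 'M[K]_(m, d)) B k : A *m B ^+ k = 0 ->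
  k != 0%N -> A *m B *m B ^+ k.-1 = 0.
Proof. by case: k => // k e _; rewrite -mulmxA -[B *m _]exprS. Qed.

Let br0 : (forall x, br x 0 = 0) /\ (forall y, br 0 y = 0).
Proof.
split=> x; first by have := lie_br_linr c x (-1) 0 0; rewrite scaler0 addr0 scaleN1r addNr.
by have := lie_br_linl c x (-1) 0 0; rewrite scaler0 addr0 scaleN1r addNr.
Qed.

Let brDZ x a y y' : br x (y - a *: y') = br x y - a *: br x y'.
Proof. by rewrite addrC -scaleNr lie_br_linr scaleNr addrC. Qed.

Let brDZl x a y y' : br (y - a *: y') x = br y x - a *: br y' x.
Proof. by rewrite addrC -scaleNr (lie_br_linl c x) scaleNr addrC. Qed.

Let subM (x : 'rV[K]_d) lam : x *m (M - lam%:M) = x *m M - lam *: x.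
Proof. by rewrite mulmxBr mul_mx_scalar. Qed.

Section TwoGenerators.
Variable op : K -> K -> K.

(* The bracket maps generalized eigenvectors to generalized eigenvectors as
   soon as [br x y *m (M - op lam mu)] is a sum of brackets with one factor
   pushed through [M - lam] or [M - mu]. *)
Hypothesis step : forall lam mu x y, exists B B' : 'M[K]_d, exists a b : K,
  [/\ GRing.comm B M, GRing.comm B' M &
   br x y *m (M - (op lam mu)%:M) =
     a *: br (x *m (M - lam%:M)) (y *m B) + b *: br (x *m B') (y *m (M - mu%:M))].

(** Induction on [i + j]: each term on the right of [step] has one exponent lowered, and the
    commuting factors [B] and [B'] leave the other exponent intact. It is applied with [op] the
    product for automorphisms and the sum for derivations. *)
Lemma br_gen_eigen lam mu i j x y :
  x *m (M - lam%:M) ^+ i = 0 -> y *m (M - mu%:M) ^+ j = 0 ->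
  br x y *m (M - (op lam mu)%:M) ^+ (i + j) = 0.
Proof.
have [k] := ubnP (i + j); elim: k i j x y => // k IH i j x y lek xi yj.
case: (eqVneq i 0%N) => [i0|i0].
  by move: xi; rewrite i0 expr0 mulmx1 => ->; rewrite br0.2 mul0mx.
case: (eqVneq j 0%N) => [j0|j0].
  by move: yj; rewrite j0 expr0 mulmx1 => ->; rewrite br0.1 mul0mx.
have cs nu B n : GRing.comm B M -> GRing.comm B ((M - nu%:M) ^+ n).
  move=> cB; apply: commrX; apply: commrB => //; exact: scalar_mxC.
have [B [B' [a [b [cB cB' e]]]]] := step lam mu x y.
have -> : (i + j = (i + j).-1.+1)%N by rewrite prednK //; lia.
rewrite exprS [_ * _]/(_ *m _) mulmxA e mulmxDl -!scalemxAl.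
rewrite [X in _ *: X + _](_ : _ = 0) ?[X in _ + _ *: X](_ : _ = 0) ?scaler0 ?addr0 //.
  rewrite (_ : (i + j).-1 = i + j.-1)%N; last by lia.
  apply: IH; first by lia.
    by rewrite -mulmxA [X in _ *m X](cs _ _ _ cB') mulmxA xi mul0mx.
  exact: nilp_suffix.
rewrite (_ : (i + j).-1 = i.-1 + j)%N; last by lia.
apply: IH; first by lia.
  exact: nilp_suffix.
by rewrite -mulmxA [X in _ *m X](cs _ _ _ cB) mulmxA yj mul0mx.
Qed.

End TwoGenerators.

Lemma br_aut_eigen : (forall x y, br x y *m M = br (x *m M) (y *m M)) ->
  forall lam mu i j x y, x *m (M - lam%:M) ^+ i = 0 -> y *m (M - mu%:M) ^+ j = 0 ->
    br x y *m (M - (lam * mu)%:M) ^+ (i + j) = 0.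
Proof.
move=> aut; apply: br_gen_eigen => lam mu x y.
exists M, 1, 1, lam; split; [by []|exact: commr_sym (commr1 M)|].
rewrite scale1r mulmx1 !subM aut brDZ brDZl scalerBr scalerA addrA subrK.
by rewrite mulrC.
Qed.

Lemma br_der_eigen : (forall x y, br x y *m M = br (x *m M) y + br x (y *m M)) ->
  forall lam mu i j x y, x *m (M - lam%:M) ^+ i = 0 -> y *m (M - mu%:M) ^+ j = 0 ->
    br x y *m (M - (lam + mu)%:M) ^+ (i + j) = 0.
Proof.
move=> der; apply: br_gen_eigen => lam mu x y.
exists 1, 1, 1, 1; split; [exact: commr_sym (commr1 M)|exact: commr_sym (commr1 M)|].
rewrite !scale1r !mulmx1 !subM der brDZ brDZl scalerDl opprD.
by rewrite addrACA.
Qed.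

End BracketEigenspaces.

(** The vector is taken on the moment curve [(1, m, m^2, ...)]: each [w i] is a nonzero polynomial,
    and some natural number [m] is a root of none of them. *)
Lemma avoid_hyperplanes (I : finType) (r : nat) (w : I -> 'rV[rat]_r) :
  (forall i, w i != 0) -> exists t : 'cV[int]_r, forall i,
    (w i *m map_mx intr t) 0 0 != 0.
Proof.
move=> w0; pose P := \prod_i rVpoly (w i).
have nzP : P != 0.
  apply/prodf_neq0 => i _; apply: contra (w0 i) => /eqP e.
  by rewrite -[w i]rVpolyK e linear0.
have [m] := poly_nonroot (@natr_inj rat) nzP.
rewrite /P horner_prod => /prodf_neq0 H.
exists (\col_j (m ^ j)%:Z) => i; have := H i isT.
rewrite (horner_coef_wide _ (size_poly _ _ : size (rVpoly (w i)) <= r)%N) mxE.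
congr (_ != _); apply: eq_bigr => j _; rewrite coef_rVpoly_ord !mxE.
by rewrite -[in RHS]pmulrn natrX.
Qed.

Lemma clear_denominators (I : finType) (q : I -> rat) :
  exists (N : nat) (z : I -> int), (0 < N)%N /\ forall i, N%:R * q i = (z i)%:~R.
Proof.
exists (\prod_i `|denq (q i)|)%N, (fun i => numq (q i) * (\prod_(j | j != i) `|denq (q j)|)%N%:Z).
split=> [|i]; first by apply: prodn_gt0 => i; rewrite absz_gt0 denq_neq0.
rewrite (bigD1 i) //= natrM mulrAC natr_absz gtr0_norm ?denq_gt0 //.
have -> : (denq (q i))%:~R * q i = (numq (q i))%:~R.
  by rewrite -{2}[q i]divq_num_den mulrC divfK // intr_eq0 denq_neq0.
by rewrite rmorphM.
Qed.

(* Multiplicative relations of the special shape [x y = z] among numbers that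
   are not torsion can be turned into additive relations among nonzero integers:
   no basis vector lies in the rational span of the relations. *)
Lemma integral_weights (K : fieldType) (r : nat) (s : 'I_r -> K) :
  (forall i, s i != 0) -> (forall i n, s i ^+ n.+1 != 1) ->
  exists k : 'I_r -> int, (forall i, k i != 0) /\
    forall i j l, s i * s j = s l -> k i + k j = k l.
Proof.
move=> s0 s1; pose T : finType := ('I_r * 'I_r * 'I_r)%type.
pose e (i : 'I_r) : 'rV[int]_r := delta_mx 0 i.
pose R0 (t : T) : 'rV[int]_r :=
  if s t.1.1 * s t.1.2 == s t.2 then e t.1.1 + e t.1.2 - e t.2 else 0.
pose R : 'M[rat]_(#|T|, r) := \matrix_t map_mx intr (R0 (enum_val t)).
pose phi (w : 'rV[int]_r) := \prod_j s j ^ (w 0 j).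
have phiD w w' : phi (w + w') = phi w * phi w'.
  rewrite /phi -big_split; apply: eq_bigr => j _; by rewrite mxE expfzDr.
have phi0 : phi 0 = 1 by rewrite /phi big1 // => j _; rewrite mxE expr0z.
have phie i : phi (e i) = s i.
  rewrite /phi (bigD1 i) //= mxE !eqxx expr1z big1 ?mulr1 // => j ji.
  by rewrite mxE (negPf ji) andbF expr0z.
have phiN w : phi (- w) = (phi w)^-1.
  apply: (mulfI (x := phi w)); first by apply/prodf_neq0 => j _; rewrite expfz_neq0.
  rewrite -phiD subrr phi0 divff //; by apply/prodf_neq0 => j _; rewrite expfz_neq0.
have phiZ z w : phi (z *: w) = phi w ^ z.
  have Hn (n : nat) : phi (n%:Z *: w) = phi w ^+ n.
    elim: n => [|n IH]; first by rewrite scale0r phi0.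
    by rewrite intS scalerDl scale1r phiD IH exprS.
  by case: z => n; rewrite ?Hn // NegzE scaleNr phiN Hn.
have phiR t : phi (R0 t) = 1.
  rewrite /R0; case: eqP => // e1.
  by rewrite !phiD phiN !phie e1 divff.
(* If the [i]-th basis vector were a rational combination of relations, clearing denominators and
   applying the character [phi], trivial on relations, would give [s i ^+ N = 1]. *)
have nzrow i : row i (cokermx R) != 0.
  apply/negP => /eqP H0.
  have /submxP[u Hu] : (map_mx intr (e i) <= R)%MS.
    by rewrite submxE /e map_delta_mx -rowE H0.
  have [N [z [N0 Hz]]] := clear_denominators (fun t => u 0 t).
  have E : N%:Z *: e i = \sum_t z t *: R0 (enum_val t).
    apply/rowP=> j; apply: (intr_inj (R := rat)).
    have := congr1 (fun w : 'rV[rat]_r => N%:R * w 0 j) Hu.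
    rewrite !mxE rmorphM /= => ->; rewrite summxE rmorph_sum mulr_sumr.
    by apply: eq_bigr => t _; rewrite !mxE rmorphM /= mulrA Hz.
  have := congr1 phi E; rewrite phiZ phie (big_morph phi phiD phi0) big1 => [/eqP|t _].
    by case: N N0 {Hz E} => // n _; apply/negP; apply: s1.
  by rewrite phiZ phiR exp1rz.
have [t Ht] := avoid_hyperplanes nzrow.
(* The columns of the cokernel are additive solutions of all relations; [t] combines them into a
   solution without zero coordinate. *)
pose v := cokermx R *m map_mx intr t.
have [N [k [N0 Hk]]] := clear_denominators (fun i => v i 0).
exists k; split=> [i|i j l e1].
  rewrite -(intr_eq0 rat) -Hk mulf_neq0 ?pnatr_eq0 -?lt0n //.
  by have := Ht i; rewrite -row_mul mxE.
apply/eqP; rewrite -subr_eq0 -(intr_eq0 rat) rmorphB rmorphD /= -!Hk -mulrDr -mulrBr.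
have := mulmx_coker R; move/(congr1 (fun A => row (enum_rank (i, j, l)) A *m map_mx intr t)).
rewrite row_mul rowK enum_rankK /R0 /= e1 eqxx row0 mul0mx -mulmxA -/v.
rewrite !map_mxB map_mxD !mulmxBl mulmxDl /e !map_delta_mx -!rowE.
by move=> /(congr1 (fun A : 'M_1 => A 0 0)); rewrite !mxE => ->; rewrite mulr0.
Qed.

Lemma very_special_grading0 (F : fieldType) (c : 'I_0 -> 'I_0 -> 'rV[F]_0) :
  very_special_grading c.
Proof.
exists [::], (fun=> 0); split=> //; split=> //; split; last split; last split=> //.
- by rewrite mxdirectE /= !big_nil mxrank0.
- by rewrite big_nil; apply/eqmxP; rewrite !flatmx0 submx_refl.
by move=> k l x y _ _; rewrite [lie_br _ _ _]thinmx0 sub0mx.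
Qed.

Section GradingFromAutomorphism.
Variables (K : fieldType) (d' : nat).
Local Notation d := d'.+1.
Variables (c : 'I_d -> 'I_d -> 'rV[K]_d) (F : 'M[K]_d) (s : seq K) (N : nat).
Local Notation br := (lie_br c).
Hypothesis aut : forall x y, br x y *m F = br (x *m F) (y *m F).
Hypotheses (uniq_s : uniq s)
  (ann : horner_mx F (\prod_(lam <- s) ('X - lam%:P) ^+ N) = 0)
  (s0 : forall lam, lam \in s -> lam != 0)
  (s1 : forall lam n, lam \in s -> lam ^+ n.+1 != 1).

Lemma grading_of_automorphism : very_special_grading c.
Proof.
have [pi [pi1 pi0 piM piP]] := spectral_projections uniq_s ann.
have [kap [kap0 kapM]] : exists kap : K -> int, (forall lam, lam \in s -> kap lam != 0) /\
    forall lam mu, lam \in s -> mu \in s -> lam * mu \in s -> kap (lam * mu) = kap lam + kap mu.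
  have [||k [k0 kM]] := @integral_weights K (size s) (fun i => s`_i).
  - by move=> i; apply: s0; apply: mem_nth.
  - by move=> i n; apply: s1; apply: mem_nth.
  exists (fun lam => if insub (index lam s) is Some i then k i else 0); split.
    by move=> lam ls; rewrite -index_mem in ls; rewrite insubT.
  move=> lam mu ls ms lms; have := ls; have := ms; have := lms; rewrite -!index_mem => h1 h2 h3.
  rewrite !insubT /=; symmetry; apply: kM; by rewrite /= !nth_index.
pose V (k : int) := \sum_(lam <- s | kap lam == k) pi lam.
have VE k lam : lam \in s -> pi lam * V k = if kap lam == k then pi lam else 0.
  move=> ls; rewrite /V mulr_sumr big_mkcond (big_rem lam) //= (pi_idem uniq_s pi1 pi0) //.
  rewrite big_seq big1 ?addr0 // => mu; rewrite mem_rem_uniq // !inE => /andP[ne ms].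
  by rewrite pi0 ?if_same // eq_sym.
have VV k l : V k * V l = if k == l then V k else 0.
  rewrite {1}/V mulr_suml; case: eqP => [<-|ne].
    by rewrite big_seq_cond [RHS]big_seq_cond; apply: eq_bigr => lam /andP[ls e]; rewrite VE ?e.
  rewrite big_seq_cond big1 // => lam /andP[ls /eqP e]; rewrite VE // e.
  by case: eqP.
exists (undup (map kap s)), V; split; [exact: undup_uniq|split; [|split; [|split; [|split]]]].
- move=> k; rewrite mem_undup => nk; rewrite /V big_seq_cond big1 // => lam /andP[ls /eqP e].
  by case/negP: nk; rewrite -e map_f.
- rewrite mxdirectE /=; apply/eqP; elim: (undup _) (undup_uniq (map kap s)) => [|k r IH].
    by rewrite !big_nil mxrank0.
  rewrite cons_uniq !big_cons => /andP[kr ur]; rewrite mxrank_disjoint_sum ?IH //.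
  apply/eqP/rowV0P => v; rewrite sub_capmx => /andP[/submxP[u ->] /submxP[w e]].
  have : u *m V k *m V k = 0.
    rewrite e -mulmxA; suff -> : ((\sum_(l <- r) V l)%MS *m V k = 0) by rewrite mulmx0.
    apply/sub_kermxP; rewrite big_seq; apply: (big_ind (fun A => (A <= kermx (V k))%MS)).
    - exact: sub0mx.
    - by move=> A B HA HB; rewrite addsmx_sub HA.
    move=> l lr; apply/sub_kermxP; rewrite [_ *m _]VV; case: eqP => // el.
    by rewrite -el lr in kr.
  by rewrite -mulmxA [X in _ *m X]VV eqxx.
- apply/eqmxP; rewrite submx1 -[1%:M]pi1 /=.
  rewrite big_seq; apply: (big_ind (fun A => (A <= \sum_(k <- undup (map kap s)) V k)%MS)).
  + exact: sub0mx.
  + by move=> A B; apply: addmx_sub.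
  move=> lam ls; have kin : kap lam \in undup (map kap s) by rewrite mem_undup map_f.
  rewrite (big_rem _ kin) /=; apply: submx_trans (addsmxSl _ _).
  have := VE (kap lam) lam ls; rewrite eqxx => <-; exact: submxMl.
- move=> k l x y /submxP[u ->] /submxP[w ->].
  have suml (r : seq K) (P : pred K) (f : K -> 'rV_d) z :
      br (\sum_(lam <- r | P lam) f lam) z = \sum_(lam <- r | P lam) br (f lam) z.
    apply: (big_morph (br^~ z)) => [a b|].
      by have := lie_br_linl c z 1 a b; rewrite !scale1r.
    by have := lie_br_linl c z (-1) 0 0; rewrite scaler0 addr0 scaleN1r addNr.
  have sumr (r : seq K) (P : pred K) (f : K -> 'rV_d) z :
      br z (\sum_(lam <- r | P lam) f lam) = \sum_(lam <- r | P lam) br z (f lam).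
    apply: (big_morph (br z)) => [a b|].
      by have := lie_br_linr c z 1 a b; rewrite !scale1r.
    by have := lie_br_linr c z (-1) 0 0; rewrite scaler0 addr0 scaleN1r addNr.
  rewrite /V !mulmx_sumr suml big_seq_cond; apply: summx_sub => lam /andP[ls /eqP el].
  rewrite sumr big_seq_cond; apply: summx_sub => mu /andP[ms /eqP em].
  have Hx : u *m pi lam *m (F - lam%:M) ^+ N = 0.
    by rewrite -mulmxA [X in _ *m X](piM _ ls) mulmx0.
  have Hy : w *m pi mu *m (F - mu%:M) ^+ N = 0.
    by rewrite -mulmxA [X in _ *m X](piM _ ms) mulmx0.
  have Hxy := br_aut_eigen aut Hx Hy.
  case lms: (lam * mu \in s); last first.
    by rewrite (pi_notin pi1 piM piP (negbT lms) Hxy) sub0mx.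
  rewrite -(pi_fix uniq_s pi1 piM piP lms Hxy).
  have := VE (kap (lam * mu)) _ lms; rewrite eqxx => <-.
  by rewrite kapM // el em mulmxA submxMl.
rewrite /V big_seq_cond big1 // => lam /andP[ls /eqP e].
by have := kap0 lam ls; rewrite e eqxx.
Qed.

End GradingFromAutomorphism.

(** * Brackets under extension of scalars *)

Section BilinearBracket.
Variables (K : fieldType) (d : nat) (c : 'I_d -> 'I_d -> 'rV[K]_d).
Local Notation br := (lie_br c).

Lemma lie_br_delta i j : br (delta_mx 0 i) (delta_mx 0 j) = c i j.
Proof.
rewrite /lie_br (bigD1 i) //= (bigD1 j) //= !mxE !eqxx mulr1 scale1r.
rewrite big1 ?addr0 => [|k kj]; last by rewrite !mxE (negPf kj) andbF mulr0 scale0r.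
rewrite big1 ?addr0 // => k ki; rewrite big1 // => l _.
by rewrite !mxE (negPf ki) andbF mul0r scale0r.
Qed.

End BilinearBracket.

Section BilinearBracketSum.
Variables (K : fieldType) (d' : nat).
Local Notation d := d'.+1.
Variable c : 'I_d -> 'I_d -> 'rV[K]_d.
Local Notation br := (lie_br c).

Lemma lie_br_suml (I : Type) (r : seq I) (a : I -> K) (u : I -> 'rV[K]_d) y :
  br (\sum_(i <- r) a i *: u i) y = \sum_(i <- r) a i *: br (u i) y.
Proof.
elim: r => [|i r IH].
  by rewrite !big_nil; have := lie_br_linl c y (-1) 0 0; rewrite scaler0 addr0 scaleN1r addNr.
by rewrite !big_cons lie_br_linl IH.
Qed.

Lemma lie_br_sumr (I : Type) (r : seq I) (a : I -> K) (u : I -> 'rV[K]_d) y :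
  br y (\sum_(i <- r) a i *: u i) = \sum_(i <- r) a i *: br y (u i).
Proof.
elim: r => [|i r IH].
  by rewrite !big_nil; have := lie_br_linr c y (-1) 0 0; rewrite scaler0 addr0 scaleN1r addNr.
by rewrite !big_cons lie_br_linr IH.
Qed.

(** Identities over the larger field are reduced to basis vectors, which are rational, so that
    automorphisms and derivations survive base change. *)
Lemma lie_br_bilinear (b : 'rV[K]_d -> 'rV[K]_d -> 'rV[K]_d) :
  (forall y, linear (b^~ y)) -> (forall x, linear (b x)) ->
  (forall i j, b (delta_mx 0 i) (delta_mx 0 j) = c i j) ->
  forall x y, br x y = b x y.
Proof.
move=> bl br' e x y; have sl (r : seq 'I_d) z (a : 'I_d -> K) u :
    b (\sum_(i <- r) a i *: u i) z = \sum_(i <- r) a i *: b (u i) z.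
  elim: r => [|i r IH]; last by rewrite !big_cons (bl z) IH.
  by rewrite !big_nil; have := bl z (-1) 0 0; rewrite scaler0 addr0 scaleN1r addNr.
have sr (r : seq 'I_d) z (a : 'I_d -> K) u :
    b z (\sum_(i <- r) a i *: u i) = \sum_(i <- r) a i *: b z (u i).
  elim: r => [|i r IH]; last by rewrite !big_cons (br' z) IH.
  by rewrite !big_nil; have := br' z (-1) 0 0; rewrite scaler0 addr0 scaleN1r addNr.
rewrite {2}[x]row_sum_delta {2}[y]row_sum_delta sl; apply: eq_bigr => i _.
by rewrite sr scaler_sumr; apply: eq_bigr => j _; rewrite e scalerA.
Qed.

End BilinearBracketSum.

Section BaseChange.
Variables (K : fieldType) (phi : {rmorphism rat -> K}) (d' : nat).
Local Notation d := d'.+1.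
Variable c : 'I_d -> 'I_d -> 'rV[rat]_d.
Local Notation br := (lie_br c).
Let cK i j := map_mx phi (c i j).
Local Notation brK := (lie_br cK).

Lemma map_lie_br x y : map_mx phi (br x y) = brK (map_mx phi x) (map_mx phi y).
Proof.
rewrite /lie_br raddf_sum; apply: eq_bigr => i _; rewrite raddf_sum; apply: eq_bigr => j _.
by rewrite /= map_mxZ rmorphM !mxE.
Qed.

Lemma base_change_aut F : (forall x y, br x y *m F = br (x *m F) (y *m F)) ->
  forall x y, brK x y *m map_mx phi F = brK (x *m map_mx phi F) (y *m map_mx phi F).
Proof.
move=> aut x y; set FK := map_mx phi F.
have inv := fun cc => @lie_br_bilinear K d' cc (fun x y => brK (x *m FK) (y *m FK)).
rewrite -(inv (fun i j => cK i j *m FK)).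
- rewrite /lie_br mulmx_suml; apply: eq_bigr => i _; rewrite mulmx_suml.
  by apply: eq_bigr => j _; rewrite scalemxAl.
- by move=> z a u v; rewrite mulmxDl -scalemxAl lie_br_linl.
- by move=> z a u v; rewrite mulmxDl -scalemxAl lie_br_linr.
move=> i j; rewrite -!(map_delta_mx phi) -!map_mxM -map_lie_br -aut map_mxM.
by rewrite lie_br_delta map_mxM.
Qed.

Lemma base_change_der F : (forall x y, br x y *m F = br (x *m F) y + br x (y *m F)) ->
  forall x y, brK x y *m map_mx phi F = brK (x *m map_mx phi F) y + brK x (y *m map_mx phi F).
Proof.
move=> der x y; set FK := map_mx phi F.
have inv := fun cc => @lie_br_bilinear K d' cc (fun x y => brK (x *m FK) y + brK x (y *m FK)).
rewrite -(inv (fun i j => cK i j *m FK)).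
- rewrite /lie_br mulmx_suml; apply: eq_bigr => i _; rewrite mulmx_suml.
  by apply: eq_bigr => j _; rewrite scalemxAl.
- by move=> z a u v; rewrite mulmxDl -scalemxAl !lie_br_linl scalerDr addrACA.
- by move=> z a u v; rewrite mulmxDl -scalemxAl !lie_br_linr scalerDr addrACA.
move=> i j; rewrite -!(map_delta_mx phi) -!map_mxM -!map_lie_br -raddfD -der lie_br_delta /=.
by rewrite map_mxM.
Qed.

End BaseChange.

Lemma prod_roots_dvd (K : fieldType) (r t : seq K) N : {subset r <= t} ->
  (size r <= N)%N -> \prod_(z <- r) ('X - z%:P) %| \prod_(z <- t) ('X - z%:P) ^+ N.
Proof.
elim: r N => [|z r IH] N; first by rewrite big_nil dvd1p.
case: N => // N sub; rewrite ltnS => szN; rewrite big_cons.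
have -> : \prod_(z <- t) ('X - z%:P) ^+ N.+1 =
   \prod_(z <- t) ('X - z%:P) * \prod_(z <- t) ('X - z%:P) ^+ N.
  by rewrite -big_split; apply: eq_bigr => u _; rewrite exprS.
apply: dvdp_mul; last by apply: IH => // u ur; apply: sub; rewrite inE ur orbT.
by rewrite (big_rem z) ?dvdp_mulr //; apply: sub; rewrite mem_head.
Qed.

Lemma annihilator_of_roots (K : fieldType) (d' : nat) (F : 'M[K]_d'.+1) (r : seq K) :
  char_poly F = \prod_(z <- r) ('X - z%:P) ->
  horner_mx F (\prod_(z <- undup r) ('X - z%:P) ^+ size r) = 0.
Proof.
move=> e; have : char_poly F %| \prod_(z <- undup r) ('X - z%:P) ^+ size r.
  by rewrite e; apply: prod_roots_dvd => // z; rewrite mem_undup.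
by move=> /dvdpP[g ->]; rewrite rmorphM /= Cayley_Hamilton mulr0.
Qed.

Theorem grading_of_selfsimilar (G : Grp) (d : nat) (c : 'I_d -> 'I_d -> 'rV[rat]_d)
    (iota : G -> 'rV[rat]_d) :
  is_malcev_lie_algebra c iota -> freely_self_similar G ->
  very_special_grading (complexify c).
Proof.
move=> malcev [A [A0 [act [actP [ss free]]]]].
have [a _] : exists a : A, a \in A by apply/card_gt0P.
(* Square matrices form a ring only in positive size, so dimension 0 is settled separately. *)
case: d c iota malcev => [|d'] c iota malcev; first exact: very_special_grading0.
have [F [uF aut detF]] := selfsimilar_automorphism malcev a actP ss free.
pose phi : {rmorphism rat -> Cplx} := (ratr : rat -> Rdefinitions.R[i]).
pose FC := map_mx phi F.
have autC := base_change_aut phi aut; rewrite -/FC in autC.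
have [r e] := closed_field_poly_normal (char_poly FC : {poly Rdefinitions.R[i]}).
have {}e : char_poly FC = \prod_(z <- r) ('X - z%:P).
  by rewrite [LHS]e (monicP (char_poly_monic FC)) scale1r.
have eig lam : lam \in undup r -> exists2 v : 'rV_d'.+1, v *m FC = lam *: v & v != 0.
  rewrite mem_undup => lr; apply/eigenvalueP; rewrite eigenvalue_root_char e.
  by rewrite root_prod_XsubC.
apply: (grading_of_automorphism autC (undup_uniq r) (annihilator_of_roots e)).
- move=> lam /eig[v ev]; apply: contraNneq => l0.
  have uFC : FC \in unitmx by rewrite map_unitmx.
  by rewrite -[v](mulmxK uFC) ev l0 scale0r mul0mx.
move=> lam k /eig[v ev v0]; apply/negP => /eqP lk.
have vk j : v *m FC ^+ j = lam ^+ j *: v.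
  elim: j => [|j IH]; first by rewrite !expr0 mulmx1 scale1r.
  by rewrite exprSr mulmxA IH -scalemxAl ev scalerA -exprSr.
have : \det (FC ^+ k.+1 - 1) != 0.
  rewrite /FC -rmorphXn -(rmorph1 (map_mx phi : 'M_d'.+1 -> 'M_d'.+1)) -rmorphB.
  by rewrite det_map_mx fmorph_eq0 detF.
move/det0P; apply; exists v => //.
by rewrite mulmxBr mulmx1 vk lk scale1r subrr.
Qed.

(** * Rational invertible derivations *)

Section DerivationOfGrading.
Variables (K : fieldType) (d' : nat).
Local Notation d := d'.+1.
Variable c : 'I_d -> 'I_d -> 'rV[K]_d.
Local Notation br := (lie_br c).
Hypothesis natK : injective (fun n : nat => n%:R : K).

Lemma intr_neq0 (z : int) : z != 0 -> z%:~R != 0 :> K.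
Proof.
have n0 (n : nat) : n != 0%N -> n%:R != 0 :> K.
  by move=> nz; apply/negP=> /eqP e; case/eqP: nz; apply: natK; rewrite e.
by case: z => n nz; rewrite ?NegzE ?mulrNz ?oppr_eq0 -pmulrn n0.
Qed.

Lemma sub_sumseqmx m (r : seq int) (V : int -> 'M[K]_d) (A : 'M[K]_(m, d)) : uniq r ->
  (A <= \sum_(k <- r) V k)%MS -> exists W : int -> 'M[K]_(m, d), A = \sum_(k <- r) W k *m V k.
Proof.
elim: r m A => [|k r IH] m A; first by rewrite !big_nil submx0 => _ /eqP ->; exists (fun=> 0);
  rewrite big_nil.
rewrite cons_uniq !big_cons => /andP[kr ur] /sub_addsmxP[[u v] /= eA].
have [|W eW] := IH m (v *m (\sum_(k <- r) V k)%MS) ur; first exact: submxMl.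
exists (fun l => if l == k then u else W l); rewrite big_cons eqxx eA eW; congr (_ + _).
rewrite big_seq [RHS]big_seq; apply: eq_bigr => l lr.
by case: eqP => // el; rewrite -el lr in kr.
Qed.

Lemma direct_independent (r : seq int) (V : int -> 'M[K]_d) :
  (\sum_(k <- r) \rank (V k) <= \rank (\sum_(k <- r) V k)%MS)%N ->
  forall v : int -> 'rV[K]_d, (forall k, k \in r -> (v k <= V k)%MS) ->
    \sum_(k <- r) v k = 0 -> forall k, k \in r -> v k = 0.
Proof.
elim: r => [//|k r IH]; rewrite !big_cons => rk v Hv.
have le1 : (\rank (\sum_(k <- r) V k)%MS <= \sum_(k <- r) \rank (V k))%N.
  elim: (r) => [|l t IHt]; first by rewrite !big_nil mxrank0.
  rewrite !big_cons; apply: leq_trans (mxrank_adds_leqif _ _) _.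
  by rewrite leq_add2l.
have := mxrank_sum_cap (V k) (\sum_(k <- r) V k)%MS.
move=> cap; have c0 : \rank (V k :&: \sum_(k <- r) V k)%MS = 0%N.
  move: cap rk le1; set s1 := \rank (_ + _)%MS; set s2 := \rank (_ :&: _)%MS.
  by set s3 := \rank (V k); set s4 := \rank (\sum_(_ <- _) _)%MS; set s5 := \sum_(_ <- _) _; lia.
have rk' : (\sum_(k <- r) \rank (V k) <= \rank (\sum_(k <- r) V k)%MS)%N.
  have := leq_trans rk (mxrank_adds_leqif _ _); by rewrite leq_add2l.
rewrite big_cons => /eqP; rewrite addr_eq0 => /eqP e.
have vk : v k = 0.
  apply/eqP; rewrite -submx0; move/eqP: c0; rewrite mxrank_eq0 => /eqP <-.
  rewrite sub_capmx Hv ?mem_head //= e eqmx_opp big_seq; apply: summx_sub => l lr.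
  rewrite (big_rem l) //=; apply: submx_trans (addsmxSl _ _); apply: Hv.
  by rewrite inE lr orbT.
move=> l; rewrite inE => /orP[/eqP -> //|lr]; apply: (IH rk') => //.
  by move=> l' l'r; apply: Hv; rewrite inE l'r orbT.
by apply/eqP; rewrite -oppr_eq0 -e vk.
Qed.

Lemma derivation_of_grading : very_special_grading c -> exists D : 'M[K]_d,
  (forall x y, br x y *m D = br (x *m D) y + br x (y *m D)) /\ \det D != 0.
Proof.
move=> [ks [V [uks [Vout [dx [full [Vbr V0]]]]]]].
have indep := direct_independent (eq_leq (esym (eqP dx))).
have [|W eW] := @sub_sumseqmx _ ks V 1%:M uks; first by rewrite full submx_refl.
(* [V k] is merely some matrix whose rows span the [k]-th piece. Writing the identity as a sum of
   products [W k *m V k] yields the actual projections. *)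
pose P k := W k *m V k.
have PV m (x : 'M_(m, d)) k : (x *m P k <= V k)%MS by rewrite mulmxA submxMl.
have xP (x : 'rV_d) : x = \sum_(k <- ks) x *m P k by rewrite -mulmx_sumr -eW mulmx1.
have Pfix (x : 'rV_d) k l : (x <= V k)%MS -> k \in ks -> l \in ks ->
    x *m P l = if l == k then x else 0.
  move=> xV kks lks; apply/eqP; rewrite -subr_eq0; apply/eqP.
  apply: (indep (fun l => x *m P l - (if l == k then x else 0)) _ _ l lks).
    move=> j jks; apply: addmx_sub; first exact: PV.
    by rewrite eqmx_opp; case: eqP => [->|] //; rewrite sub0mx.
  rewrite big_split /= -xP (big_rem k) //= eqxx big_seq big1 ?addr0 ?subrr // => j.
  by rewrite mem_rem_uniq // !inE => /andP[/negPf -> _]; rewrite oppr0.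
pose D := \sum_(k <- ks) (k%:~R : K) *: P k.
have DV (x : 'rV_d) k : k \in ks -> (x <= V k)%MS -> x *m D = k%:~R *: x.
  move=> kks xV; rewrite mulmx_sumr (big_rem k) //= -scalemxAr (Pfix x k k) // eqxx.
  rewrite big_seq big1 ?addr0 // => j; rewrite mem_rem_uniq // !inE => /andP[/negPf ne jks].
  by rewrite -scalemxAr (Pfix x k j) // ne scaler0.
have DV' (x : 'rV_d) k : (x <= V k)%MS -> x *m D = k%:~R *: x.
  case kks: (k \in ks); first exact: DV.
  by rewrite Vout ?kks // submx0 => /eqP ->; rewrite mul0mx scaler0.
exists D; split.
  move=> x y; have key k l : br (x *m P k) (y *m P l) *m D =
      br (x *m P k *m D) (y *m P l) + br (x *m P k) (y *m P l *m D).
    rewrite (DV' _ (k + l)) ?Vbr // (DV' _ k) // (DV' _ l) //.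
    have Zl a u v : br (a *: u) v = a *: br u v.
      by have := lie_br_suml c [:: tt] (fun=> a) (fun=> u) v; rewrite !big_seq1.
    have Zr a u v : br u (a *: v) = a *: br u v.
      by have := lie_br_sumr c [:: tt] (fun=> a) (fun=> v) u; rewrite !big_seq1.
    by rewrite Zl Zr rmorphD scalerDl.
  have sl (u : int -> 'rV_d) v : br (\sum_(k <- ks) u k) v = \sum_(k <- ks) br (u k) v.
    have := lie_br_suml c ks (fun=> 1) u v; rewrite (eq_bigr u) => [->|k _];
      last by rewrite scale1r.
    by apply: eq_bigr => k _; rewrite scale1r.
  have sr (u : int -> 'rV_d) v : br v (\sum_(k <- ks) u k) = \sum_(k <- ks) br v (u k).
    have := lie_br_sumr c ks (fun=> 1) u v; rewrite (eq_bigr u) => [->|k _];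
      last by rewrite scale1r.
    by apply: eq_bigr => k _; rewrite scale1r.
  have sD (u : int -> 'rV_d) : (\sum_(k <- ks) u k) *m D = \sum_(k <- ks) u k *m D by rewrite
    mulmx_suml.
  rewrite {1 2 3}(xP x) {1 2 3}(xP y) !sD !sl sD -big_split /=.
  apply: eq_bigr => k _ /=; rewrite !sr sD -big_split.
  by apply: eq_bigr => l _ /=; rewrite key.
apply/negP => /det0P[v v0 vD].
have Pk k : k \in ks -> k%:~R *: (v *m P k) = 0.
  move=> kks; apply: (indep (fun k => k%:~R *: (v *m P k)) _ _ k kks).
    by move=> j _; apply: scalemx_sub.
  by rewrite -[RHS]vD mulmx_sumr; apply: eq_bigr => j _; rewrite scalemxAr.
case/negP: v0; apply/eqP; rewrite (xP v) big_seq big1 // => k kks.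
case: (eqVneq k 0) => [->|k0]; first by rewrite /P V0 !mulmx0.
have /eqP := Pk k kks; rewrite scaler_eq0 => /orP[|/eqP //].
by rewrite (negPf (intr_neq0 k0)).
Qed.

End DerivationOfGrading.

Section RationalDerivation.
Variables (K : fieldType) (phi : {rmorphism rat -> K}) (d' : nat).
Local Notation d := d'.+1.
Variable c : 'I_d -> 'I_d -> 'rV[rat]_d.
Hypothesis natK : injective (fun n : nat => n%:R : K).
Let cK i j := map_mx phi (c i j).

Definition is_der (F : fieldType) (cF : 'I_d -> 'I_d -> 'rV[F]_d) (D : 'M[F]_d) :=
  forall x y, lie_br cF x y *m D = lie_br cF (x *m D) y + lie_br cF x (y *m D).

(** The coefficients [u i] are traded for natural numbers one at a time: the determinant is a
    polynomial in the coefficient at hand, nonzero because of its value at [u i], hence nonzero at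
    some natural number. *)
Lemma generic_det (I : Type) (Q : 'M[rat]_d -> Prop) (r : seq I) (u : I -> K)
    (E : I -> 'M[rat]_d) (B : 'M[rat]_d) :
  (forall (n : nat) A A', Q A -> Q A' -> Q (n%:R *: A + A')) ->
  Q B -> (forall i, Q (E i)) ->
  \det (map_mx phi B + \sum_(i <- r) u i *: map_mx phi (E i)) != 0 ->
  exists A, Q A /\ \det A != 0.
Proof.
move=> QD QB QE; elim: r B QB => [|i r IH] B QB.
  by rewrite big_nil addr0 det_map_mx fmorph_eq0; exists B.
rewrite big_cons; set R := \sum_(_ <- _) _ => H.
pose P : {poly K} := \det (map_mx polyC (map_mx phi B + R) + 'X *: map_mx polyC (map_mx phi (E i))).
have PE z : P.[z] = \det (map_mx phi B + (z *: map_mx phi (E i) + R)).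
  rewrite -/(horner_eval z P) -det_map_mx; congr (\det _); apply/matrixP=> a b.
  rewrite !mxE /= /horner_eval !(hornerD, hornerM, hornerC, hornerX).
  by rewrite -addrA [R _ _ + _]addrC.
have nzP : P != 0.
  by apply: contraNneq H => P0; rewrite -PE P0 horner0.
have [n] := poly_nonroot natK nzP; rewrite PE => Hn.
apply: (IH (n%:R *: E i + B)); first exact: QD.
by rewrite map_mxD map_mxZ rmorph_nat -addrA addrCA.
Qed.

Lemma rational_derivation (DK : 'M[K]_d) : is_der cK DK -> \det DK != 0 ->
  exists D : 'M[rat]_d, is_der c D /\ \det D != 0.
Proof.
move=> derK detK; pose T : finType := ('I_d * 'I_d * 'I_d)%type.
pose defect (F : fieldType) (cF : 'I_d -> 'I_d -> 'rV[F]_d) (D : 'M[F]_d) : 'rV[F]_#|T| :=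
  \row_t (let: (i, j, k) := enum_val t in
    (cF i j *m D - lie_br cF (row i D) (delta_mx 0 j) - lie_br cF (delta_mx 0 i) (row j D)) 0 k).
have defect_lin F cF : linear (@defect F cF).
  move=> a D D'; apply/rowP=> t; rewrite !mxE; case: (enum_val t) => [[i j] k].
  have rowl l : row l (a *: D + D') = a *: row l D + row l D' by rewrite linearP.
  by rewrite !rowl (lie_br_linl cF) (lie_br_linr cF) mulmxDr -scalemxAr !mxE; ring.
have defect_der F cF D : reflect (is_der cF D) (@defect F cF D == 0).
  apply: (iffP eqP) => [e x y|der].
    have /(_ _ _ _) inv := @lie_br_bilinear F d' (fun i j => cF i j *m D)
      (fun x y => lie_br cF (x *m D) y + lie_br cF x (y *m D)).
    rewrite -inv.
    - rewrite /lie_br mulmx_suml; apply: eq_bigr => i _; rewrite mulmx_suml.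
      by apply: eq_bigr => j _; rewrite scalemxAl.
    - by move=> z a u v; rewrite mulmxDl -scalemxAl !lie_br_linl scalerDr addrACA.
    - by move=> z a u v; rewrite mulmxDl -scalemxAl !lie_br_linr scalerDr addrACA.
    move=> i j; rewrite -!rowE; apply/rowP=> k.
    have := congr1 (fun v : 'rV_#|T| => v 0 (enum_rank (i, j, k))) e.
    rewrite !mxE enum_rankK !mxE => /eqP; rewrite -addrA -opprD subr_eq0 => /eqP ->.
    by [].
  apply/rowP=> t; rewrite !mxE; case: (enum_val t) => [[i j] k].
  by rewrite -lie_br_delta der -!rowE !mxE -addrA -opprD subrr.
pose A F cF := \matrix_(p < d * d) @defect F cF (vec_mx (delta_mx 0 p)).
have AE F cF D : mxvec D *m A F cF = @defect F cF D.
  rewrite [mxvec D]row_sum_delta mulmx_suml -{2}[D]mxvecK.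
  have hom : forall (r : seq 'I_(d * d)) (a : 'I_(d * d) -> F),
      @defect F cF (vec_mx (\sum_(p <- r) a p *: delta_mx 0 p)) =
      \sum_(p <- r) a p *: @defect F cF (vec_mx (delta_mx 0 p)).
    move=> r a; elim: r => [|p r IH].
      rewrite !big_nil linear0; have := defect_lin F cF (-1) 0 0.
      by rewrite scaler0 addr0 scaleN1r addNr.
    by rewrite !big_cons linearP defect_lin IH.
  rewrite {2}[mxvec D]row_sum_delta hom; apply: eq_bigr => p _.
  by rewrite -scalemxAl -rowE rowK.
have AK : A K cK = map_mx phi (A rat c).
  apply/row_matrixP=> p; rewrite rowK -map_row rowK; apply/rowP=> t; rewrite !mxE.
  case: (enum_val t) => [[i j] k].
  rewrite -(map_delta_mx phi) -map_vec_mx -!map_row -!(map_delta_mx phi) -!map_lie_br.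
  by rewrite -map_mxM -!map_mxB mxE.
have : (mxvec DK <= kermx (A K cK))%MS.
  by apply/sub_kermxP; rewrite AE; apply/eqP/defect_der.
(* The kernel of a rational matrix is spanned by rational vectors over any extension, so [DK] is a
   combination of rational derivations with coefficients in [K]. *)
rewrite AK -map_kermx => /submxP[u eu].
pose E p := vec_mx (row p (kermx (A rat c))).
have Eder p : is_der c (E p).
  apply/defect_der; rewrite -AE vec_mxK; apply/eqP/sub_kermxP; exact: row_sub.
have EK : DK = \sum_p u 0 p *: map_mx phi (E p).
  rewrite -[DK]mxvecK eu -[in LHS](mulmx1 u) {1}[u]row_sum_delta mulmx1 mulmx_suml linear_sum.
  apply: eq_bigr => p _; rewrite -scalemxAl linearZ /= -rowE -map_row map_vec_mx //.
apply: (@generic_det _ (is_der c) (index_enum _) (fun p => u 0 p) E 0).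
- move=> n D D' dD dD' x y; rewrite !mulmxDr -!scalemxAr dD dD' lie_br_linl lie_br_linr.
  by rewrite scalerDr addrACA.
- move=> x y; rewrite !mulmx0; have := lie_br_linl c y (-1) 0 0.
  have := lie_br_linr c x (-1) 0 0; rewrite !scaler0 !addr0 !scaleN1r !addNr => -> ->.
  by rewrite addr0.
- exact: Eder.
by rewrite map_mx0 add0r -EK.
Qed.

End RationalDerivation.

(** * Galois equivariant characters *)

Section GaloisIntegers.
Variables (L : fieldType) (phi : {rmorphism rat -> L}) (gT : finGroupType).
Variable s : gT -> {rmorphism L -> L}.
(** Composition follows the convention of a right action, which is the one of the Galois groups
    substituted later. *)
Hypothesis sM : forall g h z, s (g * h)%g z = s h (s g z).
Hypothesis s1 : forall z, s 1%g z = z.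
Hypothesis fixed_rat : forall z, (forall g, s g z = z) -> exists q, z = phi q.
Hypothesis alg_rat : forall z, algebraicOver phi z.

Definition algint (z : L) := integralOver (intr : int -> L) z.

Lemma algintD u v : algint u -> algint v -> algint (u + v).
Proof. exact: integral_add. Qed.
Lemma algintM u v : algint u -> algint v -> algint (u * v).
Proof. exact: integral_mul. Qed.
Lemma algintN u : algint u -> algint (- u).
Proof. exact: integral_opp. Qed.
Lemma algintB u v : algint u -> algint v -> algint (u - v).
Proof. exact: integral_sub. Qed.
Lemma algint_int (m : int) : algint m%:~R.
Proof. exact: (integral_id (intr : int -> L)). Qed.
Lemma algint_nat n : algint n%:R.
Proof. exact: (integral_nat (intr : int -> L)). Qed.
Lemma algint1 : algint 1.
Proof. exact: (algint_nat 1). Qed.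
Lemma algintX u n : algint u -> algint (u ^+ n).
Proof.
by move=> Ou; elim: n => [|n IH]; [apply: algint1 | rewrite exprS; apply: algintM].
Qed.
Lemma algint_prod (I : Type) (r : seq I) (P : pred I) (F : I -> L) :
  (forall i, P i -> algint (F i)) -> algint (\prod_(i <- r | P i) F i).
Proof.
by move=> H; elim/big_rec: _ => [|i u Pi Ou]; [apply: algint1 | apply: algintM; auto].
Qed.
Lemma algint_gal g u : algint u -> algint (s g u).
Proof.
case=> p mp /(rmorph_root (s g)); rewrite -map_poly_comp => pu; exists p => //.
by rewrite (eq_map_poly (g := s g \o intr)) // => z /=; rewrite rmorph_int.
Qed.

Lemma sV g z : s g^-1%g (s g z) = z.
Proof. by rewrite -sM mulgV s1. Qed.
Lemma sVK g z : s g (s g^-1%g z) = z.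
Proof. by rewrite -sM mulVg s1. Qed.

Lemma natL : injective (fun n : nat => n%:R : L).
Proof.
move=> i j /= e; apply: (@natr_inj rat); apply: (fmorph_inj phi).
by rewrite !rmorph_nat.
Qed.

Lemma natL_neq0 n : (0 < n)%N -> n%:R != 0 :> L.
Proof.
move=> n0; apply/negP=> /eqP e; move: n0.
by rewrite (natL (_ : n%:R = 0%:R)).
Qed.

Lemma phi_int (m : int) : phi m%:~R = m%:~R.
Proof. exact: rmorph_int. Qed.

Lemma intL_inj : injective (intr : int -> L).
Proof.
move=> i j e; apply/eqP; rewrite -subr_eq0 -(intr_eq0 rat) -(fmorph_eq0 phi) phi_int.
by rewrite rmorphB /= e subrr.
Qed.

(** The monic equation of [phi q] is an equation for [q] itself; it is transported to the algebraic
    numbers, where a rational algebraic integer is an integer. *)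
Lemma algint_rat q : algint (phi q) -> exists m : int, q = m%:~R.
Proof.
case=> p mp; have -> : map_poly intr p = map_poly phi (map_poly intr p).
  by rewrite -map_poly_comp; apply: eq_map_poly => m /=; rewrite rmorph_int.
rewrite fmorph_root => rq; have : (ratr q : algC) \in Num.int.
  apply: Cint_rat_Aint; first by apply/CratP; exists q.
  apply: (@root_monic_Aint (map_poly intr p)).
  - have -> : map_poly intr p = map_poly (ratr : rat -> algC) (map_poly intr p).
      by rewrite -map_poly_comp; apply: eq_map_poly => m /=; rewrite rmorph_int.
    by rewrite fmorph_root.
  - by rewrite monic_map.
  by apply/polyOverP=> i; rewrite coef_map /= intr_int.
case/intrP=> m e; exists m; apply: (fmorph_inj (ratr : {rmorphism rat -> algC})).
by rewrite rmorph_int; exact: e.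
Qed.

Lemma algint_scale z : exists m : nat, (0 < m)%N /\ algint (m%:R * z).
Proof.
have [p p0 pz] := alg_rat z; have [q [a a0 pq]] := rat_poly_scale p.
have q0 : q != 0 by apply: contraNneq p0 => q0; rewrite pq q0 rmorph0 scaler0.
have qz : root (map_poly intr q) z.
  move: pz; rewrite pq map_polyZ rootE hornerZ mulf_eq0 fmorph_eq0 invr_eq0 intr_eq0 (negPf a0) /=.
  rewrite -map_poly_comp (eq_map_poly (g := intr)) // => m /=; exact: rmorph_int.
have [n szq] : exists n, size q = n.+1 by exists (size q).-1; rewrite prednK // size_poly_gt0.
set l := lead_coef q; have l0 : l != 0 by rewrite lead_coef_eq0.
have Ol : algint (l%:~R * z).
  (* With [q] of degree [n] and leading coefficient [l], the value of this monic polynomial at [l z]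
     is [l ^ (n - 1) q(z)]. *)
  exists ('X^n + \poly_(i < n) (q`_i * l ^+ (n.-1 - i))).
    rewrite monicE lead_coefDl ?lead_coefXn // size_polyXn.
    by rewrite ltnS; apply: size_poly.
  rewrite rootE rmorphD /= map_polyXn hornerD hornerXn.
  case: n szq => [|n] szq.
    move: qz; rewrite rootE horner_coef size_map_inj_poly ?rmorph0 //; last exact: intL_inj.
    rewrite szq big_ord1 coef_map expr0 mulr1 /= => /eqP e.
    case/negP: l0; rewrite /l lead_coefE szq /= -(intr_eq0 rat) -(fmorph_eq0 phi) phi_int.
    by rewrite e.
  have e : l%:~R ^+ n * (map_poly intr q).[z] = 0 by rewrite (rootP qz) mulr0.
  apply/eqP; rewrite -[RHS]e [in RHS]horner_coef (@size_map_inj_poly _ _ intr) ?rmorph0 //;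
    last exact: intL_inj.
  rewrite szq big_ord_recr /= coef_map /= addrC mulrDr; congr (_ + _); last first.
    rewrite (@horner_coef_wide _ n.+1); last by rewrite (leq_trans (size_poly _ _)) // size_poly.
    rewrite mulr_sumr; apply: eq_bigr => i _; rewrite !coef_map /= coef_poly ltn_ord.
    have -> : l%:~R ^+ n = l%:~R ^+ (n - i) * l%:~R ^+ i :> L by rewrite -exprD subnK ?leq_ord.
    by rewrite rmorphM rmorphXn /= exprMn; ring.
  have -> : q`_n.+1 = l by rewrite /l lead_coefE szq.
  by rewrite exprMn exprS; ring.
exists `|l|%N; split; first by rewrite absz_gt0.
rewrite pmulrn abszE; case: (ger0P l) => _; first exact: Ol.
by rewrite rmorphN mulNr; apply: algintN.
Qed.

Lemma algint_common (I : finType) (F : I -> L) :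
  exists m : nat, (0 < m)%N /\ forall i, algint (m%:R * F i).
Proof.
have [f Hf] := seq_choice 0%N (fun i (_ : i \in enum I) => algint_scale (F i)).
have {}Hf i := Hf i (mem_enum _ i).
exists (\prod_i f i)%N; split=> [|i]; first by apply: prodn_gt0 => i; case: (Hf i).
rewrite (bigD1 i) //= natrM mulrAC; apply: algintM; last exact: algint_nat.
by case: (Hf i).
Qed.

Definition norm z := \prod_g s g z.

Lemma norm_gal g z : norm (s g z) = norm z.
Proof.
rewrite /norm (reindex_inj (mulgI g^-1%g)) /=; apply: eq_bigr => h _.
by rewrite -sM mulKVg.
Qed.

Lemma gal_norm g z : s g (norm z) = norm z.
Proof.
rewrite /norm rmorph_prod [RHS](reindex_inj (mulIg g)) /=; apply: eq_bigr => h _.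
by rewrite sM.
Qed.

Lemma normM u v : norm (u * v) = norm u * norm v.
Proof. by rewrite /norm -big_split; apply: eq_bigr => g _; rewrite rmorphM. Qed.

Lemma normX u n : norm (u ^+ n) = norm u ^+ n.
Proof.
elim: n => [|n IH]; last by rewrite !exprS normM IH.
by rewrite /norm big1 // => g _; rewrite rmorph1.
Qed.

Lemma norm_eq0 z : (norm z == 0) = (z == 0).
Proof.
apply/eqP/eqP => [/eqP/prodf_eq0[g _]|->]; first by rewrite fmorph_eq0 => /eqP.
by apply/eqP/prodf_eq0; exists 1%g; rewrite ?rmorph0.
Qed.

Lemma int_norm z : algint z -> exists m : int, norm z = m%:~R.
Proof.
move=> Oz; have [q e] := fixed_rat (gal_norm^~ z).
have [|m em] := @algint_rat q; last by exists m; rewrite e em phi_int.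
by rewrite -e; apply: algint_prod => g _; apply: algint_gal.
Qed.

Definition nonunit p := exists n : int, norm p = n%:~R /\ (1 < `|n|)%N.

Lemma nonunit_gal g p : nonunit p -> nonunit (s g p).
Proof. by case=> n [e ?]; exists n; rewrite norm_gal. Qed.

Lemma nonunit_neq0 p : nonunit p -> p != 0.
Proof.
case=> n [e n1]; rewrite -norm_eq0 e -(rmorph0 (intr : {rmorphism int -> L})).
by rewrite (inj_eq intL_inj); apply: contraTneq n1 => ->.
Qed.

(** The norm of [z] is an integer [m] divisible by every power of [n], where [|n| > 1]. The exponent
    [|m|] is already too large unless [m = 0], since [|n| ^ |m| > |m|]. *)
Lemma not_divisible p z : nonunit p ->
  (forall k, exists w, algint w /\ z = p ^+ k * w) -> z = 0.
Proof.
move=> [n [pn n1]] H; have [w0 [Oz]] := H 0%N; rewrite expr0 mul1r => ez.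
have [m em] := int_norm Oz; rewrite -ez in em.
apply/eqP; rewrite -norm_eq0 em -(rmorph0 (intr : {rmorphism int -> L})) (inj_eq intL_inj).
have [w [Ow ew]] := H `|m|%N; have [r er] := int_norm Ow.
have : m = n ^+ `|m| * r.
  by apply: intL_inj; rewrite -em ew normM normX pn er rmorphM rmorphXn.
move/(congr1 absz); rewrite abszM abszX => e; rewrite -absz_eq0.
have [//|m0] := posnP `|m|%N; have r0 : (0 < `|r|)%N.
  by case: posnP e => // ->; rewrite muln0 => e; rewrite e in m0.
have := ltn_expl `|m| n1; rewrite {1}e ltnNge; apply: contraNT => _.
by rewrite leq_pmulr.
Qed.

Definition comax p q := exists u v, [/\ algint u, algint v & u * p + v * q = 1].

Lemma comax_sym p q : comax p q -> comax q p.
Proof. by case=> u [v [Ou Ov e]]; exists v, u; split=> //; rewrite addrC. Qed.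

Lemma comaxM p q r : algint p -> algint q -> algint r ->
  comax p q -> comax p r -> comax p (q * r).
Proof.
move=> Op Oq Or [u [v [Ou Ov e]]] [u' [v' [Ou' Ov' e']]].
exists (u * (u' * p + v' * r) + v * q * u'), (v * v'); split.
- by rewrite e' mulr1; apply: algintD => //; apply: algintM => //; apply: algintM.
- exact: algintM.
by transitivity (u * p * (u' * p + v' * r) + v * q * (u' * p + v' * r)); [ring | rewrite e' !mulr1].
Qed.

Lemma comax_prod p (I : Type) (r : seq I) (F : I -> L) : algint p ->
  (forall i, algint (F i)) -> (forall i, comax p (F i)) -> comax p (\prod_(i <- r) F i).
Proof.
move=> Op OF cF; elim: r => [|i r IH].
  rewrite big_nil; exists 0, 1; split; [exact: (algint_nat 0)|exact: algint1|].
  by rewrite mul0r add0r mul1r.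
by rewrite big_cons; apply: comaxM => //; apply: algint_prod.
Qed.

Lemma comaxX p q n : algint p -> algint q -> comax p q -> comax p (q ^+ n).
Proof.
move=> Op Oq c; have := @comax_prod p _ (nseq n tt) (fun=> q) Op (fun=> Oq) (fun=> c).
by rewrite big_const_seq count_predT size_nseq iter_mulr mulr1.
Qed.

Definition cong m z := exists z', algint z' /\ z = 1 + m * z'.

Lemma cong_algint m z : algint m -> cong m z -> algint z.
Proof.
by move=> Om [z' [Oz' ->]]; apply: algintD; [exact: algint1 | apply: algintM].
Qed.

Lemma cong1 m : cong m 1.
Proof. by exists 0; split; [exact: (algint_nat 0)|rewrite mulr0 addr0]. Qed.

Lemma congM m u v : algint m -> cong m u -> cong m v -> cong m (u * v).
Proof.
move=> Om cu cv; have Ov := cong_algint Om cv; case: cu cv => [u' [Ou' ->]] [v' [Ov' ev]].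
exists (v' + u' * v); split; first by apply: algintD => //; apply: algintM.
by rewrite {1}ev ev; ring.
Qed.

Lemma congX m u n : algint m -> cong m u -> cong m (u ^+ n).
Proof.
by move=> Om cu; elim: n => [|n IH]; [apply: cong1 | rewrite exprS; apply: congM].
Qed.

Lemma cong_prod m (I : Type) (r : seq I) (F : I -> L) : algint m ->
  (forall i, cong m (F i)) -> cong m (\prod_(i <- r) F i).
Proof.
by move=> Om H; elim/big_rec: _ => [|i u _ cu]; [apply: cong1 | apply: congM].
Qed.

Lemma cong_gal (M : nat) g z : cong M%:R z -> cong M%:R (s g z).
Proof.
case=> z' [Oz' ->]; exists (s g z'); split; first exact: algint_gal.
by rewrite rmorphD rmorph1 rmorphM rmorph_nat.
Qed.

(* [(1 + M p)(1 - M p) = 1 - M^2 p^2] and [M^2 p^2] is a multiple of the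
   difference [M (p - q)] of the two numbers. *)
Lemma comax_cong (M : nat) p q e : algint p -> algint q -> algint e ->
  e * (p - q) = M%:R -> comax (1 + M%:R * p) (1 + M%:R * q).
Proof.
move=> Op Oq Oe eM; exists (1 - M%:R * p + e * p ^+ 2), (- (e * p ^+ 2)); split.
- apply: algintD; last by apply: algintM => //; apply: algintX.
  by apply: algintB; [exact: algint1 | apply: algintM => //; apply: algint_nat].
- by apply: algintN; apply: algintM => //; apply: algintX.
by transitivity (1 - M%:R ^+ 2 * p ^+ 2 + M%:R * (e * (p - q)) * p ^+ 2); [|rewrite eM]; ring.
Qed.

(** The numbers are [1 + M theta] and [1 + 2 M theta] for a primitive integral [theta]. The relevant
    differences of conjugates of [theta] and [2 theta] do not vanish, and all of them divide [M]
    among the integers, so [comax_cong] applies. A further factor [t] of [M] moves both norms away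
    from 0, 1 and -1. *)
Lemma comaximal_conjugates (theta : L) (N : nat) : (0 < N)%N ->
  (forall g, s g theta = theta -> g = 1%g) ->
  exists x y, [/\ cong N%:R x, cong N%:R y, nonunit x, nonunit y &
    [/\ forall g h, g != h -> comax (s g x) (s h x),
        forall g h, g != h -> comax (s g y) (s h y)
      & forall g h, comax (s g x) (s h y)]].
Proof.
(* [theta] can vanish only when the group is trivial, and then 1 does as well. *)
move=> N0 faith0; wlog [Ot t0] : theta faith0 / algint theta /\ theta != 0.
  move=> W; case: (eqVneq theta 0) => [t0|t0].
    apply: (W 1) => [g _|]; last by split; [exact: algint1|exact: oner_neq0].
    by apply: faith0; rewrite t0 rmorph0.
  have [m [m0 Om]] := algint_scale theta; have mL := natL_neq0 m0.
  apply: (W (m%:R * theta)) => [g|]; last by split=> //; rewrite mulf_neq0.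
  by rewrite rmorphM rmorph_nat => /(mulfI mL); apply: faith0.
have faith g h : g != h -> s g theta != s h theta.
  apply: contraNneq => e; rewrite eq_mulgV1; apply/eqP/faith0.
  by rewrite sM e -sM mulgV s1.
(* Equality would multiply the nonzero norm of [theta] by 2 to the order of the group. *)
have two g h : s g theta != 2%:R * s h theta.
  apply/eqP=> /(congr1 norm); rewrite normM !norm_gal => /eqP.
  rewrite -{1}[norm theta]mul1r (inj_eq (mulIf _)) ?norm_eq0 // /norm.
  rewrite (eq_bigr (fun=> 2%:R)) => [|k _]; last by rewrite rmorph_nat.
  rewrite prodr_const -natrX => /eqP /(natL (x1 := 1%N)) /esym/eqP.
  have : (0 < #|gT|)%N by apply/card_gt0P; exists 1%g.
  by case: #|gT| => // n _; rewrite expnS; lia.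
pose F (i : gT * gT * bool * bool) := let: (g, h, b, b') := i in
  ((if b' then 2%:R else 1) * s g theta - (if b then 2%:R else 1) * s h theta)^-1.
have [m [m0 Om]] := algint_common F.
have two0 : 2%:R != 0 :> L by apply: natL_neq0.
(* At a natural number [t] the polynomial [P k] is the norm of [1 + t k theta]. It is not constant,
   being 1 at 0 and vanishing at [- (k theta)^-1]; the product [Q] below excludes the norms 0, 1 and
   -1 together. *)
pose P (k : L) : {poly L} := \prod_g (1 + (k * s g theta)%:P * 'X).

have PE (k t : nat) : (P k%:R).[t%:R] = norm (1 + (t * k)%:R * theta).
  rewrite /P horner_prod; apply: eq_bigr => g _.
  rewrite !(hornerD, hornerM, hornerC, hornerX) rmorphD rmorph1 rmorphM rmorph_nat natrM.
  by ring.
have Pne (k : nat) (e : L) : (0 < k)%N -> P k%:R != e%:P.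
  move=> k0; have kL := natL_neq0 k0.
  have P0 : (P k%:R).[0] = 1.
    rewrite /P horner_prod big1 // => g _.
    by rewrite !(hornerD, hornerM, hornerC, hornerX) mulr0 addr0.
  apply/eqP=> eP; have e1 : e = 1 by rewrite -P0 eP hornerC.
  have : (P k%:R).[- (k%:R * theta)^-1] = 0.
    rewrite /P horner_prod (bigD1 1%g) //= s1.
    by rewrite !(hornerD, hornerM, hornerC, hornerX) mulrN divff ?mulf_neq0 // subrr mul0r.
  by rewrite eP hornerC e1 => /eqP; rewrite oner_eq0.
pose Q (k : nat) := P k%:R * (P k%:R - 1%:P) * (P k%:R - (-1)%:P).
have Q0 k : (0 < k)%N -> Q k != 0.
  by move=> k0; rewrite !mulf_neq0 ?subr_eq0 ?Pne // -polyC0 Pne.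
have Mk0 : (0 < N * m)%N by rewrite muln_gt0 N0.
have Mk20 : (0 < N * m * 2)%N by rewrite muln_gt0 Mk0.
have [t] := poly_nonroot natL (mulf_neq0 (Q0 _ Mk0) (Q0 _ Mk20)).
rewrite hornerM mulf_eq0 negb_or => /andP[Q1 Q2].
have nu k : (Q k).[t%:R] != 0 -> nonunit (1 + (t * k)%:R * theta).
  rewrite /Q !(hornerD, hornerM, hornerN, hornerC) PE => H.
  have [|n en] := @int_norm (1 + (t * k)%:R * theta).
    by apply: algintD; [exact: algint1|apply: algintM => //; exact: algint_nat].
  exists n; split=> //; move: H; rewrite en ltnNge; apply: contra => n1.
  have : n = 0 \/ n = 1 \/ n = -1 by lia.
  by case=> [->|[->|->]]; rewrite ?mul0r // ?rmorphN ?subrr ?mulr0 ?mul0r // opprK addNr mulr0.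
pose M := (t * (N * m))%N.
have M2 : ((t * (N * m * 2))%:R = M%:R * 2%:R :> L) by rewrite -natrM; congr _%:R; rewrite /M; lia.
have Mdiv b b' g h : (if b' then 2%:R else 1) * s g theta - (if b then 2%:R else 1) * s h theta
  != 0 ->
    exists e, algint e /\
      e * ((if b' then 2%:R else 1) * s g theta - (if b then 2%:R else 1) * s h theta) = M%:R.
  move=> ne; exists ((t * N)%:R * (m%:R * F (g, h, b, b'))); split.
    by apply: algintM; [exact: algint_nat|exact: Om].
  by rewrite /F -mulrA -mulrA mulVf // mulr1 -natrM; congr _%:R; rewrite /M; lia.
have Ot2 : algint (2%:R * theta) by apply: algintM => //; exact: algint_nat.
have congM' z : algint z -> cong N%:R (1 + M%:R * z).
  move=> Oz; exists ((t * m)%:R * z); split; first by apply: algintM => //; exact: algint_nat.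
  by rewrite mulrA -natrM; congr (1 + _%:R * _); rewrite /M; lia.
have sE g z : s g (1 + M%:R * z) = 1 + M%:R * s g z by rewrite rmorphD rmorph1 rmorphM rmorph_nat.
have s2 g : s g (2%:R * theta) = 2%:R * s g theta by rewrite rmorphM rmorph_nat.
have Os g z : algint z -> algint (s g z) by apply: algint_gal.
exists (1 + M%:R * theta), (1 + M%:R * (2%:R * theta)); split.
- exact: congM'.
- exact: congM'.
- exact: nu.
- by rewrite mulrA -M2; apply: nu.
split=> [g h gh|g h gh|g h]; rewrite !sE.
- have [|e [Oe ee]] := Mdiv false false g h; first by rewrite !mul1r subr_eq0 faith.
  by apply: (comax_cong _ _ Oe); rewrite -?ee ?mul1r //; apply: Os.
- have [|e [Oe ee]] := Mdiv true true g h.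
    by rewrite subr_eq0 (inj_eq (mulfI two0)) faith.
  by apply: (comax_cong _ _ Oe); rewrite ?s2 -?ee // -s2; apply: Os.
have [|e [Oe ee]] := Mdiv true false g h; first by rewrite mul1r subr_eq0 two.
by apply: (comax_cong _ _ Oe); rewrite ?s2 -?ee ?mul1r // -?s2; apply: Os.
Qed.

Lemma comax_big (I J : finType) (F : I -> L) (H : J -> L) (m : I -> nat) (n : J -> nat) :
  (forall i, algint (F i)) -> (forall j, algint (H j)) ->
  (forall i j, comax (F i) (H j)) ->
  comax (\prod_i F i ^+ m i) (\prod_j H j ^+ n j).
Proof.
move=> OF OH c; apply: comax_prod => [|j|j].
- by apply: algint_prod => i _; apply: algintX.
- exact: algintX.
apply: comaxX => //; first by apply: algint_prod => i _; apply: algintX.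
apply: comax_sym; apply: comax_prod => // i; first exact: algintX.
by apply: comaxX => //; apply: comax_sym.
Qed.

Lemma pow_ratio (u v : L) (n : int) : u != 0 -> v != 0 ->
  (if 0 < n then u else v) ^+ `|n| = (u / v) ^ n * (if 0 < n then v else u) ^+ `|n|.
Proof.
move=> u0 v0; case: n => [[|n]|n].
- by rewrite /= expr0z !expr0 mulr1.
- have -> : (0 < n.+1%:Z)%R by [].
  by rewrite -exprnP expr_div_n divfK // expf_neq0.
rewrite /= -[(u / v) ^ _]/((u / v) ^+ n.+1)^-1 expr_div_n invf_div divfK //.
exact: expf_neq0.
Qed.

(* [a] collects the factors of the character with positive exponent, [b] those
   with negative exponent. Their Bezout coefficients are made equivariant by a
   product over the Galois group. *)
Lemma galois_characters (theta : L) (spec : seq L) (l : L -> int) (N : nat) : (0 < N)%N ->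
  (forall g, s g theta = theta -> g = 1%g) ->
  (forall g z, z \in spec -> s g z \in spec) ->
  (forall z, z \in spec -> l z != 0) ->
  (forall z w, z \in spec -> w \in spec -> z + w \in spec -> l (z + w) = l z + l w) ->
  exists a b A B : L -> L,
  [/\ forall g z, [/\ s g (a z) = a (s g z), s g (b z) = b (s g z),
                     s g (A z) = A (s g z) & s g (B z) = B (s g z)],
      forall z, z \in spec -> [/\ cong N%:R (a z), cong N%:R (b z), cong N%:R (A z) & cong N%:R
        (1 + B z)],
      forall z, z \in spec -> [/\ a z != 0, b z != 0 & a z * A z + b z * B z = 1],
      forall z w, z \in spec -> w \in spec -> z + w \in spec ->
        a (z + w) * (b z * b w) = a z * a w * b (z + w)
    & forall z t, z \in spec -> (forall k, exists w, algint w /\ t = b z ^+ k * w) -> t = 0].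
Proof.
move=> N0 faith sS l0 lD.
have ON : algint N%:R by apply: algint_nat.
have [x [y [cx cy nx ny [xx yy xy]]]] := comaximal_conjugates N0 faith.
pose sel (c : bool) g := if c then s g x else s g y.
have selP c g : [/\ algint (sel c g), cong N%:R (sel c g) & nonunit (sel c g)].
  have cg : cong N%:R (sel c g) by case: c; apply: cong_gal.
  by split=> //; [apply: cong_algint cg | rewrite /sel; case: (c); apply: nonunit_gal].
have Osel c g : algint (sel c g) by case: (selP c g).
have sel0 c g : sel c g != 0 by case: (selP c g) => _ _; apply: nonunit_neq0.
have selM c g h : s h (sel c g) = sel c (g * h)%g by case: c; rewrite /sel sM.
have selC c c' g h : (g != h) || (c != c') -> comax (sel c g) (sel c' h).
  case: c c' => [] []; rewrite ?orbF /= => gh; [exact: xx|exact: xy| |exact: yy].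
  exact/comax_sym/xy.
(* The sign of the weight decides, conjugate by conjugate, whether [x] or [y] goes into the
   numerator [e true]; the other one goes into the denominator [e false]. *)
pose e (d : bool) z := \prod_g sel (d == (0 < l (s g^-1%g z))) g ^+ `|l (s g^-1%g z)|.
have reind h (z : L) (F : gT -> L -> L) :
    \prod_g F (g * h)%g (s g^-1%g z) = \prod_g F g (s g^-1%g (s h z)).
  rewrite [RHS](reindex_inj (mulIg h)); apply: eq_bigr => g _; congr (F _ _).
  by rewrite -sM invMg mulKVg.
have eS d g z : s g (e d z) = e d (s g z).
  rewrite /e rmorph_prod -(reind g z (fun g z => sel (d == (0 < l z)) g ^+ `|l z|)).
  by apply: eq_bigr => h _; rewrite rmorphXn selM.
have ec d z : cong N%:R (e d z).
  by apply: cong_prod => // g; apply: congX => //; case: (selP (d == (0 < l (s g^-1%g z))) g).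
have Oe d z : algint (e d z) by apply: cong_algint (ec d z).
have e0 d z : e d z != 0.
  by apply/prodf_neq0 => g _; apply: expf_neq0.
have eC z : comax (e true z) (e false z).
  apply: comax_big => [g|g|g h]; [exact: Osel|exact: Osel|]; apply: selC;
    case: (eqVneq g h) => [->|//] /=.
  by case: (0 < _).
have [v Hv] := seq_choice 0 (fun z (_ : z \in spec) =>
  let: ex_intro u (ex_intro v (And3 Ou Ov uv)) := eC z in
  ex_intro (fun v => algint v /\ exists u, algint u /\ u * e true z + v * e false z = 1) v
    (conj Ov (ex_intro _ u (conj Ou uv)))).
pose n := #|gT|; have n0 : (0 < n)%N by apply/card_gt0P; exists 1%g.
(* Each conjugated coefficient times [e false z] is 1 modulo [e true z], hence so is the product
   [e false z ^+ n * B' z]. This makes the quotient [A'] below integral. *)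
pose B' z := \prod_g s g (v (s g^-1%g z)).
have B'S g z : s g (B' z) = B' (s g z).
  rewrite /B' rmorph_prod -(reind g z (fun g z => s g (v z))).
  by apply: eq_bigr => h _; rewrite sM.
have OB' z : z \in spec -> algint (B' z).
  by move=> zs; apply: algint_prod => g _; apply: algint_gal; case: (Hv (s g^-1%g z)) => //;
    apply: sS.
pose A' z := (1 - e false z ^+ n * B' z) / e true z.
have A'S g z : s g (A' z) = A' (s g z).
  by rewrite /A' rmorphM fmorphV rmorphB rmorph1 rmorphM rmorphXn !eS B'S.
have AB' z : e true z * A' z + e false z ^+ n * B' z = 1.
  by rewrite /A' mulrCA divff // mulr1 subrK.
have OA' z : z \in spec -> algint (A' z).
  move=> zs; have : cong (e true z) (e false z ^+ n * B' z).
    rewrite /n -prodr_const /B' -big_split /=; apply: cong_prod => // g.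
    have [_ [u [Ou /(congr1 (s g))]]] := Hv _ (sS g^-1%g z zs).
    rewrite rmorphD !rmorphM !eS rmorph1 !sVK => uv; exists (- s g u).
    split; first by apply: algintN; apply: algint_gal.
    by rewrite -uv mulrN [e true z * _]mulrC addrC addrA addNr add0r mulrC.
  case=> w [Ow ew]; rewrite /A' ew opprD addNKr -mulrN mulrAC divff // mul1r.
  exact: algintN.
(* The plain coefficients [A'] and [B'] carry no congruence. From [a A' + b^n B' = 1] one gets
   [a - (a - 1) (a A' + b^n B') = 1], whose coefficients are 1 and 0 modulo [N], because [a - 1] is
   divisible by [N]. *)
exists (e true), (e false), (fun z => 1 - (e true z - 1) * A' z),
  (fun z => - ((e true z - 1) * (e false z ^+ n.-1 * B' z))); split.
- move=> g z; split; rewrite ?eS //.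
    by rewrite rmorphB rmorph1 rmorphM rmorphB rmorph1 eS A'S.
  by rewrite rmorphN !rmorphM rmorphB rmorph1 rmorphXn !eS B'S.
- move=> z zs; have [a' [Oa' ea]] := ec true z; have Nz : N%:R * a' = e true z - 1.
    by rewrite ea addrAC subrr add0r.
  split=> //; rewrite -Nz.
    exists (- (a' * A' z)); split; last by ring.
    by apply: algintN; apply: algintM => //; apply: OA'.
  exists (- (a' * (e false z ^+ n.-1 * B' z))); split; last by ring.
  by apply: algintN; apply: algintM => //; apply: algintM; [apply: algintX | apply: OB'].
- move=> z zs; split=> //;
  transitivity (e true z - (e true z - 1) * (e true z * A' z + e false z ^+ n * B' z)).
    by rewrite -(prednK n0) exprS; ring.
  by rewrite AB' mulr1 opprB addrC subrK.
- move=> z w zs ws zws; rewrite /e -!big_split /=; apply: eq_bigr => g _ /=.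
  rewrite rmorphD lD -?rmorphD ?sS //.
  have E k : sel (true == (0 < k)) g ^+ `|k| = (s g x / s g y) ^ k * sel (false == (0 < k)) g ^+
    `|k|.
    have := pow_ratio k (sel0 true g) (sel0 false g); rewrite /sel /=.
    by case: (0 < k).
  rewrite !E expfzDr; first by ring.
  by rewrite mulf_neq0 ?invr_eq0 ?(sel0 true g) ?(sel0 false g).
move=> z t zs H; pose p := sel (false == (0 < l z)) 1%g.
have [Op _ np] := selP (false == (0 < l z)) 1%g.
apply: (not_divisible np) => k; have [w [Ow ->]] := H k.
have [q [Oq eq]] : exists q, algint q /\ e false z = p * q.
  exists (p ^+ `|l z|.-1 * \prod_(g | g != 1%g) sel (false == (0 < l (s g^-1%g z))) g ^+ `|l (s
    g^-1%g z)|).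
  split; first by apply: algintM; [apply: algintX|apply: algint_prod => g _; apply: algintX;
    apply: Osel].
  by rewrite /e (bigD1 1%g) //= invg1 s1 mulrA -exprS prednK // absz_gt0 l0.
exists (q ^+ k * w); split; first by apply: algintM => //; apply: algintX.
by rewrite eq exprMn mulrA.
Qed.

End GaloisIntegers.

(** * The splitting field and its rational operators *)

Lemma splitting_field_exists (p : {poly rat}) : p \is monic ->
  exists (L : splittingFieldType rat) (rs : seq L),
    map_poly (in_alg L) p = \prod_(z <- rs) ('X - z%:P).
Proof.
move=> mp; have [r Dr] := closed_field_poly_normal (map_poly (ratr : rat -> algC) p).
rewrite lead_coef_map (monicP mp) rmorph1 scale1r in Dr.
have [Q [QC [rs Drs genQ]]] := num_field_exists r.
have ep : map_poly (in_alg Q) p = \prod_(z <- rs) ('X - z%:P).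
  apply: (map_poly_inj QC); rewrite -map_poly_comp.
  rewrite (eq_map_poly (g := ratr)) => [|q]; last by rewrite /= alg_num_field fmorph_rat.
  rewrite Dr -Drs big_map rmorph_prod; apply: eq_bigr => z _.
  by rewrite rmorphB /= map_polyX map_polyC.
have ax : SplittingField.axiom Q.
  exists (map_poly (in_alg Q) p); first by apply/polyOver1P; exists p.
  by exists rs => //; rewrite ep eqpxx.
pose L : splittingFieldType rat :=
  HB.pack Q (FieldExt_isSplittingField.Build rat Q ax).
by exists L, rs.
Qed.

Lemma galois_group_exists (L : splittingFieldType rat) :
  exists (gT : finGroupType) (s : gT -> {rmorphism L -> L}) (theta : L),
  [/\ forall g h z, s (g * h)%g z = s h (s g z), forall z, s 1%g z = z,
      forall z, (forall g, s g z = z) -> exists q, z = q%:A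
    & forall g, s g theta = theta -> g = 1%g].
Proof.
have gal : galois 1 {:L}.
  apply/and3P; split; [exact: sub1v| |exact: normalFieldf].
  apply/separableP=> z _; apply: pcharf0_separable => q.
  by rewrite (fmorph_pchar (in_alg L)) pchar_num.
exists (gal_of {:L}), (fun g => gal_repr g : {rmorphism L -> L}), (separable_generator 1 {:L}).
split=> [g h z|z|z fz|g gt].
- by rewrite /= galM ?memvf.
- by rewrite /= gal_id.
- have /vlineP[q ->] : z \in 1%VS; last by exists q.
  rewrite -(galois_fixedField gal); apply/fixedFieldP; first exact: memvf.
  by move=> g _; apply: fz.
apply/eqP/gal_eqP=> z _; rewrite gal_id.
have sep : separable 1 {:L} by case/and3P: gal.
have := memvf z; rewrite (eq_adjoin_separable_generator sep (sub1v _)).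
case/Fadjoin1_polyP=> p ->; rewrite -horner_map gt -map_poly_comp.
by rewrite (eq_map_poly (g := in_alg L)) // => q; rewrite /= rmorph_alg.
Qed.

(** A generic rational functional, scaled so that its values on [r] are integers. [numq] returns
    these values, so additivity holds whenever both vectors and their sum lie in [r]. *)
Lemma linear_weights (V : vectType rat) (r : seq V) : (forall v, v \in r -> v != 0) ->
  exists l : V -> int, (forall v, v \in r -> l v != 0) /\
    (forall v w, v \in r -> w \in r -> v + w \in r -> l (v + w) = l v + l w).
Proof.
move=> r0; pose co := passmx.rVof (vbasis {:V}).
have w0 (i : 'I_(size r)) : co (tnth (in_tuple r) i) != 0.
  by rewrite passmx.rVof_eq0 ?vbasisP // r0 // mem_tnth.
have [t Ht] := avoid_hyperplanes w0.
have [N [z [N0 Hz]]] := clear_denominators (fun i : 'I_(size r) =>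
  (co (tnth (in_tuple r) i) *m map_mx intr t) 0 0).
exists (fun v => numq (N%:R * (co v *m map_mx intr t) 0 0)).
have E v : v \in r -> (numq (N%:R * (co v *m map_mx intr t) 0 0))%:~R =
    N%:R * (co v *m map_mx intr t) 0 0 /\ (co v *m map_mx intr t) 0 0 != 0.
  by move=> /(tnthP (in_tuple r))[i ->]; rewrite Hz numq_int; split=> //; apply: Ht.
split=> [v vr|v w vr wr vwr].
  have [e n0] := E v vr; rewrite -(intr_eq0 rat) e mulf_neq0 // pnatr_eq0.
  by rewrite -lt0n.
apply: (@intr_inj rat); rewrite rmorphD /= !(proj1 (E _ _)) //.
by have := passmx.rVof_linear (vbasis {:V}) 1 v w; rewrite !scale1r /co => ->;
  rewrite mulmxDl mxE mulrDr.
Qed.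

Definition congmx (N : nat) d (E : 'M[rat]_d) :=
  exists E' : 'M[int]_d, E = 1%:M + N%:R *: map_mx intr E'.

Section EquivariantOperators.
Variables (L : fieldType) (phi : {rmorphism rat -> L}) (gT : finGroupType).
Variable s : gT -> {rmorphism L -> L}.
Hypothesis sM : forall g h z, s (g * h)%g z = s h (s g z).
Hypothesis s1 : forall z, s 1%g z = z.
Hypothesis fixed_rat : forall z, (forall g, s g z = z) -> exists q, z = phi q.
Hypothesis alg_rat : forall z, algebraicOver phi z.
Variables (d' : nat).
Local Notation d := d'.+1.
Variables (D : 'M[rat]_d) (spec : seq L) (n : nat) (pi : L -> 'M[L]_d).
Let DL := map_mx phi D.
Hypotheses (uniq_spec : uniq spec) (gal_spec : forall g z, z \in spec -> s g z \in spec)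
  (pi1 : \sum_(z <- spec) pi z = 1)
  (pi0 : forall z w, z \in spec -> w \in spec -> z != w -> pi z * pi w = 0)
  (piD : forall z, z \in spec -> pi z * (DL - z%:M) ^+ n = 0)
  (piP : forall z, z \in spec -> exists e, pi z = horner_mx DL e).

Lemma gal_phi g q : s g (phi q) = phi q.
Proof. by rewrite -[q]divq_num_den !fmorph_div !rmorph_int. Qed.

Lemma gal_D g : map_mx (s g) DL = DL.
Proof. by apply/matrixP=> i j; rewrite !mxE gal_phi. Qed.

(** The conjugated system [pi'] projects onto the same generalized eigenspaces, since [D] is
    rational; thus [pi' w * pi w = pi' w]. Two such commuting systems, both summing to 1,
    coincide. *)
Lemma gal_pi g z : z \in spec -> map_mx (s g) (pi z) = pi (s g z).
Proof.
move=> zs; pose pi' w := map_mx (s g) (pi (s g^-1%g w)).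
have pi'E w : w \in spec -> pi' w * pi w = pi' w.
  move=> ws; apply: (pi_fix uniq_spec pi1 piD piP ws (k := n)).
  have := congr1 (map_mx (s g)) (piD (gal_spec g^-1%g ws)).
  by rewrite map_mx0 map_mxM rmorphXn rmorphB /= map_scalar_mx /= gal_D (sVK sM s1).
have comm w v : w \in spec -> v \in spec -> pi w * pi' v = pi' v * pi w.
  move=> ws vs; have [e ->] := piP ws; have [f ef] := piP (gal_spec g^-1%g vs).
  by rewrite /pi' ef map_horner_mx gal_D -!rmorphM mulrC.
have pi'1 : \sum_(w <- spec) pi' w = 1.
  rewrite (perm_big (map (s g) spec)) /=; last first.
    apply: uniq_perm => //; first by rewrite map_inj_uniq //; apply: fmorph_inj.
    move=> w; apply/idP/mapP => [ws|[v vs ->]]; last exact: gal_spec.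
    by exists (s g^-1%g w); [apply: gal_spec | rewrite (sVK sM s1)].
  rewrite big_map; transitivity (map_mx (s g) (1 : 'M[L]_d)); last exact: map_mx1.
  rewrite -pi1 raddf_sum; apply: eq_bigr => w _.
  by rewrite /pi' (sV sM s1).
have gzs := gal_spec g zs.
rewrite -[RHS]mulr1 -pi'1 mulr_sumr (big_rem (s g z)) //= big_seq big1 => [|w].
  by rewrite addr0 comm // pi'E // /pi' (sV sM s1).
rewrite mem_rem_uniq // !inE => /andP[ne ws].
by rewrite comm // -pi'E // -mulrA pi0 ?mulr0.
Qed.

(** Functional calculus for the semisimple part of [D]: the operator acts by the scalar [e z] on the
    whole generalized eigenspace of [z]. *)
Definition Op (e : L -> L) := \sum_(z <- spec) e z *: pi z.

Lemma Op_pi e z : z \in spec -> Op e * pi z = e z *: pi z.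
Proof.
move=> zs; rewrite /Op mulr_suml (big_rem z) //= big_seq big1 => [|w].
  by rewrite addr0 -scalerAl (pi_idem uniq_spec pi1 pi0).
by rewrite mem_rem_uniq // !inE => /andP[ne ws]; rewrite -scalerAl pi0 ?scaler0.
Qed.

Lemma pi_Op e z : z \in spec -> pi z * Op e = e z *: pi z.
Proof.
move=> zs; rewrite -Op_pi //; have [p ->] := piP zs; rewrite /Op mulr_sumr mulr_suml.
rewrite big_seq [RHS]big_seq; apply: eq_bigr => w ws.
by have [q ->] := piP ws; rewrite -scalerAr -scalerAl -!rmorphM mulrC.
Qed.

Lemma OpX_pi e k z : z \in spec -> Op e ^+ k * pi z = e z ^+ k *: pi z.
Proof.
move=> zs; elim: k => [|k IH]; first by rewrite !expr0 mul1r scale1r.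
by rewrite exprSr -mulrA Op_pi // -scalerAr IH scalerA exprS.
Qed.

Lemma OpM e f : Op e * Op f = Op (fun z => e z * f z).
Proof.
rewrite {2}/Op mulr_sumr big_seq [RHS]big_seq; apply: eq_bigr => z zs.
by rewrite -scalerAr Op_pi // scalerA mulrC.
Qed.

Lemma Op1 e : (forall z, z \in spec -> e z = 1) -> Op e = 1.
Proof.
by move=> e1; rewrite -pi1 /Op big_seq [RHS]big_seq; apply: eq_bigr => z zs; rewrite e1 ?scale1r.
Qed.

Lemma OpD e f : Op e + Op f = Op (fun z => e z + f z).
Proof. by rewrite /Op -big_split; apply: eq_bigr => z _; rewrite scalerDl. Qed.

Lemma Op_horner e : exists p, Op e = horner_mx DL p.
Proof.
rewrite /Op big_seq; elim/big_rec: _ => [|z x zs [p ->]]; first by exists 0; rewrite rmorph0.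
have [q ->] := piP zs; exists (e z *: q + p).
by rewrite rmorphD /= linearZ.
Qed.

Lemma Op_rat e : (forall g z, s g (e z) = e (s g z)) ->
  exists E : 'M[rat]_d, map_mx phi E = Op e.
Proof.
move=> eq; have fix1 g : map_mx (s g) (Op e) = Op e.
  rewrite /Op raddf_sum [RHS](perm_big (map (s g) spec)) /=; last first.
    apply: uniq_perm => //; first by rewrite map_inj_uniq //; apply: fmorph_inj.
    move=> w; apply/idP/mapP => [ws|[v vs ->]]; last exact: gal_spec.
    by exists (s g^-1%g w); [apply: gal_spec | rewrite (sVK sM s1)].
  rewrite big_map big_seq [RHS]big_seq; apply: eq_bigr => z zs.
  by rewrite /= map_mxZ eq gal_pi.
have H (i : 'I_d * 'I_d) : exists q, Op e i.1 i.2 = phi q.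
  apply: fixed_rat => g; have := congr1 (fun M : 'M_d => M i.1 i.2) (fix1 g).
  by rewrite mxE.
have [q Hq] := fin_all_exists H; exists (\matrix_(i, j) q (i, j)).
by apply/matrixP=> i j; rewrite !mxE -Hq.
Qed.

(** Since the projections sum to 1, [E - 1] is the sum of the [(e z - 1) pi z]; the factor [N0] in
    the modulus pays for the denominators of the projections. *)
Lemma Op_cong (N N0 : nat) e (E : 'M[rat]_d) : (0 < N)%N ->
  (forall z i j, z \in spec -> algint (N0%:R * pi z i j)) ->
  (forall z, z \in spec -> cong (N * N0)%:R (e z)) ->
  map_mx phi E = Op e -> congmx N E.
Proof.
move=> NN N0P eC eE; have NL : N%:R != 0 :> L by apply: (natL_neq0 phi).
have H (i : 'I_d * 'I_d) : exists m : int, (N%:R^-1 *: (E - 1%:M)) i.1 i.2 = m%:~R.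
  apply: (algint_rat (phi := phi)); have [f Hf] := seq_choice 0 eC.
  rewrite !mxE rmorphM fmorphV rmorph_nat rmorphB rmorph_nat.
  have -> : phi (E i.1 i.2) = Op e i.1 i.2 by rewrite -eE mxE.
  have -> : (i.1 == i.2)%:R = (1 : 'M[L]_d) i.1 i.2 by rewrite mxE.
  rewrite -pi1 !summxE -sumrB mulr_sumr big_seq.
  apply: (big_ind (@algint L)); [exact: (algint_nat L 0)|exact: algintD|].
  move=> z zs; have [Of {1}->] := Hf z zs.
  rewrite mxE mulrDl mul1r addrAC subrr add0r natrM -!mulrA mulKf // mulrCA.
  by apply: algintM => //; apply: N0P.
have [m Hm] := fin_all_exists H; exists (\matrix_(i, j) m (i, j)).
apply/eqP; rewrite addrC -subr_eq; apply/eqP.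
have NQ : N%:R != 0 :> rat by rewrite pnatr_eq0 -lt0n.
rewrite -[LHS](scalerKV NQ); congr (_ *: _).
by apply/matrixP=> i j; rewrite (Hm (i, j)) !mxE.
Qed.

End EquivariantOperators.

Lemma scale_lie_br (F : fieldType) (d : nat) (c : 'I_d -> 'I_d -> 'rV[F]_d) a b x y :
  lie_br c (a *: x) (b *: y) = (a * b) *: lie_br c x y.
Proof.
rewrite /lie_br scaler_sumr; apply: eq_bigr => i _; rewrite scaler_sumr.
by apply: eq_bigr => j _; rewrite !mxE scalerA mulrACA.
Qed.

Lemma stable_horner (F : fieldType) (d' m : nat) (W : 'M[F]_(m, d'.+1)) (M : 'M[F]_d'.+1) p :
  (W *m M <= W)%MS -> (W *m horner_mx M p <= W)%MS.
Proof.
move=> WM; elim/poly_ind: p => [|p c IH]; first by rewrite rmorph0 mulmx0 sub0mx.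
rewrite rmorphD rmorphM /= horner_mx_X horner_mx_C mulmxDr; apply: addmx_sub.
  by rewrite mulmxA; apply: submx_trans WM; apply: submxMr.
by rewrite mul_mx_scalar scalemx_sub.
Qed.

(** The four characters are turned into rational matrices by [Op]. The last clause is the form of
    non-divisibility needed for freeness: it is relative to a stable subspace [W], later a term of
    the lower central series. *)
Lemma commuting_pair (d' : nat) (c : 'I_d'.+1 -> 'I_d'.+1 -> 'rV[rat]_d'.+1) (D : 'M[rat]_d'.+1)
    (N : nat) : is_der c D -> \det D != 0 -> (0 < N)%N ->
  exists a b A B : 'M[rat]_d'.+1,
  [/\ [/\ congmx N a, congmx N b, congmx N A & congmx N (1 + B)],
      [/\ a \in unitmx, b \in unitmx & a * A + b * B = 1],
      forall E, E \in [:: a; b; A; B] -> (forall E', E' \in [:: a; b; A; B] -> E * E' = E' * E) /\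
        (forall W : 'M_d'.+1, (W *m D <= W)%MS -> (W *m E <= W)%MS),
      forall x y, lie_br c x y *m (a * b^-1) = lie_br c (x *m (a * b^-1)) (y *m (a * b^-1))
    & forall (W : 'M_d'.+1) (q : nat) x, (W *m D <= W)%MS -> (0 < q)%N ->
      (forall k, exists y, (exists y' : 'rV[int]_d'.+1, q%:R *: y = map_mx intr y') /\
         (x - y *m b ^+ k <= W)%MS) -> (x <= W)%MS].
Proof.
move=> derD detD N0.
have [L [rs ers]] := splitting_field_exists (char_poly_monic D).
have [gT [s [theta [sM s1 fixq faith]]]] := galois_group_exists L.
pose phi : {rmorphism rat -> L} := in_alg L.
have fixed_rat z : (forall g, s g z = z) -> exists q, z = phi q by exact: fixq.
have alg_rat z : algebraicOver phi z.
  have /polyOver1P[p ep] := minPolyOver 1 z; exists p; last by rewrite -ep root_minPoly.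
  by rewrite -(map_poly_eq0 phi) -ep monic_neq0 ?monic_minPoly.
pose DL := map_mx phi D; pose spec := undup rs.
have eDL : char_poly DL = \prod_(z <- rs) ('X - z%:P) by rewrite -map_char_poly.
have spec_root z : (z \in spec) = root (map_poly phi (char_poly D)) z.
  by rewrite mem_undup -root_prod_XsubC -eDL map_char_poly.
have gp g q : s g (phi q) = phi q by apply: gal_phi.
have gal_spec g z : z \in spec -> s g z \in spec.
  rewrite !spec_root => /(rmorph_root (s g)); rewrite -map_poly_comp.
  by rewrite (eq_map_poly (g := phi)) // => q; exact: gp.
have spec0 z : z \in spec -> z != 0.
  rewrite spec_root; apply: contraTneq => ->; rewrite /root horner_coef0 coef_map fmorph_eq0.
  by rewrite char_poly_det mulf_neq0 // expf_neq0 // oppr_eq0 oner_eq0.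
have uS : uniq spec := undup_uniq rs.
have [pi [pi1 pi0 piD piP]] := spectral_projections uS (annihilator_of_roots eDL).
have [l [l0 lD]] := @linear_weights L spec spec0.
have [m [m0 Hm]] := algint_common alg_rat
  (fun i : 'I_(size spec) * 'I_d'.+1 * 'I_d'.+1 => pi (spec`_i.1.1) i.1.2 i.2).
have {}Hm z i j : z \in spec -> algint (m%:R * pi z i j).
  move=> zs; have := zs; rewrite -index_mem => lt.
  by have := Hm (Ordinal lt, i, j); rewrite /= nth_index.
have Nm0 : (0 < N * m)%N by rewrite muln_gt0 N0.
have [a [b [A [B [eqv cg bez mult nd]]]]] :=
  galois_characters sM s1 fixed_rat alg_rat Nm0 faith gal_spec l0 lD.
have rat_op := Op_rat sM s1 fixed_rat uS gal_spec pi1 pi0 piD piP.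
have [a' ea] : exists E : 'M[rat]_d'.+1, map_mx phi E = Op spec pi a by apply: rat_op => g z;
  case: (eqv g z).
have [b' eb] : exists E : 'M[rat]_d'.+1, map_mx phi E = Op spec pi b by apply: rat_op => g z;
  case: (eqv g z).
have [A' eA] : exists E : 'M[rat]_d'.+1, map_mx phi E = Op spec pi A by apply: rat_op => g z;
  case: (eqv g z).
have [B' eB] : exists E : 'M[rat]_d'.+1, map_mx phi E = Op spec pi B by apply: rat_op => g z;
  case: (eqv g z).
have inj : injective (map_mx phi : 'M[rat]_d'.+1 -> 'M[L]_d'.+1) by apply: map_mx_inj;
  apply: fmorph_inj.
have opM e f := OpM uS pi1 pi0 e f.
have unit_op e (E : 'M[rat]_d'.+1) : (forall z, z \in spec -> e z != 0) ->
    map_mx phi E = Op spec pi e -> E \in unitmx.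
  move=> e0 eE; rewrite -(map_unitmx phi) eE;
    apply: (proj1 (@mulmx1_unit _ _ _ (Op spec pi (fun z => (e z)^-1)) _)).
  by rewrite -[_ *m _]/(_ * _) opM (Op1 pi1) // => z zs; rewrite divff ?e0.
have ua : a' \in unitmx by apply: unit_op ea => z zs; case: (bez z zs).
have ub : b' \in unitmx by apply: unit_op eb => z zs; case: (bez z zs).
have ef : map_mx phi (a' * b'^-1) = Op spec pi (fun z => a z / b z).
  have ubL : map_mx phi b' \in unitmx by rewrite map_unitmx.
  rewrite map_mxM map_invmx ea; apply: (can_inj (mulmxK ubL)); rewrite mulmxKV //.
  rewrite eb -[_ *m _]/(_ * _) opM /Op big_seq [RHS]big_seq; apply: eq_bigr => z zs.
  by case: (bez z zs) => _ bz _; rewrite divfK.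
exists a', b', A', B'; split.
- have opc e (E : 'M[rat]_d'.+1) : (forall z, z \in spec -> cong (N * m)%:R (e z)) ->
      map_mx phi E = Op spec pi e -> congmx N E.
    by move=> H1 H2; apply: Op_cong H1 H2.
  split; [apply: opc ea|apply: opc eb|apply: opc eA|apply: (opc (fun z => 1 + B z))].
  - by move=> z zs; case: (cg z zs).
  - by move=> z zs; case: (cg z zs).
  - by move=> z zs; case: (cg z zs).
  - by move=> z zs; case: (cg z zs).
  by rewrite map_mxD map_mx1 eB -OpD (@Op1 _ _ _ _ pi1 (fun=> 1)).
- split=> //; apply: inj; rewrite map_mxD !map_mxM map_mx1 ea eb eA eB.
  rewrite -![_ *m _]/(_ * _) !opM OpD (Op1 pi1) // => z zs.
  by case: (bez z zs).
- have op4 E : E \in [:: a'; b'; A'; B'] -> exists e, map_mx phi E = Op spec pi e.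
    by rewrite !inE => /or4P[] /eqP ->; [exists a|exists b|exists A|exists B].
  move=> E /op4[e ee]; split=> [E' /op4[f fe]|W WD].
    apply: inj; rewrite !map_mxM ee fe -![_ *m _]/(_ * _) !opM.
    by apply: eq_bigr => z _; rewrite mulrC.
  rewrite -(map_submx phi) map_mxM ee; have [p ->] := Op_horner piP e.
  by apply: stable_horner; rewrite -map_mxM map_submx.
- move=> x y; move: (a' * b'^-1) ef => f ef.
  have injr : injective (map_mx phi : 'rV[rat]_d'.+1 -> 'rV[L]_d'.+1).
    by apply: map_mx_inj; apply: fmorph_inj.
  apply: injr; rewrite map_mxM !map_lie_br !map_mxM ef.
  set chi := fun z : L => a z / b z; have := base_change_der phi derD; rewrite -/DL.
  set cL := fun i j => _ => derL.
  have piD' (u : 'rV_d'.+1) z : z \in spec -> u *m pi z *m (DL - z%:M) ^+ size rs = 0.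
    by move=> zs; rewrite -mulmxA [X in _ *m X](piD z zs) mulmx0.
  have key (u v : 'rV_d'.+1) z w : z \in spec -> w \in spec ->
      lie_br cL (u *m pi z) (v *m pi w) *m Op spec pi chi =
      lie_br cL (u *m pi z *m Op spec pi chi) (v *m pi w *m Op spec pi chi).
    move=> zs ws;
      have pio (t : 'rV_d'.+1) z' : z' \in spec -> t *m pi z' *m Op spec pi chi = chi z' *: (t *m
        pi z').
      by move=> ys; rewrite -mulmxA [X in _ *m X](pi_Op uS pi1 pi0 piP) // -scalemxAr.
    rewrite !pio // scale_lie_br.
    have nil := br_der_eigen derL (piD' u z zs) (piD' v w ws).
    have [zws|zws] := boolP (z + w \in spec); last first.
      by rewrite (pi_notin pi1 piD piP zws nil) mul0mx scaler0.
    rewrite -(pi_fix uS pi1 piD piP zws nil) pio // /chi.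
    have [_ bz _] := bez z zs; have [_ bw _] := bez w ws; have [_ bzw _] := bez _ zws.
    congr (_ *: _); apply: (mulIf (mulf_neq0 bzw (mulf_neq0 bz bw))).
    have := mult z w zs ws zws; move: bz bw bzw;
      move: (a (z + w)) (b (z + w)) (a z) (a w) (b z) (b w).
    move=> u1 u2 u3 u4 u5 u6 h5 h6 h2 e1.
    by rewrite mulrA divfK // e1; field; rewrite h5 h6.
  move: (map_mx phi x) (map_mx phi y) => u v; set O := Op spec pi chi.
  have dec (t : 'rV_d'.+1) : t = \sum_(z <- spec) 1 *: (t *m pi z).
    by rewrite -{1}[t]mulmx1 -[1%:M]pi1 mulmx_sumr; apply: eq_bigr => z _; rewrite scale1r.
  have decO (t : 'rV_d'.+1) : t *m O = \sum_(z <- spec) 1 *: (t *m pi z *m O).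
    by rewrite {1}(dec t) mulmx_suml; apply: eq_bigr => z _; rewrite !scale1r.
  rewrite (decO u) (decO v) {1}(dec u) {1}(dec v) !lie_br_suml mulmx_suml.
  rewrite big_seq [RHS]big_seq; apply: eq_bigr => z zs; rewrite !lie_br_sumr !scale1r mulmx_suml.
  rewrite big_seq [RHS]big_seq; apply: eq_bigr => w ws; rewrite !scale1r; exact: key.
(* Following [pi z] by the cokernel of [W] turns the congruences [x = y b^k] modulo [W] into
   divisibility of each coordinate by [b z ^+ k], once [q] and the denominators [k0] are cleared. *)
move=> W q x WD q0 H; rewrite -(map_submx phi) submxE; set ck := cokermx _.
have [k0 [k00 Hk]] := algint_common alg_rat
  (fun i : 'I_(size spec) * 'I_d'.+1 * 'I_d'.+1 => (pi (spec`_i.1.1) *m ck) i.1.2 i.2).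
have {}Hk z i j : z \in spec -> algint (k0%:R * (pi z *m ck) i j).
  move=> zs; have := zs; rewrite -index_mem => lt.
  by have := Hk (Ordinal lt, i, j); rewrite /= nth_index.
have qL : q%:R != 0 :> L by apply: (natL_neq0 phi).
have kL : k0%:R != 0 :> L by apply: (natL_neq0 phi).
have zero z : z \in spec -> map_mx phi x *m (pi z *m ck) = 0.
  move=> zs; apply/rowP=> j; rewrite [RHS]mxE.
  suff : q%:R * k0%:R * (map_mx phi x *m (pi z *m ck)) 0 j = 0.
    by move/eqP; rewrite !mulf_eq0 (negPf qL) (negPf kL) => /eqP.
  apply: (nd z _ zs) => k; have [y [[y' ey] Wy]] := H k.
  exists (q%:R * k0%:R * (map_mx phi y *m (pi z *m ck)) 0 j); split.
    rewrite mxE mulr_sumr; apply: (big_ind (@algint L)); [exact: (algint_nat L 0)|exact: algintD|].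
    move=> i _; rewrite mulrACA; apply: algintM; last exact: Hk.
    have := congr1 (fun t : 'rV_d'.+1 => phi (t 0 i)) ey.
    by rewrite !mxE rmorphM rmorph_nat rmorph_int => ->; apply: algint_int.
  rewrite mulrCA; congr (_ * _).
  have WL : (map_mx phi x - map_mx phi y *m map_mx phi b' ^+ k <= map_mx phi W)%MS.
    by rewrite -rmorphXn -map_mxM -map_mxB map_submx.
  have : (map_mx phi x - map_mx phi y *m map_mx phi b' ^+ k) *m pi z *m ck = 0.
    apply/eqP; rewrite -submxE; have [p ->] := piP z zs.
    apply: (submx_trans (submxMr _ WL)).
    by apply: stable_horner; rewrite -map_mxM map_submx.
  rewrite !mulmxBl -mulmxA => /subr0_eq ->.
  rewrite eb -(mulmxA _ _ (pi z)) [X in _ *m X *m _](OpX_pi uS pi1 pi0) // -scalemxAr -scalemxAl.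
  rewrite [LHS]mxE; congr (_ * _).
  exact: (congr1 (fun t : 'rV_d'.+1 => t 0 j) (esym (mulmxA _ _ _))).
rewrite -[map_mx phi x]mulmx1 -[1%:M]pi1 mulmx_sumr mulmx_suml big_seq big1 // => z zs.
by rewrite -mulmxA zero.
Qed.

(** * Lattices stable under the Campbell-Hausdorff product *)

Section DynkinDenominators.
Variables (V : lmodType rat) (P : V -> Prop) (K : nat).
Hypotheses (P0 : P 0) (PD : forall x y, P x -> P y -> P (x + y)) (PN : forall x, P x -> P (- x)).

Lemma subgroup_scale (z : int) x : P x -> P (z%:~R *: x).
Proof.
move=> Px; have Pn (n : nat) : P (n%:R *: x).
  elim: n => [|n IH]; first by rewrite scale0r.
  by rewrite -addn1 natrD scalerDl scale1r; apply: PD.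
case: z => n; first by rewrite -pmulrn; apply: Pn.
by rewrite NegzE mulrNz scaleNr -pmulrn; apply/PN/Pn.
Qed.

Lemma subgroup_fraction (k m : nat) x : (k %| m)%N -> (0 < m)%N ->
  P (m%:R^-1 *: x) -> P (k%:R^-1 *: x).
Proof.
move=> /dvdnP[q ->]; rewrite muln_gt0 => /andP[q0 k0] /(subgroup_scale q%:Z).
by rewrite scalerA natrM invfM mulrA mulfV ?mul1r // pnatr_eq0 -lt0n.
Qed.

Lemma subgroup_sum (I : Type) (r : seq I) (Q : pred I) (F : I -> V) :
  (forall i, Q i -> P (F i)) -> P (\sum_(i <- r | Q i) F i).
Proof. by move=> H; apply: (big_ind P). Qed.

Lemma Tsum_denominator n (g : seq bool -> V) :
  (forall w, P (((K`! ^ (2 * n))%N)%:R^-1 *: g w)) -> P (Tsum K n g).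
Proof.
elim: n g => [|n IH] g H; first by have := H [::]; rewrite muln0 expn0 invr1 scale1r.
rewrite /=; apply: subgroup_sum => r _; apply: subgroup_sum => s _.
have -> : forall T : V, ((r`!)%:R * (s`!)%:R)^-1 *: T = ((r`! * s`!)%N)%:R^-1 *: T.
  by move=> T; rewrite natrM.
rewrite (Tsum_linear (phi := fun v => ((r`! * s`!)%N)%:R^-1 *: v)); last first.
  by move=> a u v; rewrite scalerDr !scalerA mulrC.
apply: IH => w; rewrite scalerA -invfM -natrM.
apply: (@subgroup_fraction _ (K`! ^ (2 * n.+1))); [|by rewrite expn_gt0 fact_gt0|exact: H].
rewrite mulnS expnD -mulnn mulnC dvdn_mul // dvdn_mul //.
  by rewrite (fact_split (leq_ord r)) dvdn_mulr.
by rewrite (fact_split (leq_ord s)) dvdn_mulr.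
Qed.

(** One factor [K!] absorbs [1 / n]; each of the at most [K] blocks absorbs its two factorials with
    two more. *)
Definition dynkin_den := (K`! * K`! ^ (2 * K))%N.

Lemma dynkin_den_gt0 : (0 < dynkin_den)%N.
Proof. by rewrite muln_gt0 expn_gt0 fact_gt0. Qed.

Lemma BCHsum_denominator (g : seq bool -> V) :
  (forall w, P (dynkin_den%:R^-1 *: g w)) -> P (BCHsum K g).
Proof.
move=> H; rewrite /BCHsum big_nat_cond; apply: subgroup_sum => n /andP[/andP[n1 nK] _].
rewrite -scalerA; have -> : (-1) ^+ n.-1 = ((-1) ^+ n.-1)%:~R :> rat by rewrite rmorphXn rmorphN.
apply: subgroup_scale; rewrite (Tsum_linear (phi := fun v => n%:R^-1 *: v)); last first.
  by move=> a u v; rewrite scalerDr !scalerA mulrC.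
apply: Tsum_denominator => w; rewrite scalerA -invfM -natrM.
apply: (subgroup_fraction _ dynkin_den_gt0 (H w)); rewrite mulnC dvdn_mul //.
  by apply: dvdn_fact; rewrite n1.
by apply: dvdn_exp2l; rewrite leq_mul2l -ltnS nK orbT.
Qed.

End DynkinDenominators.

Section LieLattice.
Variables (L : lmodType rat) (br : L -> L -> L) (K : nat).
Hypotheses (lieL : lie_bracket br) (nilL : nil_bracket br K).
Local Notation "x ** y" := (bchg br K x y) (at level 40, left associativity).
Variable gens : seq L.

Inductive ZN (m : nat) : L -> Prop :=
| ZN_zero : ZN m 0
| ZN_add x y : ZN m x -> ZN m y -> ZN m (x + y)
| ZN_opp x : ZN m x -> ZN m (- x)
| ZN_base s : size s = m -> (forall x, x \in s -> x \in gens) -> ZN m (nest br s).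

Lemma ZN_gen a j y : a \in gens -> (0 < j)%N -> ZN j y -> ZN j.+1 (br a y).
Proof.
move=> Sa j0; elim=> [|y1 y2 _ H1 _ H2|y1 _ H1|s js Ss].
- by rewrite (br0r lieL); apply: ZN_zero.
- by rewrite (brDr lieL); apply: ZN_add.
- by rewrite (brNr lieL); apply: ZN_opp.
have -> : br a (nest br s) = nest br (a :: s) by case: s js Ss j0 => //; case: j.
by apply: ZN_base => [|x]; rewrite /= ?js // inE => /orP[/eqP ->|/Ss].
Qed.

Lemma ZN_br i j x y : (0 < i)%N -> (0 < j)%N -> ZN i x -> ZN j y -> ZN (i + j) (br x y).
Proof.
move=> i0 j0; elim=> [|x1 x2 _ H1 _ H2|x1 _ H1|s les Ss] Hy.
- by rewrite (br0l lieL); apply: ZN_zero.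
- by rewrite (brDl lieL); apply: ZN_add; [apply: H1|apply: H2].
- by rewrite (brNl lieL); apply: ZN_opp; apply: H1.
rewrite -les; have {les i0} : s != [::] by case: s les {Ss} => //; case: (i) i0.
elim: s Ss j j0 y Hy => [//|a [|b s] IH] Ss j j0 y Hy _.
  by apply: ZN_gen => //; apply: Ss; rewrite mem_head.
have Sa : a \in gens by apply: Ss; rewrite mem_head.
have {}IH := IH (fun x xs => Ss x (@mem_behead _ [:: a, b & s] x xs)).
set X := nest br (b :: s) in IH *.
have -> : br (nest br [:: a, b & s]) y = br a (br X y) - br X (br a y).
  by rewrite (br_leibniz lieL a X y) addrK.
have -> : (size [:: a, b & s] + j = (size (b :: s) + j).+1)%N by [].
apply: ZN_add; first by apply: ZN_gen => //; apply: IH.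
by apply: ZN_opp; rewrite -addnS; apply: IH => //; apply: ZN_gen.
Qed.

(* Weighting a bracket of length [m + 1] by [q^-m] makes [[Lam, Lam]] a subset
   of [q Lam], which absorbs the denominators of the Dynkin series. *)
Let q := (2 * (K.+2)`! * dynkin_den K.+2)%N.

Let q_gt0 : (0 < q)%N.
Proof. by rewrite muln_gt0 dynkin_den_gt0 andbT muln_gt0 fact_gt0. Qed.

Let qQ : q%:R != 0 :> rat.
Proof. by rewrite pnatr_eq0 -lt0n q_gt0. Qed.

Inductive Lam : L -> Prop :=
| Lam_zero : Lam 0
| Lam_add x y : Lam x -> Lam y -> Lam (x + y)
| Lam_base m x : ZN m.+1 x -> Lam ((q%:R ^+ m)^-1 *: x).

Lemma Lam_opp x : Lam x -> Lam (- x).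
Proof.
elim=> [|y z _ Hy _ Hz|m y Hy]; first by rewrite oppr0; apply: Lam_zero.
  by rewrite opprD; apply: Lam_add.
by rewrite -scalerN; apply: Lam_base; apply: ZN_opp.
Qed.

Lemma Lam_gen x : x \in gens -> Lam x.
Proof.
move=> xg; have := @Lam_base 0 x; rewrite expr0 invr1 scale1r; apply.
by apply: (@ZN_base 1 [:: x]) => // y; rewrite inE => /eqP ->.
Qed.

Lemma Lam_br x y : Lam x -> Lam y -> Lam (q%:R^-1 *: br x y).
Proof.
elim=> [|x1 x2 _ H1 _ H2|m x1 Hx] Hy.
- by rewrite (br0l lieL) scaler0; apply: Lam_zero.
- by rewrite (brDl lieL) scalerDr; apply: Lam_add; [apply: H1|apply: H2].
elim: Hy => [|y1 y2 _ H1 _ H2|n y1 Hy].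
- by rewrite (br0r lieL) scaler0; apply: Lam_zero.
- by rewrite (brDr lieL) scalerDr; apply: Lam_add.
rewrite (brZl lieL) (brZr lieL) !scalerA -!invfM.
have -> : q%:R * (q%:R ^+ m * q%:R ^+ n) = q%:R ^+ (m + n).+1 :> rat.
  by rewrite exprS exprD.
by apply: Lam_base; rewrite -addnS -addSn; apply: ZN_br.
Qed.

Definition LamX (e : nat) x := Lam (e%:R^-1 *: x).

Lemma LamX1 x : LamX 1 x <-> Lam x.
Proof. by rewrite /LamX invr1 scale1r. Qed.

Lemma LamX0 e : LamX e 0.
Proof. by rewrite /LamX scaler0; apply: Lam_zero. Qed.

Lemma LamXD e x y : LamX e x -> LamX e y -> LamX e (x + y).
Proof. by rewrite /LamX scalerDr; apply: Lam_add. Qed.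

Lemma LamXN e x : LamX e x -> LamX e (- x).
Proof. by rewrite /LamX scalerN; apply: Lam_opp. Qed.

Lemma LamX_br e e' x y : LamX e x -> LamX e' y -> LamX (q * e * e') (br x y).
Proof.
move=> Hx Hy; have := Lam_br Hx Hy.
by rewrite (brZl lieL) (brZr lieL) !scalerA -!invfM -!natrM mulnA.
Qed.

Lemma LamX_dvd e e' x : (e %| e')%N -> (0 < e')%N -> LamX e' x -> LamX e x.
Proof.
apply: subgroup_fraction; [exact: Lam_zero|exact: Lam_add|exact: Lam_opp].
Qed.

(** The difference telescopes at the outermost letter. Every bracket gains a factor [q], and in each
    term exactly one place contributes the factor [m]. *)
Lemma LamX_nest_congr m w x y x' y' : Lam x -> Lam y -> Lam x' -> Lam y' ->
  LamX m (x - x') -> LamX m (y - y') ->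
  LamX (q ^ (size w).-1) (nest br (lett x y w)) /\
  LamX (q ^ (size w).-1 * m) (nest br (lett x y w) - nest br (lett x' y' w)).
Proof.
move=> Hx Hy Hx' Hy' mx my; pose pick (b : bool) (u v : L) := if b then u else v.
have L1 b : LamX 1 (pick b x y) by rewrite LamX1; case: b.
have L1' b : LamX 1 (pick b x' y') by rewrite LamX1; case: b.
have Lm b : LamX m (pick b x y - pick b x' y') by case: b.
elim: w (x') (y') {Hx' Hy' mx my} L1' Lm => [|b [|b' w] IH] x1 y1 L1' Lm.
- by rewrite subrr; split; apply: LamX0.
- by rewrite expn0 mul1n; split; [apply: (L1 b)|apply: (Lm b)].
have [IH1 IH2] := IH _ _ L1' Lm; have [IH1' _] := IH x1 y1 L1' Lm.
rewrite -![nest br (lett _ _ [:: b, b' & w])]/(br (pick b _ _) (nest br (lett _ _ (b' :: w)))).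
split; first by have := LamX_br (L1 b) IH1; rewrite muln1 -expnS.
have -> : br (pick b x y) (nest br (lett x y (b' :: w))) -
   br (pick b x1 y1) (nest br (lett x1 y1 (b' :: w))) =
   br (pick b x1 y1) (nest br (lett x y (b' :: w)) - nest br (lett x1 y1 (b' :: w))) +
   br (pick b x y - pick b x1 y1) (nest br (lett x y (b' :: w))).
  by rewrite (brDr lieL) (brNr lieL) (brDl lieL) (brNl lieL) [RHS]addrC addrA subrK.
apply: LamXD.
  by have := LamX_br (L1' b) IH2; rewrite muln1 mulnA -expnS.
by have := LamX_br (Lm b) IH1; rewrite -mulnA [(m * _)%N]mulnC mulnA -expnS.
Qed.

Lemma LamX_tail_congr m x y x' y' : (0 < m)%N -> Lam x -> Lam y -> Lam x' -> Lam y' ->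
  LamX m (x - x') -> LamX m (y - y') ->
  LamX m (bch_tail br K x y - bch_tail br K x' y').
Proof.
move=> m0 Hx Hy Hx' Hy' mx my.
pose g w := nest br (lett x y w) - nest br (lett x' y' w).
have -> : bch_tail br K x y - bch_tail br K x' y' =
    BCHsum K.+2 (fun w => if (2 < size w)%N then (size w)%:R^-1 *: g w else 0).
  rewrite /bch_tail BCHsumN -BCHsumD; apply: BCHsum_eq => w _.
  by case: ifP => _; rewrite ?oppr0 ?addr0 // scalerBr.
apply: (BCHsum_denominator (P := LamX m)); [exact: LamX0|exact: LamXD|exact: LamXN|].
move=> w; case: ifP => w2; last by rewrite scaler0; apply: LamX0.
have [wK|wK] := leqP (size w) K; last first.
  by rewrite /g !nilL ?size_lett // subrr !scaler0; apply: LamX0.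
rewrite scalerA -invfM -natrM /LamX scalerA -invfM -natrM.
have [_] := LamX_nest_congr w Hx Hy Hx' Hy' mx my; apply: LamX_dvd; last first.
  by rewrite muln_gt0 expn_gt0 q_gt0.
(* The tail has words of length at least 3, so at least one [q] is available; its factors [(K.+2)!]
   and [dynkin_den K.+2] absorb [1 / size w] and the denominators of the sum. *)
rewrite mulnC dvdn_mul // (dvdn_trans (n := q)) //; last first.
  by apply: dvdn_exp => //; case: (size w) w2 => [|[]].
rewrite mulnC dvdn_mul // dvdn_mull // dvdn_fact //.
by rewrite (leq_trans _ w2) //= (leq_trans wK) // -addn2 leq_addr.
Qed.

Lemma Lam_bch_congr m x y x' y' : (0 < m)%N -> Lam x -> Lam y -> Lam x' -> Lam y' ->
  LamX m (x - x') -> LamX m (y - y') -> LamX m (x ** y - x' ** y').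
Proof.
move=> m0 Hx Hy Hx' Hy' mx my; rewrite !(bchg_expand lieL nilL).
have -> : x + y + 2^-1 *: br x y + bch_tail br K x y -
    (x' + y' + 2^-1 *: br x' y' + bch_tail br K x' y') =
    (x - x') + (y - y') + 2^-1 *: (br x y - br x' y') +
    (bch_tail br K x y - bch_tail br K x' y').
  rewrite scalerBr; move: (2^-1 *: br x y) (2^-1 *: br x' y') (bch_tail _ _ _ _) (bch_tail _ _ _ _).
  by move=> u v s t; rewrite !opprD (AC (4*4) ((1*5)*(2*6)*(3*7)*(4*8))).
apply: LamXD; last exact: LamX_tail_congr.
apply: LamXD; first exact: LamXD.
have [_] := LamX_nest_congr [:: true; false] Hx Hy Hx' Hy' mx my.
rewrite /LamX scalerA -invfM -(natrM _ m 2); apply: LamX_dvd;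
  last by rewrite muln_gt0 expn_gt0 q_gt0.
by rewrite mulnC dvdn_mul // expn1 /q -mulnA dvdn_mulr.
Qed.

Lemma Lam_bch x y : Lam x -> Lam y -> Lam (x ** y).
Proof.
move=> Hx Hy; apply/LamX1; rewrite -[_ ** _]subr0 -(bchg0 lieL nilL 0).
by apply: Lam_bch_congr => //; rewrite ?subr0; try exact: Lam_zero; apply/LamX1.
Qed.

End LieLattice.

(** Classical reasoning: as long as the row space misses a vector satisfying [P], that vector is
    adjoined, and the codimension bounds the number of steps. *)
Lemma subspace_matrix (F : fieldType) (d : nat) (P : 'rV[F]_d -> Prop) :
  P 0 -> (forall x y, P x -> P y -> P (x + y)) -> (forall a x, P x -> P (a *: x)) ->
  exists W : 'M[F]_d, forall x, (x <= W)%MS <-> P x.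
Proof.
move=> P0 PD PZ; have step (k : nat) (W : 'M[F]_d) : (d - \rank W <= k)%N ->
    (forall x : 'rV_d, (x <= W)%MS -> P x) ->
    exists W' : 'M[F]_d, forall x : 'rV_d, (x <= W')%MS <-> P x.
  elim: k W => [|k IH] W rk WP.
    exists W => x; split=> [|_]; first exact: WP.
    by rewrite submx_full // /row_full eqn_leq rank_leq_col -subn_eq0 -leqn0.
  case: (Classical_Prop.classic (forall x, P x -> (x <= W)%MS)) => [H|].
    by exists W => x; split; [apply: WP | apply: H].
  move=> H; have [x Hx] := Classical_Pred_Type.not_all_ex_not _ _ H.
  have [Px /negP xW] := Classical_Prop.imply_to_and _ _ Hx.
  apply: (IH (W + x)%MS).
    have : (W < W + x)%MS by rewrite ltmxE addsmxSl addsmx_sub submx_refl (negPf xW).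
    move/rank_ltmx => lt; rewrite -ltnS; apply: leq_trans rk;
      rewrite ltn_sub2l // (leq_trans lt) ?rank_leq_col //.
  move=> y /sub_addsmxP[[u v] /= ->]; apply: PD; first by apply: WP; apply: submxMl.
  by rewrite [v]mx11_scalar mul_scalar_mx; apply: PZ.
by apply: (step _ 0 (leqnn _)) => x; rewrite submx0 => /eqP ->.
Qed.

Definition intv d (x : 'rV[rat]_d) := exists x' : 'rV[int]_d, x = map_mx intr x'.

Lemma intvD d (x y : 'rV[rat]_d) : intv x -> intv y -> intv (x + y).
Proof. by move=> [x' ->] [y' ->]; exists (x' + y'); rewrite map_mxD. Qed.

Lemma intvZ d (z : int) (x : 'rV[rat]_d) : intv x -> intv (z%:~R *: x).
Proof. by move=> [x' ->]; exists (z *: x'); rewrite map_mxZ. Qed.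

Lemma intvZn d (n : nat) (x : 'rV[rat]_d) : intv x -> intv (n%:R *: x).
Proof. by move/(intvZ n%:Z). Qed.

Lemma intvN d (x : 'rV[rat]_d) : intv x -> intv (- x).
Proof. by move=> [x' ->]; exists (- x'); rewrite map_mxN. Qed.

Lemma intv0 d : @intv d 0.
Proof. by exists 0; rewrite map_mx0. Qed.

Lemma intvM d (x : 'rV[rat]_d) (E : 'M[int]_d) : intv x -> intv (x *m map_mx intr E).
Proof. by move=> [x' ->]; exists (x' *m E); rewrite map_mxM. Qed.

Lemma intv_coord d (x : 'rV[rat]_d) : (forall i, exists z : int, x 0 i = z%:~R) -> intv x.
Proof.
move=> H; have [z Hz] := fin_all_exists H; exists (\row_i z i).
by apply/rowP=> i; rewrite !mxE.
Qed.

Section LatticeDenominators.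
Variables (d : nat) (c : 'I_d -> 'I_d -> 'rV[rat]_d) (K : nat).
Local Notation br := (lie_br c).
Hypotheses (lieL : lie_bracket br) (nilL : nil_bracket br K).
Variable V : seq 'rV[rat]_d.

Lemma ZN_nil m x : (K < m)%N -> ZN br V m x -> x = 0.
Proof.
move=> lt; elim=> [|y z _ -> _ ->|y _ ->|s es _]; rewrite ?addr0 ?oppr0 //.
by apply: nilL; rewrite es.
Qed.

(** The weights [q^-m] in [Lam] are unbounded, but brackets of length above [K] vanish, so only
    boundedly many powers of [q] and of the structure denominators occur. *)
Lemma Lam_denominator : exists Q : nat, (0 < Q)%N /\ forall x, Lam br K V x -> intv (Q%:R *: x).
Proof.
have [C [c' [C0 Hc]]] := clear_denominators (fun i : 'I_d * 'I_d * 'I_d => c i.1.1 i.1.2 0 i.2).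
have [Q0 [v' [Q00 Hv]]] := clear_denominators (fun i : 'I_(size V) * 'I_d => V`_i.1 0 i.2).
have brI u v : intv u -> intv v -> intv (C%:R *: br u v).
  move=> [u' ->] [v1 ->]; apply: intv_coord => k.
  exists (\sum_i \sum_j u' 0 i * v1 0 j * c' (i, j, k)).
  rewrite mxE lie_brE mulr_sumr rmorph_sum; apply: eq_bigr => i _.
  rewrite mulr_sumr rmorph_sum; apply: eq_bigr => j _.
  by rewrite !mxE !rmorphM /= -Hc /= mulrCA.
have genI x : x \in V -> intv (Q0%:R *: x).
  move=> xV; have := xV; rewrite -index_mem => lt; apply: intv_coord => k.
  by exists (v' (Ordinal lt, k)); rewrite mxE -Hv /= nth_index.
pose N := (C * Q0)%N.
have nestI s : (forall x, x \in s -> x \in V) -> intv ((N ^ size s)%N%:R *: nest br s).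
  elim: s => [|a [|b s] IH] sV; first by rewrite scaler0; apply: intv0.
    rewrite expn1 natrM -scalerA; apply/intvZn/genI/sV; exact: mem_head.
  have [x xs|s' Es] := IH; first by apply: sV; rewrite inE xs orbT.
  have := brI _ _ (genI a (sV a (mem_head _ _))) (ex_intro _ s' Es).
  rewrite (brZl lieL) (brZr lieL) !scalerA -!natrM.
  by rewrite mulnA -/N -expnS.
have znI m x : ZN br V m x -> intv ((N ^ m)%N%:R *: x).
  elim=> [|y z _ Hy _ Hz|y _ Hy|s <- sV].
  - by rewrite scaler0; apply: intv0.
  - by rewrite scalerDr; apply: intvD.
  - by rewrite scalerN; apply: intvN.
  exact: nestI.
set q := (2 * (K.+2)`! * dynkin_den K.+2)%N.
have q0 : (0 < q)%N by rewrite /q muln_gt0 dynkin_den_gt0 andbT muln_gt0 fact_gt0.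
exists (q ^ K * N ^ K)%N; split; first by rewrite muln_gt0 !expn_gt0 q0 muln_gt0 C0 Q00.
move=> x; elim=> [|y z _ Hy _ Hz|m y Hy].
- by rewrite scaler0; apply: intv0.
- by rewrite scalerDr; apply: intvD.
have [lt|le] := ltnP K m.+1; first by rewrite (ZN_nil lt Hy) !scaler0; apply: intv0.
rewrite scalerA; have qQ : q%:R ^+ m != 0 :> rat by rewrite expf_neq0 // pnatr_eq0 -lt0n.
have -> : ((q ^ K * N ^ K)%N%:R / q%:R ^+ m : rat) = (q ^ (K - m) * N ^ (K - m.+1))%N%:R * (N ^
  m.+1)%N%:R.
  rewrite -{1}(subnK (ltnW le)) expnD -[in (N ^ K)%N](subnK le) [(N ^ _)%N]expnD.
  apply: (mulIf qQ); rewrite divfK //; rewrite -natrX -!natrM; congr _%:R; ring.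
by rewrite -scalerA; apply/intvZn/znI.
Qed.

End LatticeDenominators.

Section MalcevLattice.
Variables (G : Grp) (d : nat) (c : 'I_d -> 'I_d -> 'rV[rat]_d) (iota : G -> 'rV[rat]_d).
Hypothesis malcev : is_malcev_lie_algebra c iota.
Local Notation br := (lie_br c).
Local Notation "x ** y" := (bchg br d x y) (at level 40, left associativity).
Let lieL := malcev_lie malcev.
Let nilL := malcev_nil malcev.
Let imG x := exists g, x = iota g.

(** [Lam] contains the generators and is closed under the product, hence contains the group.
    Conversely [Fil_lattice_in], applied to the standard basis, places some [M Z^d] inside the
    group, and [Q Lam] is integral, so [m = M * Q] works. *)
Lemma malcev_lattice : finitely_generated G ->
  exists (Lam : 'rV[rat]_d -> Prop) (Q R m : nat),
  [/\ [/\ (0 < Q)%N, (0 < R)%N & (0 < m)%N],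
      [/\ Lam 0, forall x y, Lam x -> Lam y -> Lam (x + y) & forall x, Lam x -> Lam (- x)],
      [/\ forall x, Lam x -> intv (Q%:R *: x), forall x, intv x -> Lam (R%:R *: x),
          forall g, Lam (iota g) & forall x, Lam x -> exists g, iota g = m%:R *: x]
    & forall k x y x' y', (0 < k)%N -> Lam x -> Lam y -> Lam x' -> Lam y' ->
        Lam (k%:R^-1 *: (x - x')) -> Lam (k%:R^-1 *: (y - y')) ->
        Lam (k%:R^-1 *: (x ** y - x' ** y'))].
Proof.
move=> [gens Hgens]; pose V := [seq iota g | g <- gens].
have [Q [Q0 HQ]] := Lam_denominator lieL nilL V.
have L0 : Lam br d V 0 by apply: Lam_zero.
have LD x y : Lam br d V x -> Lam br d V y -> Lam br d V (x + y) by apply: Lam_add.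
have LN x : Lam br d V x -> Lam br d V (- x) by apply: Lam_opp.
have LG g : Lam br d V (iota g).
  elim: (Hgens g) => {g} [g gs||g h _ Hg _ Hh|g _ Hg].
  - apply: Lam_gen; rewrite /V; elim: gens gs {Hgens V HQ L0 LD LN} => [//|h s IH] /= [->|/IH].
      exact: mem_head.
    by rewrite inE => ->; rewrite orbT.
  - by rewrite (iota1 malcev).
  - by rewrite (iotaM malcev); apply: (Lam_bch lieL nilL).
  by rewrite (iotaV malcev); apply: LN.
have sc (z : int) x : Lam br d V x -> Lam br d V (z%:~R *: x) by apply: subgroup_scale.
have span x : exists R : nat, (0 < R)%N /\ Lam br d V (R%:R *: x).
  apply: (malcev_ind malcev (P := fun x => exists R : nat, (0 < R)%N /\ Lam br d V (R%:R *: x))).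
  - by exists 1%N; rewrite scaler0.
  - move=> u v [R [R0 Hu]] [R' [R0' Hv]]; exists (R * R')%N; rewrite muln_gt0 R0; split=> //.
    rewrite scalerDr natrM mulrC -scalerA mulrC -[in X in _ + X]scalerA.
    by apply: LD; [apply: (sc R'%:Z) | apply: (sc R%:Z)].
  - move=> a u [R [R0 Hu]]; exists (R * `|denq a|)%N; rewrite muln_gt0 R0 absz_gt0 denq_neq0;
    split=> //.
    have -> : (R * `|denq a|)%N%:R *: (a *: u) = (numq a)%:~R *: (R%:R *: u).
      rewrite !scalerA; congr (_ *: _); rewrite natrM natr_absz gtr0_norm ?denq_gt0 //.
      by rewrite -mulrA [_ * a]mulrC -{1}[a]divq_num_den divfK ?intr_eq0 ?denq_neq0 // mulrC.
    exact: (sc _ _).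
  - move=> u v [R [R0 Hu]] [R' [R0' Hv]]; exists (R * R')%N; rewrite muln_gt0 R0; split=> //.
    have := Lam_br lieL Hu Hv; set q := (_ * _)%N => H.
    have := sc q%:Z _ H; rewrite scalerA mulfV.
      by rewrite scale1r (brZl lieL) (brZr lieL) scalerA natrM.
    by rewrite pnatr_eq0 -lt0n /q muln_gt0 dynkin_den_gt0 andbT muln_gt0 fact_gt0.
  by move=> g; exists 1%N; rewrite scale1r.
have [R HR] := seq_choice 0%N (fun j (_ : j \in enum 'I_d) => span (delta_mx 0 j)).
pose Rt := (\prod_j R j)%N.
have SL x : intv x -> Lam br d V (Rt%:R *: x).
  move=> [z ->]; rewrite (row_sum_delta (map_mx intr z)) scaler_sumr; apply: (subgroup_sum L0 LD).
  move=> j _; have [_ HRj] := HR j (mem_enum _ _).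
  rewrite mxE /Rt (bigD1 j) //= mulnC natrM -!scalerA [_ *: (_%:~R *: _)]scalerA [_ * _]mulrC
    -scalerA.
  apply: (sc _%:Z); exact: (sc _ _).
have S0 : imG 0 by exists gone; rewrite (iota1 malcev).
have SM x y : imG x -> imG y -> imG (x ** y).
  by move=> [g ->] [h ->]; exists (gmul g h); rewrite (iotaM malcev).
have SN x : imG x -> imG (- x).
  by move=> [g ->]; exists (ginv g); rewrite (iotaV malcev).
have F1 x : Fil br imG 1 x.
  apply: (malcev_ind malcev (P := Fil br imG 1)).
  - exact: Fil_zero.
  - exact: Fil_add.
  - exact: Fil_scale.
  - by move=> u v Hu Hv; have := Fil_br lieL (ltnSn 0) (ltnSn 0) Hu Hv; apply: Fil_le.
  by move=> g; apply: Fil_S; exists g.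
have [M [M0 HM]] := Fil_lattice_in lieL nilL (bchg_assoc lieL nilL) S0 SM SN
  (fun j => F1 (delta_mx 0 j)).
exists (Lam br d V), Q, Rt, (M * Q)%N; split; [split=> // | split=> // | split=> // | ].
- by apply: prodn_gt0 => j; case: (HR j (mem_enum _ _)).
- by rewrite muln_gt0 M0.
- move=> x /HQ[z ez]; have [g eg] := HM (fun j => z 0 j); exists g.
  rewrite -eg natrM -scalerA ez [in RHS](row_sum_delta (map_mx intr z)) scaler_sumr.
  by apply: eq_bigr => j _; rewrite mxE scalerA rmorphM.
by move=> k x y x' y' k0 Hx Hy Hx' Hy' kx ky; apply: (Lam_bch_congr lieL nilL).
Qed.

End MalcevLattice.

(** * Self-similar actions from virtual endomorphisms *)

Definition propb (P : Prop) : bool := if ClassicalEpsilon.excluded_middle_informative P then true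
  else false.

Lemma propbP P : reflect P (propb P).
Proof. by rewrite /propb; case: ClassicalEpsilon.excluded_middle_informative => h; constructor. Qed.

Section VirtualEndomorphism.
Variables (G : Grp) (H : G -> Prop) (f : G -> G).
Local Notation "x * y" := (gmul x y).
Local Notation "x ^-1" := (ginv x).
Hypotheses (H1 : H gone) (HM : forall x y, H x -> H y -> H (x * y)) (HV : forall x, H x -> H
  (x^-1)).
Hypothesis fM : forall x y, H x -> H y -> f (x * y) = f x * f y.
Variables (C : finType) (code : G -> C).
Hypothesis codeP : forall g h, code g = code h -> H (g^-1 * h).

Lemma ginvM (x y : G) : ginv (x * y) = y^-1 * x^-1.
Proof.
symmetry; apply: ginv_unique; rewrite gmulA -(gmulA x y) gmulgV gmulg1; exact: gmulgV.
Qed.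

Lemma Hmid x y z : H (x^-1 * y) -> H (y^-1 * z) -> H (x^-1 * z).
Proof. by move=> a b; have := HM a b; rewrite -gmulA [y * _]gmulA gmulgV gmul1g. Qed.

Lemma Hsym x y : H (x^-1 * y) -> H (y^-1 * x).
Proof. by move/HV; rewrite ginvM ginvK. Qed.

(** A code attained on the coset of [g], chosen so as to depend only on the coset. The letters are
    the cosets of [H], realised as a finite subset of the codes. *)
Let classC g := [pick c | propb (exists h, code h = c /\ H (g^-1 * h))].

Let classC_some g : exists c, classC g = Some c /\ exists h, code h = c /\ H (g^-1 * h).
Proof.
rewrite /classC; case: pickP => [c /propbP h|/(_ (code g))/propbP[]]; first by exists c.
by exists g; rewrite gmulVg.
Qed.

Let classC_eq g g' : H (g^-1 * g') -> classC g = classC g'.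
Proof.
move=> gg'; rewrite /classC; apply: eq_pick => c; apply/propbP/propbP => -[h [e hh]]; exists h.
  by split=> //; apply: Hmid hh; apply: Hsym.
by split=> //; apply: Hmid hh.
Qed.

Let inI c := propb (exists g, classC g = Some c).
Let A : finType := {c : C | inI c}.

Let cl_ex g : exists a : A, classC g = Some (val a).
Proof.
have [c [e _]] := classC_some g; have Pc : inI c by apply/propbP; exists g.
by exists (exist _ c Pc).
Qed.

Let cl g : A := proj1_sig (ClassicalEpsilon.constructive_indefinite_description _ (cl_ex g)).

Let clE g : classC g = Some (val (cl g)).
Proof. by rewrite /cl; case: ClassicalEpsilon.constructive_indefinite_description. Qed.

Let clP g g' : cl g = cl g' <-> H (g^-1 * g').
Proof.
split=> [e|/classC_eq e]; last by apply/val_inj/Some_inj; rewrite -!clE.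
have [c [ec [h [eh gh]]]] := classC_some g; have [c' [ec' [h' [eh' gh']]]] := classC_some g'.
have ecc : c = c' by apply: Some_inj; rewrite -ec -ec' !clE e.
by apply: Hmid gh _; apply: Hmid (Hsym gh'); apply: codeP; rewrite eh eh'.
Qed.

(** The trivial coset gets the identity as representative, so that an element of [H] fixes the base
    letter and has its image under [f] as state there. *)
Let rep_ex (a : A) : exists g, cl g = a /\ (a = cl gone -> g = gone).
Proof.
case: (eqVneq a (cl gone)) => [->|ne]; first by exists gone.
have /propbP[g eg] := valP a; exists g; split.
  by apply/val_inj/Some_inj; rewrite -clE.
by move=> e; case/eqP: ne.
Qed.

Let r (a : A) : G := proj1_sig (ClassicalEpsilon.constructive_indefinite_description _ (rep_ex a)).

Let clr a : cl (r a) = a.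
Proof. by rewrite /r; case: ClassicalEpsilon.constructive_indefinite_description => g []. Qed.

Let r1 : r (cl gone) = gone.
Proof. by rewrite /r;
  case: ClassicalEpsilon.constructive_indefinite_description => g [_ /= ->]. Qed.

Let img g a := cl (g * r a).
Let kap g a := (r (img g a))^-1 * (g * r a).
Let st g a := f (kap g a).

Let kapH g a : H (kap g a).
Proof. by apply/clP; rewrite clr. Qed.

Let kapE g a : g * r a = r (img g a) * kap g a.
Proof. by rewrite /kap gmulA gmulgV gmul1g. Qed.

Let clM g h h' : cl h = cl h' -> cl (g * h) = cl (g * h').
Proof.
move/clP => e; apply/clP; rewrite ginvM -gmulA (gmulA (g^-1)) gmulVg gmul1g.
exact: e.
Qed.

Let imgM g h a : img (g * h) a = img g (img h a).
Proof. by rewrite /img -gmulA; apply: clM; rewrite clr. Qed.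

Let kapM g h a : kap (g * h) a = kap g (img h a) * kap h a.
Proof.
by rewrite {1 2}/kap imgM -!gmulA -kapE.
Qed.

Let stM g h a : st (g * h) a = st g (img h a) * st h a.
Proof. by rewrite /st kapM fM. Qed.

Let img1 a : img gone a = a.
Proof. by rewrite /img gmul1g clr. Qed.

Let f1 : f gone = gone.
Proof.
have := fM H1 H1; rewrite gmul1g => e; have := congr1 (fun x => (f gone)^-1 * x) e.
by rewrite /= gmulA gmulVg gmul1g => <-.
Qed.

Let st1 a : st gone a = gone.
Proof. by rewrite /st /kap img1 gmul1g gmulVg f1. Qed.

Fixpoint vact (g : G) (w : nat -> A) (n : nat) : A :=
  if n is m.+1 then vact (st g (w 0%N)) (fun k => w k.+1) m else img g (w 0%N).

Let funext (T U : Type) (u v : T -> U) : u =1 v -> u = v.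
Proof. exact: FunctionalExtensionality.functional_extensionality. Qed.

Lemma vact1 w : vact gone w = w.
Proof.
apply: funext => n; elim: n w => [|n IH] w /=; first exact: img1.
by rewrite st1 IH.
Qed.

Lemma vactM g h w : vact (g * h) w = vact g (vact h w).
Proof.
apply: funext => n; elim: n g h w => [|n IH] g h w /=; first exact: imgM.
by rewrite stM IH.
Qed.

Lemma vact_scons g a w : vact g (scons a w) = scons (img g a) (vact (st g a) w).
Proof. by apply: funext => -[]. Qed.

Let agree n (u v : nat -> A) := forall i, (i < n)%N -> u i = v i.

Lemma agree_vact n g u v : agree n u v -> agree n (vact g u) (vact g v).
Proof.
move=> uv i; elim: i n g u v uv => [|i IH] n g u v uv lt /=; first by rewrite uv.
by rewrite uv ?(leq_ltn_trans _ lt) //; apply: (IH n.-1) => [j jn|]; [apply: uv|]; lia.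
Qed.

(** This is the image of the [j]-th iterate of the partial map [f]; the hypothesis [trans] asks it
    to meet every coset of [H]. *)
Fixpoint chain (j : nat) : G -> Prop :=
  if j is k.+1 then fun y => exists x, [/\ chain k x, H x & y = f x] else fun=> True.

Hypothesis trans : forall j g, exists y, chain j y /\ H (y^-1 * g).

Let chainM j x y : chain j x -> chain j y -> chain j (x * y).
Proof.
elim: j x y => [//|j IH] x y [x' [cx Hx ->]] [y' [cy Hy ->]].
by exists (x' * y'); split; [apply: IH | apply: HM | rewrite fM].
Qed.

Let fV x : H x -> f (x^-1) = (f x)^-1.
Proof.
by move=> Hx; apply: ginv_unique; rewrite -fM ?gmulgV ?f1 //; apply: HV.
Qed.

Let chainV j x : chain j x -> chain j (x^-1).
Proof.
elim: j x => [//|j IH] x [x' [cx Hx ->]].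
by exists (x'^-1); split; [apply: IH | apply: HV | rewrite fV].
Qed.

(* An element carrying the letter [a] to the letter [b] is built as
   [p_b * h * p_a^-1] with [p_a], [p_b] moving the base letter; its state at [a]
   is [f h] up to fixed factors on both sides. *)
Lemma vact_transitive n j w u : exists g, chain j g /\ agree n (vact g w) u.
Proof.
elim: n j w u => [|n IH] j w u.
  by have [y [cy _]] := trans j gone; exists y.
have move_base a : exists p, chain j p /\ img p (cl gone) = a.
  have [y [cy Hy]] := trans j (r a); exists y; split=> //.
  by rewrite /img r1 gmulg1 -[RHS]clr; apply/clP.
have [p [cp ep]] := move_base (w 0%N); have [q [cq eq]] := move_base (u 0%N).
have ep' : img (p^-1) (w 0%N) = cl gone by rewrite -ep -imgM gmulVg img1.
pose s2 := st (p^-1) (w 0%N); pose s1 := st q (cl gone).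
(* The induction hypothesis is used one link further: a member of [chain j.+1] is [f h] with [h] in
   [H] and in [chain j], so it is the state of an available element at the base letter. *)
have [y [[h [ch Hh ->]] Hy]] := IH j.+1 (vact s2 (fun k => w k.+1)) (vact (s1^-1) (fun k => u
  k.+1)).
have eh : img h (cl gone) = cl gone.
  by rewrite /img r1 gmulg1; apply/clP; rewrite gmulg1; apply: HV.
have sh : st h (cl gone) = f h.
  have e1 : ginv gone = gone :> G by symmetry; apply: ginv_unique; rewrite gmul1g.
  by rewrite /st /kap eh r1 gmulg1 e1 gmul1g.
exists (q * (h * p^-1)); split; first by apply: chainM => //; apply: chainM => //; apply: chainV.
case=> [_|i lt]; first by rewrite /= !imgM ep' eh.
rewrite -[LHS]/(vact (st (q * (h * p^-1)) (w 0%N)) (fun k => w k.+1) i).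
rewrite !stM imgM ep' eh sh -/s1 -/s2 !vactM.
rewrite (agree_vact s1 Hy lt) -vactM gmulgV vact1 //.
Qed.

Hypothesis free : forall x t : nat -> G,
  (forall k, H ((t k)^-1 * (x k * t k)) /\ x k.+1 = f ((t k)^-1 * (x k * t k))) -> x 0%N = gone.

(** The successive states of [g] along a fixed word each fix the corresponding tail. Each is
    obtained from the previous one by conjugating with a coset representative and applying [f],
    which is the situation ruled out by [free]. *)
Lemma vact_free g w : vact g w = w -> g = gone.
Proof.
move=> e; pose x := fix x k := if k is m.+1 then st (x m) (w m) else g.
have fixx k i : vact (x k) (fun n => w (k + n)%N) i = w (k + i)%N.
  elim: k i => [|k IH] i; first by rewrite /= -[in RHS]e.
  have := IH i.+1; rewrite /= addn0 addSnnS => <-; congr (vact _ _ _).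
  by apply: funext => n; rewrite addnS.
apply: (free (x := x) (t := fun k => r (w k))) => k.
have ew : img (x k) (w k) = w k by have := fixx k 0%N; rewrite /= addn0.
have := kapH (x k) (w k); rewrite /kap ew => Hk; split=> //.
by rewrite /= /st /kap ew.
Qed.

Lemma selfsimilar_of_virtual_endomorphism : freely_densely_self_similar G.
Proof.
exists A; split; first by apply/card_gt0P; exists (cl gone).
exists vact; split; first by split; [exact: vact1 | exact: vactM].
split; first by move=> g a; exists (st g a), (img g a) => w; apply: vact_scons.
split; first by move=> g w; apply: vact_free.
move=> w u; have [g [_ Hg]] := vact_transitive (size u) 0 w (nth (cl gone) u).
exists g; apply: (@eq_from_nth _ (cl gone)); first by rewrite size_map size_iota.
move=> i; rewrite size_map size_iota => lt.
by rewrite (nth_map 0%N) ?size_iota // nth_iota // Hg.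
Qed.

End VirtualEndomorphism.

(** * The virtual endomorphism attached to an invertible derivation *)

Lemma congmxM (N d : nat) (E E' : 'M[rat]_d.+1) : congmx N E -> congmx N E' -> congmx N (E * E').
Proof.
have e (u v : 'M[rat]_d.+1) (n : rat) :
    (1 + n *: u) * (1 + n *: v) = 1 + n *: (u + v + n *: (u * v)).
  by rewrite mulrDl mul1r mulrDr mulr1 -!scalerAl -scalerAr !scalerDr -!addrA; congr (1 + _);
    rewrite addrCA.
move=> [U ->] [V ->]; exists (U + V + N%:R *: (U *m V)).
by rewrite [LHS]e !map_mxD map_mxZ map_mxM rmorph_nat.
Qed.

Lemma congmx1 (N d : nat) : congmx N (1 : 'M[rat]_d.+1).
Proof. by exists 0; rewrite map_mx0 scaler0 addr0. Qed.

Lemma congmxX (N d : nat) (E : 'M[rat]_d.+1) k : congmx N E -> congmx N (E ^+ k).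
Proof. by move=> cE; elim: k => [|k IH]; [apply: congmx1 | rewrite exprS; apply: congmxM]. Qed.

Section VirtualEndomorphismOfDerivation.
Variables (G : Grp) (d' : nat).
Local Notation d := d'.+1.
Variables (c : 'I_d -> 'I_d -> 'rV[rat]_d) (iota : G -> 'rV[rat]_d).
Hypothesis malcev : is_malcev_lie_algebra c iota.
Local Notation br := (lie_br c).
Local Notation "x ** y" := (bchg br d x y) (at level 40, left associativity).
Let lieL := malcev_lie malcev.
Let nilL := malcev_nil malcev.
Let assoc := bchg_assoc lieL nilL.

Variable D : 'M[rat]_d.
Hypothesis derD : is_der c D.

(** With every vector allowed as a generator, the filtration is the lower central series of the Lie
    algebra. *)
Local Notation Fl := (Fil br (fun _ : 'rV[rat]_d => True)).

Lemma Fl1 x : Fl 1 x.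
Proof. exact: Fil_S. Qed.

Lemma Fl_der i x : Fl i x -> Fl i (x *m D).
Proof.
elim=> [|y z _ Hy _ Hz|a y _ Hy|s les _].
- by rewrite mul0mx; apply: Fil_zero.
- by rewrite mulmxDl; apply: Fil_add.
- by rewrite -scalemxAl; apply: Fil_scale.
apply: Fil_le les _; elim: s => [|u [|v s] IH]; first by rewrite mul0mx; apply: Fil_zero.
  exact: Fl1.
rewrite -[nest _ _]/(br u (nest br (v :: s))) derD; apply: Fil_add.
  by apply: (Fil_br lieL (i := 1) (j := size (v :: s))) => //; [exact: Fl1|exact: Fil_base].
by apply: (Fil_br lieL (i := 1) (j := size (v :: s))) => //; exact: Fl1.
Qed.

Lemma Fl_matrix i : exists W : 'M[rat]_d, (W *m D <= W)%MS /\ forall x, (x <= W)%MS <-> Fl i x.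
Proof.
have [|||W HW] := @subspace_matrix _ _ (Fl i); [exact: Fil_zero|exact: Fil_add|exact: Fil_scale|].
exists W; split=> //; apply/row_subP=> j; rewrite row_mul; apply/HW/Fl_der/HW; exact: row_sub.
Qed.

Lemma Fl_bch i x y : (0 < i)%N -> Fl 1 x -> Fl 1 y -> Fl i.+1 (br x y) -> Fl i.+1 (x ** y - (x +
  y)).
Proof.
move=> i0 Hx Hy Hxy; have -> : x ** y - (x + y) = 2^-1 *: br x y + bch_tail br d x y.
  by rewrite (bchg_expand lieL nilL); move: (x + y) => z; rewrite [LHS]addrC !addrA addNr add0r.
apply: Fil_add; first exact: Fil_scale.
apply: (Fil_le (leqnSn _)); exact: (Fil_tail d lieL Hx Hy (ltn0Sn i) Hxy).
Qed.

Lemma Fl_conj i x t : (0 < i)%N -> Fl i x -> Fl i.+1 ((- t) ** (x ** t) - x).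
Proof.
move=> i0 Hx; have H1 : Fl i.+1 (x ** t - (x + t)).
  apply: Fl_bch => //; try exact: Fl1.
  by have := Fil_br lieL i0 (ltnSn 0) Hx (Fl1 t); rewrite addn1.
have H2 : Fl i.+1 (br (- t) (x ** t)).
  have -> : x ** t = (x + (x ** t - (x + t))) + t.
    by rewrite addrAC addrC subrK.
  rewrite (brDr lieL) (brNl lieL t t) (br_xx lieL) oppr0 addr0.
  have Hx' : Fl i (x + (x ** t - (x + t))) by apply: Fil_add => //; apply: Fil_le H1.
  by have := Fil_br lieL (ltnSn 0) i0 (Fl1 (- t)) Hx'; rewrite add1n.
have := Fil_add (Fl_bch i0 (Fl1 _) (Fl1 _) H2) H1; congr (Fl _ _).
move: (x ** t) => v; move: ((- t) ** v) => u; rewrite opprD opprK opprD.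
by rewrite (AC ((1*2)*(1*2)) ((1*5)*((2*6)*(3*4))))/= subrr addNr !addr0.
Qed.

Lemma bchVKg x y : x ** ((- x) ** y) = y.
Proof. by rewrite -assoc (bchgN lieL nilL) (bch0g lieL nilL). Qed.

Variables (Lam : 'rV[rat]_d -> Prop) (Q R m : nat).
Hypotheses (Q0 : (0 < Q)%N) (R0 : (0 < R)%N) (m0 : (0 < m)%N)
  (L0 : Lam 0) (LD : forall x y, Lam x -> Lam y -> Lam (x + y)) (LN : forall x, Lam x -> Lam (- x))
  (LQ : forall x, Lam x -> intv (Q%:R *: x)) (RL : forall x, intv x -> Lam (R%:R *: x))
  (GL : forall g, Lam (iota g)) (LG : forall x, Lam x -> exists g, iota g = m%:R *: x)
  (Lcongr : forall k x y x' y', (0 < k)%N -> Lam x -> Lam y -> Lam x' -> Lam y' ->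
        Lam (k%:R^-1 *: (x - x')) -> Lam (k%:R^-1 *: (y - y')) ->
        Lam (k%:R^-1 *: (x ** y - x' ** y'))).

(** [Q] makes elements of [Lam] integral, [R] brings integral vectors back into [Lam], and [m Lam]
    lies in the group. *)
Let N := (Q * R * m)%N.

Let natQ n : (0 < n)%N -> n%:R != 0 :> rat.
Proof. by rewrite pnatr_eq0 -lt0n. Qed.

Let mL (k : nat) x := Lam (k%:R^-1 *: x).

Let mL_L k x : (0 < k)%N -> mL k x -> Lam x.
Proof.
move=> k0 /(subgroup_scale L0 LD LN k%:Z); rewrite scalerA mulfV ?scale1r //; exact: natQ.
Qed.

Let mLG x : mL m x -> exists g, iota g = x.
Proof. by move=> /LG[g eg]; exists g; rewrite eg scalerA mulfV ?scale1r //; apply: natQ. Qed.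

Let mLN k x : mL k x -> mL k (- x).
Proof. by rewrite /mL scalerN; apply: LN. Qed.

Let mL_bch x y : mL m x -> mL m y -> mL m (x ** y).
Proof.
move=> Hx Hy; have := Lcongr m0 (mL_L m0 Hx) (mL_L m0 Hy) L0 L0.
by rewrite !subr0 (bchg0 lieL nilL) subr0; apply.
Qed.

Let mL_div k x y : (0 < k)%N -> Lam x -> Lam y -> mL k (y - x) -> mL k ((- x) ** y).
Proof.
move=> k0 Hx Hy Hxy; have := Lcongr k0 (LN Hx) Hy (LN Hx) Hx _ Hxy.
by rewrite (bchNg lieL nilL) subr0 subrr scaler0; apply.
Qed.

(** The product respects residue classes modulo [m Lam], so the quotient of [iota g + t] by [iota g]
    lies in [m Lam]: the image of the group is a union of additive cosets of [m Lam]. *)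
Let S_add g t : mL m t -> exists h, iota h = iota g + t.
Proof.
move=> Ht; have [|h eh] := @mLG ((- iota g) ** (iota g + t)).
  by apply: mL_div => //; [apply: LD => //; apply: mL_L Ht | rewrite addrC addKr].
by exists (gmul g h); rewrite (iotaM malcev) eh bchVKg.
Qed.

Let cong_mL E x : congmx N E -> Lam x -> mL m (x *m E - x).
Proof.
move=> [E' ->] Hx; rewrite mulmxDr mulmx1 addrAC subrr add0r /mL.
rewrite -scalemxAr scalerA /N natrM mulrC mulfK ?natQ // natrM mulrC -scalerA scalemxAl.
by apply/RL/intvM/LQ.
Qed.

Let cong_L E x : congmx N E -> Lam x -> Lam (x *m E).
Proof.
by move=> cE Hx; rewrite -[_ *m _](subrK x); apply: LD => //; apply: (mL_L m0); apply: cong_mL.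
Qed.

Let cong_S E g : congmx N E -> exists h, iota h = iota g *m E.
Proof.
by move=> cE; have [h eh] := S_add g (cong_mL cE (GL g)); exists h; rewrite eh addrC subrK.
Qed.

Variables a b A B : 'M[rat]_d.
Hypotheses (ca : congmx N a) (cb : congmx N b) (cA : congmx N A) (cB : congmx N (1 + B))
  (ua : a \in unitmx) (ub : b \in unitmx) (bez : a * A + b * B = 1)
  (gencomm : forall E, E \in [:: a; b; A; B] ->
     (forall E', E' \in [:: a; b; A; B] -> E * E' = E' * E) /\
     (forall W : 'M_d, (W *m D <= W)%MS -> (W *m E <= W)%MS))
  (autF : forall x y, br x y *m (a * b^-1) = br (x *m (a * b^-1)) (y *m (a * b^-1)))
  (NF : forall (W : 'M_d) (q : nat) x, (W *m D <= W)%MS -> (0 < q)%N ->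
      (forall k, exists y, (exists y' : 'rV[int]_d, q%:R *: y = map_mx intr y') /\
         (x - y *m b ^+ k <= W)%MS) -> (x <= W)%MS).

(** All auxiliary operators are taken from this commutative ring, whose elements preserve [Lam], its
    multiples and every term of the lower central series. *)
Inductive Alg : 'M[rat]_d -> Prop :=
| Alg_one : Alg 1
| Alg_gen E : E \in [:: a; b; A; B] -> Alg E
| Alg_add E E' : Alg E -> Alg E' -> Alg (E + E')
| Alg_opp E : Alg E -> Alg (- E)
| Alg_mul E E' : Alg E -> Alg E' -> Alg (E * E').

Lemma Alg_comm E E' : Alg E -> Alg E' -> GRing.comm E E'.
Proof.
move=> HE HE'; elim: HE => {E} [|E Eg|E F _ HE _ HF|E _ HE|E F _ HE _ HF].
- exact: commr_sym (commr1 _).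
- elim: HE' => {E'} [|E' Eg'|E' F' _ HE _ HF|E' _ HE|E' F' _ HE _ HF].
  + exact: commr1.
  + exact: (gencomm Eg).1.
  + exact: commrD.
  + exact: commrN.
  + exact: commrM.
- by apply: commr_sym; apply: commrD; apply: commr_sym.
- by apply: commr_sym; apply: commrN; apply: commr_sym.
by apply: commr_sym; apply: commrM; apply: commr_sym.
Qed.

Lemma Alg_exp E k : Alg E -> Alg (E ^+ k).
Proof. by move=> HE; elim: k => [|k IH]; [apply: Alg_one | rewrite exprS; apply: Alg_mul]. Qed.

Lemma Alg_sum (I : Type) (r : seq I) F : (forall i : I, Alg (F i)) -> Alg (\sum_(i <- r) F i).
Proof.
move=> H; apply: (big_ind Alg) => //; last exact: Alg_add.
by rewrite -(subrr 1); apply: Alg_add; [|apply: Alg_opp]; apply: Alg_one.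
Qed.

Let ga : Alg a. Proof. by apply: Alg_gen; rewrite !inE eqxx. Qed.
Let gb : Alg b. Proof. by apply: Alg_gen; rewrite !inE eqxx orbT. Qed.
Let gA : Alg A. Proof. by apply: Alg_gen; rewrite !inE eqxx !orbT. Qed.
Let gB : Alg B. Proof. by apply: Alg_gen; rewrite !inE eqxx !orbT. Qed.

Lemma Alg_L E x : Alg E -> Lam x -> Lam (x *m E).
Proof.
move=> HE; elim: HE x => {E} [|E Eg|E F _ HE _ HF|E _ HE|E F _ HE _ HF] x Hx.
- by rewrite mulmx1.
- move: Eg; rewrite !inE => /or4P[] /eqP ->; try exact: cong_L.
  have := LD (cong_L cB Hx) (LN Hx); congr (Lam _).
  by rewrite mulmxDr mulmx1 addrAC subrr add0r.
- by rewrite mulmxDr; apply: LD; [apply: HE|apply: HF].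
- by rewrite mulmxN; apply/LN/HE.
by rewrite mulmxA; apply/HF/HE.
Qed.

Lemma Alg_mL E k x : Alg E -> mL k x -> mL k (x *m E).
Proof. by move=> HE; rewrite /mL scalemxAl; apply: Alg_L. Qed.

Lemma Alg_Fl E i x : Alg E -> Fl i x -> Fl i (x *m E).
Proof.
move=> HE; have [W [WD HW]] := Fl_matrix i; have WE : (W *m E <= W)%MS.
  elim: HE => {E} [|E Eg|E F _ HE _ HF|E _ HE|E F _ HE _ HF].
  - by rewrite mulmx1.
  - exact: (gencomm Eg).2.
  - by rewrite mulmxDr; apply: addmx_sub.
  - by rewrite mulmxN eqmx_opp.
  by rewrite mulmxA; apply: submx_trans HF; apply: submxMr.
by move=> /HW xW; apply/HW; apply: submx_trans WE; apply: submxMr.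
Qed.

Let F := a * b^-1.
Let F' := b * a^-1.

Let uar : a \is a GRing.unit. Proof. exact: ua. Qed.
Let ubr : b \is a GRing.unit. Proof. exact: ub. Qed.
Let VaC E : Alg E -> GRing.comm a^-1 E.
Proof. by move=> HE; apply: commr_sym; apply: commrV; apply: Alg_comm. Qed.
Let FF' : F * F' = 1.
Proof. by rewrite /F /F' -mulrA mulKr // mulrV. Qed.
Let F'F : F' * F = 1.
Proof. by rewrite /F /F' -mulrA mulKr // mulrV. Qed.

Let F_bch x y : (x ** y) *m F = (x *m F) ** (y *m F).
Proof.
apply: (bchg_morph (phi := mulmx^~ F)) => [z u v|u v]; first by rewrite mulmxDl -scalemxAl.
exact: autF.
Qed.

Let F'_bch i x y : (x ** y) *m F' ^+ i = (x *m F' ^+ i) ** (y *m F' ^+ i).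
Proof.
elim: i x y => [|i IH] x y; first by rewrite expr0 !mulmx1.
have k (z : 'rV_d) : z *m F' *m F = z by rewrite -mulmxA [X in _ *m X]F'F mulmx1.
have k' (z : 'rV_d) : z *m F *m F' = z by rewrite -mulmxA [X in _ *m X]FF' mulmx1.
have e := F_bch (x *m F') (y *m F'); rewrite !k in e.
have E (z : 'rV_d) : z *m F' ^+ i.+1 = z *m F' *m F' ^+ i by rewrite exprS mulmxA.
by rewrite !E -IH; congr (_ *m _); rewrite -e k'.
Qed.

Definition endo_dom g := exists g', iota g' = iota g *m F.
Definition endo g := ClassicalEpsilon.epsilon (inhabits gone) (fun g' => iota g' = iota g *m F).

Lemma endoE g : endo_dom g -> iota (endo g) = iota g *m F.
Proof. exact: ClassicalEpsilon.epsilon_spec. Qed.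

Lemma endo_dom1 : endo_dom gone.
Proof. by exists gone; rewrite (iota1 malcev) mul0mx. Qed.

Lemma endo_domM g h : endo_dom g -> endo_dom h -> endo_dom (gmul g h).
Proof. by move=> [g' eg] [h' eh]; exists (gmul g' h'); rewrite !(iotaM malcev) F_bch eg eh. Qed.

Lemma endo_domV g : endo_dom g -> endo_dom (ginv g).
Proof. by move=> [g' eg]; exists (ginv g'); rewrite !(iotaV malcev) mulNmx eg. Qed.

Lemma endoM g h : endo_dom g -> endo_dom h -> endo (gmul g h) = gmul (endo g) (endo h).
Proof.
move=> Hg Hh; apply: (iota_inj malcev); rewrite (iotaM malcev) !endoE //; last exact: endo_domM.
by rewrite (iotaM malcev) F_bch.
Qed.

Lemma endo_dom_finite_index : exists (C : finType) (code : G -> C),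
  forall g h, code g = code h -> endo_dom (gmul (ginv g) h).
Proof.
have [Db [e [Db0 He]]] := clear_denominators (fun i : 'I_d * 'I_d => (b^-1 : 'M_d) i.1 i.2).
pose E' : 'M[int]_d := \matrix_(i, j) e (i, j).
have EE' : Db%:R *: (b^-1 : 'M_d) = map_mx intr E'.
  by apply/matrixP=> i j; rewrite !mxE -He.
(* [Db] is a denominator of [b^-1], and [k] is chosen so that [F] maps [k Lam] into [m Lam].
   Agreement of the integral coordinates of [Q iota g] modulo [T = Q R k] means agreement of
   [iota g] modulo [k Lam]. *)
pose k := (Q * R * m * Db)%N; have k0 : (0 < k)%N by rewrite !muln_gt0 Q0 R0 m0.
pose T := (Q * R * k)%N; have T0 : (0 < T)%N by rewrite muln_gt0 k0 andbT muln_gt0 Q0 R0.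
pose co (g : G) j : int := numq ((Q%:R *: iota g) 0 j).
have coE g j : (co g j)%:~R = (Q%:R *: iota g) 0 j.
  by have [z ez] := LQ (GL g); rewrite /co ez mxE numq_int.
exists {ffun 'I_d -> 'I_T.+1}, (fun g => [ffun j => inord `|(co g j %% T)%Z|]) => g h e1.
have TZ : T%:Z != 0 by move: T0; clearbody T; lia.
have cod j : exists z : int, co h j - co g j = z * T%:Z.
  have := congr1 (fun u : {ffun 'I_d -> 'I_T.+1} => nat_of_ord (u j)) e1; rewrite !ffunE.
  have lt u : (`|(co u j %% T)%Z| < T.+1)%N.
    have := ltz_mod (co u j) TZ; have := modz_ge0 (co u j) TZ; lia.
  rewrite !inordK // => e2; exists ((co h j %/ T)%Z - (co g j %/ T)%Z).
  rewrite {1}(divz_eq (co h j) T) {1}(divz_eq (co g j) T).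
  have := modz_ge0 (co g j) TZ; have := modz_ge0 (co h j) TZ; move: e2.
  move: (co h j %% T)%Z (co g j %% T)%Z (co h j %/ T)%Z (co g j %/ T)%Z => u v w t; nia.
have dif : mL k (iota h - iota g).
  have [z Hz] := fin_all_exists cod.
  have : intv ((\row_j (z j)%:~R) : 'rV[rat]_d) by exists (\row_j z j); apply/rowP=> j;
    rewrite !mxE.
  move/RL; rewrite /mL; congr (Lam _); apply/rowP=> j;
    have := congr1 (fun u : int => u%:~R : rat) (Hz j).
  rewrite rmorphB rmorphM /= !coE !mxE => e2.
  have -> : iota h 0 j - iota g 0 j = R%:R * k%:R * (z j)%:~R.
    apply: (mulfI (natQ Q0)); rewrite mulrBr e2 -pmulrn natrM [(Q * R)%:R]natrM;
      move: (k%:R : rat) => kk; ring.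
  by have := natQ k0; move: (k%:R : rat) => kk kk0; field.
have H : mL k (iota (gmul (ginv g) h)).
  by rewrite (iotaM malcev) (iotaV malcev); apply: mL_div.
apply: mLG; rewrite /F /mL; have := RL (intvM E' (LQ (Alg_L ga H))).
congr (Lam _); move: (iota _) => v; have -> : v *m (a * b^-1) = v *m a *m b^-1 by rewrite mulmxA.
rewrite -EE' -!scalemxAl -scalemxAr !scalerA; congr (_ *: _).
rewrite /k !natrM; have := natQ Q0; have := natQ R0; have := natQ m0; have := natQ Db0.
by move=> n1 n2 n3 n4; field; rewrite n1 n2 n3 n4.
Qed.

(** A convenient part of [chain j]: the successive preimages under [F] are each required to lie in
    the group, a condition visibly closed under products. *)
Definition deep j g := forall i, (i <= j)%N -> exists h, iota h = iota g *m F' ^+ i.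

Lemma deep_chain j g : deep j g -> chain endo_dom endo j g.
Proof.
elim: j g => [//|j IH] g dg /=; have [h eh] := dg 1%N isT; rewrite expr1 in eh.
have hF : iota g = iota h *m F by rewrite eh -mulmxA [X in _ *m X]F'F mulmx1.
have dh : endo_dom h by exists g.
exists h; split=> //; last by apply: (iota_inj malcev); rewrite endoE.
apply: IH => i ij; have [h' eh'] := dg i.+1 ij; exists h'.
by rewrite eh' eh -mulmxA exprS.
Qed.

Lemma deepM j g h : deep j g -> deep j h -> deep j (gmul g h).
Proof.
move=> dg dh i ij; have [g' eg] := dg i ij; have [h' eh] := dh i ij.
by exists (gmul g' h'); rewrite !(iotaM malcev) F'_bch eg eh.
Qed.

Lemma deep1 j : deep j gone.
Proof. by move=> i _; exists gone; rewrite (iota1 malcev) mul0mx. Qed.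

(** Each [F' = b a^-1] trades a factor [a] for a factor [b], so the [j] factors [a] pay for up to
    [j] preimages without leaving [Alg]. *)
Lemma pow_F' i j : (i <= j)%N -> a ^+ j * A ^+ j * F' ^+ i = a ^+ (j - i) * A ^+ j * b ^+ i.
Proof.
move=> ij; have cba : GRing.comm b a^-1 by apply: commr_sym; apply: VaC.
rewrite /F' exprMn_comm // mulrA; have cA' : GRing.comm (A ^+ j * b ^+ i) (a^-1 ^+ i).
  by apply: commr_sym; apply: commr_sym; apply: commrX; apply: commr_sym; apply: VaC;
    apply: Alg_mul; apply: Alg_exp.
rewrite -[a ^+ j * _ * _]mulrA -mulrA cA' mulrA -{1}(subnK ij) exprD exprVn.
by rewrite mulrK ?unitrX // mulrA.
Qed.

(** [1 - a A = b B] divides [1 - (a A)^j] through the geometric sum. *)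
Lemma bezout_power j : exists B', Alg B' /\ a ^+ j * A ^+ j + b * B' = 1.
Proof.
exists (B * \sum_(i < j) (a * A) ^+ i); split.
  by apply: Alg_mul => //; apply: Alg_sum => i; apply: Alg_exp; apply: Alg_mul.
rewrite -exprMn_comm; last exact: Alg_comm.
have -> : b * (B * \sum_(i < j) (a * A) ^+ i) = (1 - a * A) * \sum_(i < j) (a * A) ^+ i.
  by rewrite -bez addrAC subrr add0r mulrA.
by rewrite -opprB mulNr -subrX1 opprB addrC subrK.
Qed.

(* [x P1] is in [deep j] and [x (1 - P1)] in the domain, where [P1 = a^j A^j]; the
   two pieces multiply to [x] up to an error in the next term of the lower central
   series. *)
Lemma lattice_decomposition j i x : (0 < i)%N -> Fl i x -> mL m x ->
  exists g h, [/\ deep j g, endo_dom h & x = iota g ** iota h].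
Proof.
have [n] := ubnP (d.+1 - i); elim: n i x => // n IH i x lt i0 Hx mx.
have [di|di] := ltnP d i.
  exists gone, gone; split; [exact: deep1|exact: endo_dom1|].
  by rewrite (Fil_nil nilL di Hx) (iota1 malcev) (bchg0 lieL nilL).
have [B' [gB' e]] := bezout_power j; set P1 := a ^+ j * A ^+ j in e.
have gP1 : Alg P1 by apply: Alg_mul; apply: Alg_exp.
have gP2 : Alg (b * B') by apply: Alg_mul.
have [g1 eg1] := mLG (Alg_mL gP1 mx); have [h1 eh1] := mLG (Alg_mL gP2 mx).
have d1 : deep j g1.
  move=> k kj; rewrite eg1; have gk : Alg (a ^+ (j - k) * A ^+ j * b ^+ k).
    by apply: Alg_mul; [apply: Alg_mul|]; apply: Alg_exp.
  have [h eh] := mLG (Alg_mL gk mx); exists h.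
  by rewrite eh -[RHS]mulmxA [X in _ = _ *m X](pow_F' kj).
have e1 : endo_dom h1.
  have gk : Alg (B' * a) by apply: Alg_mul.
  have [h eh] := mLG (Alg_mL gk mx); exists h; rewrite eh eh1 -mulmxA; congr (_ *m _).
  rewrite -[RHS]/(b * B' * F) /F mulrA -(mulrA b) (Alg_comm gb gk).
  by rewrite mulrK.
set x1 := x *m P1 in eg1; set x2 := x *m (b * B') in eh1.
have ex : x1 + x2 = x by rewrite -mulmxDr e mulmx1.
have F1 : Fl i x1 by apply: Alg_Fl.
have F2 : Fl i x2 by apply: Alg_Fl.
have ii : (i.+1 <= i + i)%N by rewrite -addn1 leq_add2l.
have G1 : Fl i.+1 ((- x1) ** x - x2).
  have e4 : - x1 + x = x2.
    by rewrite addrC; apply/eqP; rewrite subr_eq addrC eq_sym; apply/eqP.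
  have := Fl_bch i0 (Fl1 (- x1)) (Fl1 x); rewrite e4; apply.
  by apply: (Fil_le ii); apply: (Fil_br lieL) => //; apply: Fil_opp.
have G2 : Fl i.+1 (((- x1) ** x) ** (- x2)).
  have F3 : Fl i ((- x1) ** x).
    by rewrite -[_ ** _](subrK x2); apply: Fil_add => //; apply: Fil_le G1.
  have := Fl_bch i0 (Fl1 ((- x1) ** x)) (Fl1 (- x2)).
  move=> /(_ (Fil_le ii (Fil_br lieL i0 i0 F3 (Fil_opp F2)))) H.
  by rewrite -[_ ** (- x2)](subrK (((- x1) ** x) - x2)); apply: Fil_add.
have m3 : mL m (((- x1) ** x) ** (- x2)).
  apply: mL_bch; last by apply: mLN; rewrite /x2; apply: Alg_mL.
  by apply: mL_bch => //; apply: mLN; apply: Alg_mL.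
have lt' : (d.+1 - i.+1 < n)%N by lia.
have [g2 [h2 [d2 e2 E]]] := IH _ _ lt' (ltn0Sn i) G2 m3.
exists (gmul g1 g2), (gmul h2 h1); split; [exact: deepM|exact: endo_domM|].
rewrite !(iotaM malcev) eg1 eh1 assoc -(assoc (iota g2)) -E assoc (bchNg lieL nilL) (bchg0 lieL
  nilL).
by rewrite bchVKg.
Qed.

(** [lattice_decomposition] handles elements of [m Lam] only. The group element [y0] at
    [iota g *m (a^j A^j)] is already deep and agrees with [g] modulo [m Lam], because that operator
    is congruent to 1; the quotient is then decomposed. *)
Lemma endo_chain j g : exists y, chain endo_dom endo j y /\ endo_dom (gmul (ginv y) g).
Proof.
have cP k i : congmx N (a ^+ k * A ^+ j * b ^+ i).
  by apply: congmxM; [apply: congmxM|]; apply: congmxX.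
have [y0 e0] := cong_S g (cP j 0%N); rewrite expr0 mulr1 in e0.
have D0 : deep j y0.
  move=> i ij; have [h eh] := cong_S g (cP (j - i)%N i); exists h.
  by rewrite eh e0 -[RHS]mulmxA [X in _ = _ *m X](pow_F' ij).
have dif : mL m (iota g - iota y0).
  rewrite -opprB; apply: mLN; have := cong_mL (cP j 0%N) (GL g).
  by rewrite expr0 mulr1 -e0.
have [y [h [dy dh E]]] := lattice_decomposition j (ltnSn 0) (Fl1 _) (mL_div m0 (GL y0) (GL g) dif).
exists (gmul y0 y); split; first by apply/deep_chain/deepM.
rewrite ginvM -gmulA; have -> : gmul (ginv y0) g = gmul y h.
  by apply: (iota_inj malcev); rewrite !(iotaM malcev) (iotaV malcev).
by rewrite gmulKg.
Qed.

(** With [B'] from [bezout_power], [1 - b B' = a^k A^k], so [1 - (b B')^k] is still a multiple of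
    [a^k]. *)
Lemma bezout_power2 k : exists E E', [/\ Alg E, Alg E' & a ^+ k * E + b ^+ k * E' = 1].
Proof.
have [B' [gB' e]] := bezout_power k; have gP : Alg (a ^+ k * A ^+ k) by apply: Alg_mul;
  apply: Alg_exp.
have e1 : b * B' = 1 - a ^+ k * A ^+ k by rewrite -e addrAC subrr add0r.
exists (A ^+ k * \sum_(i < k) (b * B') ^+ i), (B' ^+ k); split.
- apply: Alg_mul; first exact: Alg_exp.
  by apply: Alg_sum => i; apply: Alg_exp; apply: Alg_mul.
- exact: Alg_exp.
rewrite -exprMn_comm; last exact: Alg_comm.
have -> : a ^+ k * (A ^+ k * \sum_(i < k) (b * B') ^+ i) = (1 - b * B') * \sum_(i < k) (b * B')
  ^+ i.
  by rewrite -[in RHS]e addrK mulrA.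
by rewrite -opprB mulNr -subrX1 opprB subrK.
Qed.

(** Modulo the next term of the series the conjugations by [t k] disappear, which leaves
    [x_k b^k = x_0 a^k]. Then [x_0 = x_0 (a^k U + b^k U')] equals [(x_k U + x_0 U') b^k], with a
    left factor in [Lam], for every [k]; such divisibility forces [x_0] into that term. *)
Lemma endo_free (x t : nat -> G) :
  (forall k, endo_dom (gmul (ginv (t k)) (gmul (x k) (t k))) /\
     x k.+1 = endo (gmul (ginv (t k)) (gmul (x k) (t k)))) -> x 0%N = gone.
Proof.
move=> H; suff : Fl d.+1 (iota (x 0%N)).
  by move/(Fil_nil nilL (ltnSn d)) => e; apply: (iota_inj malcev); rewrite e (iota1 malcev).
move: x t H; suff gen i (x t : nat -> G) : (forall k,
    endo_dom (gmul (ginv (t k)) (gmul (x k) (t k))) /\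
    x k.+1 = endo (gmul (ginv (t k)) (gmul (x k) (t k)))) -> Fl i.+1 (iota (x 0%N)).
  by move=> x t; apply: gen.
elim: i x t => [|i IH] x t H; first exact: Fl1.
have Fx k : Fl i.+1 (iota (x k)).
  have := IH (fun n => x (n + k)%N) (fun n => t (n + k)%N); apply => n.
  by have := H (n + k)%N; rewrite addSn.
have stab E y : Alg E -> Fl i.+2 y -> Fl i.+2 (y *m E) by apply: Alg_Fl.
have E k : Fl i.+2 (iota (x k) *m b ^+ k - iota (x 0%N) *m a ^+ k).
  elim: k => [|k IHk]; first by rewrite !expr0 !mulmx1 subrr; apply: Fil_zero.
  have [dk ->] := H k; rewrite endoE // !(iotaM malcev) (iotaV malcev).
  have := Fl_conj (iota (t k)) (ltn0Sn i) (Fx k); set u := (- _) ** _ => He.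
  have Fb : F * b ^+ k.+1 = b ^+ k * a.
    by rewrite /F exprS -mulrA mulKr // (Alg_comm ga (Alg_exp k gb)).
  rewrite -mulmxA [X in _ *m X]Fb exprSr -[b ^+ k * a]/(b ^+ k *m a) -[a ^+ k * a]/(a ^+ k *m a)
    !mulmxA -mulmxBl.
  apply: (stab a _ ga); have := Fil_add (stab (b ^+ k) _ (Alg_exp k gb) He) IHk.
  by rewrite mulmxBl addrA subrK.
have [W [WD HW]] := Fl_matrix i.+2; apply/HW; apply: (NF WD Q0) => k.
have [U [U' [gU gU' e]]] := bezout_power2 k.
exists (iota (x k) *m U + iota (x 0%N) *m U'); split.
  by apply: LQ; apply: LD; apply: Alg_L.
apply/HW; have cU := Alg_comm (Alg_exp k gb) gU; have cU' := Alg_comm (Alg_exp k gb) gU'.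
have -> : iota (x 0%N) - (iota (x k) *m U + iota (x 0%N) *m U') *m b ^+ k =
    - ((iota (x k) *m b ^+ k - iota (x 0%N) *m a ^+ k) *m U).
  rewrite -{1}[iota (x 0%N)]mulmx1 -[1%:M]/(1 : 'M_d) -e mulmxDr mulmxDl mulmxBl opprB.
  have cc V (z : 'rV_d) : GRing.comm (b ^+ k) V -> z *m V *m b ^+ k = z *m b ^+ k *m V.
    by move=> cV; rewrite -[LHS]mulmxA -[RHS]mulmxA; congr (_ *m _); exact: esym cV.
  rewrite !cc // !mulmxA.
  by rewrite opprD addrACA subrr addr0.
by apply: Fil_opp; apply: stab.
Qed.

Lemma selfsimilar_of_derivation : freely_densely_self_similar G.
Proof.
have [C [code codeP]] := endo_dom_finite_index.
exact: (selfsimilar_of_virtual_endomorphism endo_dom1 endo_domM endo_domV endoM codeP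
  endo_chain endo_free).
Qed.

End VirtualEndomorphismOfDerivation.

Theorem selfsimilar_of_grading (G : Grp) (d : nat) (c : 'I_d -> 'I_d -> 'rV[rat]_d)
    (iota : G -> 'rV[rat]_d) :
  is_malcev_lie_algebra c iota -> finitely_generated G ->
  very_special_grading (complexify c) -> freely_densely_self_similar G.
Proof.
case: d c iota => [|d'] c iota malcev fg grading.
  (* In dimension 0 the group is trivial; the whole group serves as the domain, which leaves a
     single letter. *)
  have triv (g : G) : g = gone by apply: (iota_inj malcev); rewrite [LHS]thinmx0 [RHS]thinmx0.
  apply: (@selfsimilar_of_virtual_endomorphism G (fun=> True) id _ _ _ _ unit (fun=> tt)) => //.
  by move=> j g; exists gone; split=> //; elim: j => [//|j IH]; exists gone.
pose phi : {rmorphism rat -> Cplx} := (ratr : rat -> Rdefinitions.R[i]).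
have natC : injective (fun n : nat => n%:R : Cplx) := @natr_inj Rdefinitions.R[i].
have [DC [derC detC]] := derivation_of_grading natC grading.
have [D [derD detD]] := rational_derivation (phi := phi) natC derC detC.
have [Lam [Q [R [m [[Q0 R0 m0] [L0 LD LN] [LQ RL GL LG] Lcongr]]]]] := malcev_lattice malcev fg.
have N0 : (0 < Q * R * m)%N by rewrite !muln_gt0 Q0 R0.
have [a [b [A [B [[ca cb cA cB] [ua ub bez] comm autF NF]]]]] := commuting_pair derD detD N0.
exact: (selfsimilar_of_derivation malcev derD Q0 R0 m0 L0 LD LN LQ RL GL LG Lcongr
  ca cb cA cB ua ub bez comm autF NF).
Qed.

Theorem theorem3 (G : Grp) :
  finitely_generated G -> torsion_free G -> nilpotent_group G ->
  forall (d : nat) (c : 'I_d -> 'I_d -> 'rV[rat]_d) (iota : G -> 'rV[rat]_d),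
    is_malcev_lie_algebra c iota ->
    (freely_self_similar G <-> freely_densely_self_similar G) /\
    (freely_densely_self_similar G <-> very_special_grading (complexify c)).
Proof.
move=> fg _ _ d c iota malcev.
have ds : freely_densely_self_similar G -> freely_self_similar G.
  by move=> [A [A0 [act [actP [ss [free _]]]]]]; exists A; split=> //; exists act.
have gr := grading_of_selfsimilar malcev; have sg := selfsimilar_of_grading malcev fg.
by split; split; auto.
Qed.
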